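(* For $|q|<1$, \begin{align*} f(q)&=-\sum_{n=1}^{\infty}(-1,-1;q)_nq^{n}+4\frac{(-q;q)^2_{\infty}}{(q;q)^3_{\infty}}\sum_{r=-\infty}^{\infty}\frac{q^{2r^2+r}(4rq^r+1)}{(1+q^r)^2},\\ \phi(q)&=-\sum_{n=1}^{\infty}(-1;q^2)_nq^{n}+4\frac{(-q^2;q^2)_{\infty}}{(q;q)^3_{\infty}}\sum_{r=-\infty}^{\infty}\frac{q^{2r^2+2r}(2rq^{2r}+1)}{(1+q^{2r})^2},\\ \nu(q)&=-\sum_{n=0}^{\infty}(-q;q^2)_nq^{n}+4\frac{(-q;q^2)_{\infty}}{(q;q)^3_{\infty}}\sum_{r=-\infty}^{\infty}\frac{q^{2r^2+2r}(r+1)}{(1+q^{2r+1})^2}-2\frac{(-q;q^2)_{\infty}}{(q;q)^3_{\infty}}(-q^4,-q^{12},q^{16};q^{16})_{\infty},\\ \psi(q)&=-\sum_{n=0}^{\infty}(q;q^2)_n(-1)^{n}+\frac{1}{2(q^2;q^2)^2_{\infty}}\sum_{r=-\infty}^{\infty}q^{2r^2+r}(4r+1)(-1)^r, \end{align*} where in the last identity the series $\sum_{n\ge0}(q;q^2)_n(-1)^n$ is summed in the Cesàro sense (limit of the arithmetic means of its partial sums).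
   Context: For $n\ge 0$, $(a;q)_n=\prod_{j=0}^{n-1}(1-aq^j)$, $(a;q)_\infty=\prod_{j\ge0}(1-aq^j)$, and for negative index $(a;q)_{-n}=1/(aq^{-n};q)_n$. Also $(a_1,\dots,a_k;q)_n=(a_1;q)_n\cdots(a_k;q)_n$ (same for $n=\infty$). The third order mock theta functions: $f(q)=\sum_{n\ge0}\frac{q^{n^2}}{(-q;q)_n^2}$, $\phi(q)=\sum_{n\ge0}\frac{q^{n^2}}{(-q^2;q^2)_n}$, $\psi(q)=\sum_{n\ge1}\frac{q^{n^2}}{(q;q^2)_n}$, $\nu(q)=\sum_{n\ge0}\frac{q^{n^2+n}}{(-q;q^2)_{n+1}}$. *)

(* Defs.v *)
From Stdlib Require Import Reals ZArith.
Open Scope R_scope.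

Record Cx : Type := mkC { Re : R ; Im : R }.

Definition RtoC (x : R) : Cx := mkC x 0.
Definition ZtoC (z : Z) : Cx := RtoC (IZR z).
Definition Cx0 : Cx := RtoC 0.
Definition Cx1 : Cx := RtoC 1.
Definition Cadd (z w : Cx) : Cx := mkC (Re z + Re w) (Im z + Im w).
Definition Copp (z : Cx) : Cx := mkC (- Re z) (- Im z).
Definition Csub (z w : Cx) : Cx := Cadd z (Copp w).
Definition Cmul (z w : Cx) : Cx :=
  mkC (Re z * Re w - Im z * Im w) (Re z * Im w + Im z * Re w).
Definition Cinv (z : Cx) : Cx :=
  mkC (Re z / (Re z * Re z + Im z * Im z)) (- Im z / (Re z * Re z + Im z * Im z)).
Definition Cdiv (z w : Cx) : Cx := Cmul z (Cinv w).
Definition Cnorm (z : Cx) : R := sqrt (Re z * Re z + Im z * Im z).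

Fixpoint Cpow (z : Cx) (n : nat) : Cx :=
  match n with O => Cx1 | S m => Cmul z (Cpow z m) end.
(* z ^ k for k : Z (negative powers via the inverse; only used for z <> 0) *)
Definition Cpowz (z : Cx) (k : Z) : Cx :=
  match k with
  | Z0 => Cx1
  | Zpos p => Cpow z (Pos.to_nat p)
  | Zneg p => Cinv (Cpow z (Pos.to_nat p))
  end.

Fixpoint Csum (f : nat -> Cx) (n : nat) : Cx :=
  match n with O => Cx0 | S m => Cadd (Csum f m) (f m) end.
Fixpoint Cprod (f : nat -> Cx) (n : nat) : Cx :=
  match n with O => Cx1 | S m => Cmul (Cprod f m) (f m) end.

Definition qpoch (a q : Cx) (n : nat) : Cx :=
  Cprod (fun j => Csub Cx1 (Cmul a (Cpow q j))) n.

Definition Cseq_cv (u : nat -> Cx) (l : Cx) : Prop :=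
  forall eps : R, eps > 0 ->
    exists N : nat, forall n : nat, (n >= N)%nat -> Cnorm (Csub (u n) l) < eps.

Definition Cseries_cv (a : nat -> Cx) (l : Cx) : Prop :=
  Cseq_cv (fun N => Csum a N) l.

Definition qpoch_inf_cv (a q : Cx) (P : Cx) : Prop :=
  Cseq_cv (fun n => qpoch a q n) P.

Definition Cbiseries_cv (a : Z -> Cx) (l : Cx) : Prop :=
  exists l1 l2 : Cx,
    Cseries_cv (fun n => a (Z.of_nat n)) l1 /\
    Cseries_cv (fun n => a (- Z.of_nat (S n))%Z) l2 /\
    l = Cadd l1 l2.

Definition Ccesaro_cv (a : nat -> Cx) (l : Cx) : Prop :=
  Cseq_cv (fun N => Cdiv (Csum (fun k => Csum a (S k)) (S N)) (RtoC (INR (S N)))) l.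

Declare Scope C_scope.
Delimit Scope C_scope with Cx.
Infix "+" := Cadd : C_scope.
Infix "-" := Csub : C_scope.
Infix "*" := Cmul : C_scope.
Infix "/" := Cdiv : C_scope.
Notation "- z" := (Copp z) : C_scope.
Infix "^" := Cpow : C_scope.
Infix "^^" := Cpowz (at level 30, right associativity) : C_scope.

Definition mock_f_cv (q v : Cx) : Prop :=
  Cseries_cv (fun n => (q ^ (n * n) / (qpoch (- q) q n * qpoch (- q) q n))%Cx) v.
Definition mock_phi_cv (q v : Cx) : Prop :=
  Cseries_cv (fun n => (q ^ (n * n) / qpoch (- (q ^ 2)) (q ^ 2) n)%Cx) v.
(* psi(q) = sum_{n>=1} q^{n^2} / (q;q^2)_n   (index shifted: n = m+1) *)
Definition mock_psi_cv (q v : Cx) : Prop :=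
  Cseries_cv (fun m => (q ^ (S m * S m) / qpoch q (q ^ 2) (S m))%Cx) v.
Definition mock_nu_cv (q v : Cx) : Prop :=
  Cseries_cv (fun n => (q ^ (n * n + n) / qpoch (- q) (q ^ 2) (S n))%Cx) v.

(* Main.v *)
Require Import Defs.
From Stdlib Require Import Reals ZArith Lra Lia Rgeom Field Arith IndefiniteDescription.
Open Scope R_scope.

(** The series for f, phi and nu, extended to all integers n, are bilateral:
    the terms with n < 0 give the first sums on the right-hand sides.  Put
    L_r(b,c) = (1 - b q^r)(1 - c q^r) and a = b c.  Since L_r is affine in b + c
    once a is fixed, 1 / (L_0 ... L_k) has a partial fraction expansion in the
    1 / L_r; summed against q^(k^2) a^k / (q)_(n-k) it gives a finite identity,
    proved by induction on n.  Taking n = 2N, shifting b, c by q^(-N) and letting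
    N tend to infinity yields, with (x) = (x;q)_oo,
      sum_r q^(r^2) a^r / ((bq)_r (cq)_r)
        = L_0 (q/b)(q/c) / ((q)(q/a)(a)) sum_r (1 - a q^(2r)) a^(2r) q^(2r^2) / L_r.
    At the points of interest (b,c) = (-1,-1), (i,-i) and (i q^(1/2), -i q^(1/2))
    the right-hand side is 0/0, because the terms cancel in pairs (r,-r) or
    (r,-1-r); so b, c are scaled by s and s tends to 1.
    For nu the remaining theta series is Jacobi's triple product.
    For psi the bilateral series is a limiting case of Ramanujan's 1psi1 sum, and
    the series on the right is Jacobi's expansion of (-q;-q)^3. *)

(** * Complex arithmetic *)

(** The 0/0 is resolved term by term. Put h(s) = (1 - s w) s^N / (1 + s w). Two paired terms of the
    scaled series are, up to a common factor, h(s) and -h(1/s), with s^2 in the role of s for phi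
    and nu. Their sum is divisible by 1 - s, and the derivative left at s = 1 is the source of the
    squared denominators and of the coefficients 4r, 2r and r + 1. The vanishing factor of the
    product in front is 1 - a for f and phi, where a tends to 1, and the first factor of (q/a) for
    nu, where a tends to q. The scaling s has modulus greater than 1 and is close enough to 1 that
    no denominator vanishes on the way. Sums and infinite products are given by convergence
    predicates, not by functions. Each exchange of limit and sum is an instance of Tannery's theorem
    with a geometric majorant, which mostly comes from the quadratic exponents of q. The 1psi1 case
    is obtained in the same manner: a finite sum of q-Vandermonde type for 2N, a shift by q^(-N), a
    limit. *)

Lemma Cx_eq (z w : Cx) : Re z = Re w -> Im z = Im w -> z = w.
Proof. destruct z, w; simpl; intros -> ->; reflexivity. Qed.

Lemma normsq_neq0 (z : Cx) : z <> Cx0 -> Re z * Re z + Im z * Im z <> 0.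
Proof.
  intros H E. apply H. destruct z as [x y]; simpl in *.
  assert (x = 0) by nra. assert (y = 0) by nra. subst. reflexivity.
Qed.

Lemma Cx_field_theory : field_theory Cx0 Cx1 Cadd Cmul Csub Copp Cdiv Cinv (@eq Cx).
Proof.
  constructor.
  - constructor; intros; apply Cx_eq; simpl; ring.
  - intros H. apply (f_equal Re) in H. simpl in H. lra.
  - reflexivity.
  - intros p Hp. pose proof (normsq_neq0 p Hp). apply Cx_eq; simpl; field; assumption.
Qed.
Add Field Cx_field : Cx_field_theory.

Open Scope C_scope.

Lemma Cmul_neq0 (z w : Cx) : z <> Cx0 -> w <> Cx0 -> z * w <> Cx0.
Proof.
  intros Hz Hw E. apply Hz.
  replace z with ((z * w) * Cinv w) by (field; exact Hw). rewrite E. ring.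
Qed.

Lemma Cx1_neq0 : Cx1 <> Cx0.
Proof. intros H. apply (f_equal Re) in H. simpl in H. lra. Qed.

Lemma Cinv_neq0 (z : Cx) : z <> Cx0 -> Cinv z <> Cx0.
Proof.
  intros Hz E. apply Cx1_neq0. replace Cx1 with (z * Cinv z) by (field; exact Hz).
  rewrite E. ring.
Qed.

Lemma Csub_neq0 (z w : Cx) : z <> w -> z - w <> Cx0.
Proof. intros H E. apply H. replace z with ((z - w) + w) by ring. rewrite E. ring. Qed.

Lemma Copp_neq0 (z : Cx) : z <> Cx0 -> - z <> Cx0.
Proof. intros H E. apply H. replace z with (- - z) by ring. rewrite E. ring. Qed.

Lemma Cpow_neq0 (z : Cx) (n : nat) : z <> Cx0 -> z ^ n <> Cx0.
Proof.
  intros Hz. induction n as [|n IH]; simpl; [exact Cx1_neq0 | apply Cmul_neq0; assumption].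
Qed.

(* [field] leaves the constants [Cx1] and [- Cx1] unfolded in its side conditions. *)
Ltac nz :=
  repeat split; try assumption; try exact Cx1_neq0; try exact (Copp_neq0 _ Cx1_neq0);
  try (apply Copp_neq0; assumption); try (apply Cpow_neq0; assumption);
  try change (mkC R1 R0) with Cx1;
  try match goal with
    H : ?A <> Cx0 |- ?B <> Cx0 => let E := fresh in intros E; apply H; rewrite <- E; ring
  end.

Lemma Cdiv_eq (x y z : Cx) : z <> Cx0 -> x = y * z -> x / z = y.
Proof. intros Hz ->. field. exact Hz. Qed.

Lemma Cpow_add (z : Cx) (m n : nat) : z ^ (m + n) = z ^ m * z ^ n.
Proof. induction m as [|m IH]; simpl; [ring | rewrite IH; ring]. Qed.

Lemma Cpow_mul_l (z w : Cx) (n : nat) : (z * w) ^ n = z ^ n * w ^ n.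
Proof. induction n as [|n IH]; simpl; [ring | rewrite IH; ring]. Qed.

Lemma Cpow_pow (z : Cx) (m n : nat) : (z ^ m) ^ n = z ^ (m * n).
Proof.
  induction n as [|n IH]; simpl.
  - rewrite Nat.mul_0_r. reflexivity.
  - rewrite IH, Nat.mul_succ_r, Nat.add_comm, Cpow_add. reflexivity.
Qed.

Lemma Cpow_1_l (n : nat) : Cx1 ^ n = Cx1.
Proof. induction n as [|n IH]; simpl; [reflexivity | rewrite IH; ring]. Qed.

Lemma Cpow_inv (z : Cx) (n : nat) : z <> Cx0 -> (Cinv z) ^ n = Cinv (z ^ n).
Proof.
  intros Hz. induction n as [|n IH]; simpl.
  - field. exact Cx1_neq0.
  - rewrite IH. field. split; [apply Cpow_neq0|]; exact Hz.
Qed.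

(** * Finite sums *)

Lemma Csum_ext (f g : nat -> Cx) (n : nat) :
  (forall k, (k < n)%nat -> f k = g k) -> Csum f n = Csum g n.
Proof.
  induction n as [|n IH]; intros H; simpl; [reflexivity|].
  rewrite IH by (intros; apply H; lia). rewrite H by lia. reflexivity.
Qed.

Lemma Csum_add (f g : nat -> Cx) (n : nat) :
  Csum (fun k => f k + g k) n = Csum f n + Csum g n.
Proof. induction n as [|n IH]; simpl; [ring | rewrite IH; ring]. Qed.

Lemma Csum_mul (c : Cx) (f : nat -> Cx) (n : nat) :
  Csum (fun k => c * f k) n = c * Csum f n.
Proof. induction n as [|n IH]; simpl; [ring | rewrite IH; ring]. Qed.

Lemma Csum_split (f : nat -> Cx) (m n : nat) :
  Csum f (m + n) = Csum f m + Csum (fun k => f (m + k)%nat) n.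
Proof.
  induction n as [|n IH]; simpl.
  - rewrite Nat.add_0_r. ring.
  - rewrite Nat.add_succ_r. simpl. rewrite IH. ring.
Qed.

Lemma Csum_S_l (f : nat -> Cx) (n : nat) :
  Csum f (S n) = f O + Csum (fun k => f (S k)) n.
Proof. induction n as [|n IH]; [simpl; ring|]. cbn [Csum] in *. rewrite IH. ring. Qed.

Lemma Csum_rev (f : nat -> Cx) (n : nat) :
  Csum f n = Csum (fun k => f (n - S k)%nat) n.
Proof.
  induction n as [|n IH]; [reflexivity|].
  rewrite (Csum_S_l (fun k => f (S n - S k)%nat)). cbn [Csum]. rewrite IH, Nat.sub_succ, Nat.sub_0_r.
  change (fun k => f (S n - S (S k))%nat) with (fun k => f (n - S k)%nat). ring.
Qed.

Lemma Csum_telescope (G : nat -> Cx) (n : nat) :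
  Csum (fun k => G (S k) - G k) n = G n - G O.
Proof. induction n as [|n IH]; simpl; [ring | rewrite IH; ring]. Qed.

Lemma Csum_pairs (f : nat -> Cx) (n : nat) :
  Csum f (2 * n) = Csum (fun k => f (2 * k)%nat + f (S (2 * k))) n.
Proof.
  induction n as [|n IH]; [reflexivity|].
  replace (2 * S n)%nat with (S (S (2 * n))) by lia. cbn [Csum]. rewrite IH. ring.
Qed.

Close Scope C_scope.

(** * The modulus *)

Lemma Cnorm_ge0 (z : Cx) : 0 <= Cnorm z.
Proof. apply sqrt_pos. Qed.

Lemma Cnorm_0 : Cnorm Cx0 = 0.
Proof. unfold Cnorm; simpl. replace (0 * 0 + 0 * 0) with 0 by ring. exact sqrt_0. Qed.

Lemma Cnorm_RtoC (x : R) : Cnorm (RtoC x) = Rabs x.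
Proof.
  unfold Cnorm; simpl. replace (x * x + 0 * 0) with (Rsqr x) by (unfold Rsqr; ring).
  apply sqrt_Rsqr_abs.
Qed.

Lemma Cnorm_1 : Cnorm Cx1 = 1.
Proof. unfold Cx1. rewrite Cnorm_RtoC. apply Rabs_R1. Qed.

Lemma Cnorm_mul (z w : Cx) : Cnorm (z * w)%Cx = Cnorm z * Cnorm w.
Proof.
  unfold Cnorm. rewrite <- sqrt_mult by nra. f_equal. simpl. ring.
Qed.

Lemma Cnorm_opp (z : Cx) : Cnorm (- z)%Cx = Cnorm z.
Proof. unfold Cnorm; simpl. f_equal. ring. Qed.

Lemma Cnorm_triang (z w : Cx) : Cnorm (z + w)%Cx <= Cnorm z + Cnorm w.
Proof.
  pose proof (triangle (Re z + Re w) (Im z + Im w) 0 0 (Re w) (Im w)) as H.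
  unfold dist_euc, Rsqr in H. unfold Cnorm; simpl.
  replace (Re z + Re w - Re w) with (Re z) in H by ring.
  replace (Im z + Im w - Im w) with (Im z) in H by ring.
  rewrite !Rminus_0_r in H. exact H.
Qed.

Lemma Cnorm_sub (z w : Cx) : Cnorm (z - w)%Cx <= Cnorm z + Cnorm w.
Proof. unfold Csub. rewrite <- (Cnorm_opp w). apply Cnorm_triang. Qed.

Lemma Cnorm_sub_sym (z w : Cx) : Cnorm (z - w)%Cx = Cnorm (w - z)%Cx.
Proof. rewrite <- Cnorm_opp. f_equal. ring. Qed.

Lemma Cnorm_sub_ge (z w : Cx) : Cnorm z - Cnorm w <= Cnorm (z - w)%Cx.
Proof.
  pose proof (Cnorm_triang (z - w)%Cx w) as H.
  replace (z - w + w)%Cx with z in H by ring. lra.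
Qed.

Lemma Cnorm_pos (z : Cx) : z <> Cx0 -> 0 < Cnorm z.
Proof.
  intros H. apply sqrt_lt_R0. pose proof (normsq_neq0 z H).
  assert (0 <= Re z * Re z + Im z * Im z) by nra. lra.
Qed.

Lemma Cnorm_eq0 (z : Cx) : Cnorm z = 0 -> z = Cx0.
Proof.
  intros E. unfold Cnorm in E. apply sqrt_eq_0 in E; [|nra].
  apply Cx_eq; simpl; nra.
Qed.

Lemma Cnorm_neq0 (z : Cx) : 0 < Cnorm z -> z <> Cx0.
Proof. intros H E. subst. rewrite Cnorm_0 in H. lra. Qed.

Lemma Cnorm_pow (z : Cx) (n : nat) : Cnorm (z ^ n)%Cx = Cnorm z ^ n.
Proof. induction n as [|n IH]; simpl; [exact Cnorm_1 | rewrite Cnorm_mul, IH; reflexivity]. Qed.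

Lemma Cnorm_inv (z : Cx) : z <> Cx0 -> Cnorm (Cinv z) = / Cnorm z.
Proof.
  intros H. pose proof (Cnorm_pos z H).
  apply Rmult_eq_reg_l with (Cnorm z); [|lra].
  rewrite <- Cnorm_mul, Rinv_r by lra.
  replace (z * Cinv z)%Cx with Cx1 by (field; exact H). exact Cnorm_1.
Qed.

Lemma Cnorm_div (z w : Cx) : w <> Cx0 -> Cnorm (z / w)%Cx = Cnorm z / Cnorm w.
Proof. intros H. unfold Cdiv. rewrite Cnorm_mul, Cnorm_inv by exact H. reflexivity. Qed.

Lemma Cnorm_Re (z : Cx) : Rabs (Re z) <= Cnorm z.
Proof.
  unfold Cnorm. rewrite <- sqrt_Rsqr_abs. apply sqrt_le_1_alt. unfold Rsqr. nra.
Qed.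

Lemma Cnorm_Im (z : Cx) : Rabs (Im z) <= Cnorm z.
Proof.
  unfold Cnorm. rewrite <- sqrt_Rsqr_abs. apply sqrt_le_1_alt. unfold Rsqr. nra.
Qed.

Lemma Cnorm_le_ReIm (z : Cx) : Cnorm z <= Rabs (Re z) + Rabs (Im z).
Proof.
  replace z with (RtoC (Re z) + mkC 0 (Im z))%Cx at 1 by (apply Cx_eq; simpl; ring).
  eapply Rle_trans; [apply Cnorm_triang|]. rewrite Cnorm_RtoC.
  apply Rplus_le_compat_l. unfold Cnorm; simpl.
  replace (0 * 0 + Im z * Im z) with (Rsqr (Im z)) by (unfold Rsqr; ring).
  rewrite sqrt_Rsqr_abs. lra.
Qed.

(** * Limits *)

Lemma cv_const (c : Cx) : Cseq_cv (fun _ => c) c.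
Proof.
  intros e He. exists O. intros. replace (c - c)%Cx with Cx0 by ring. rewrite Cnorm_0. lra.
Qed.

Lemma cv_ext_ge (u v : nat -> Cx) (l : Cx) (N : nat) :
  (forall n, (N <= n)%nat -> u n = v n) -> Cseq_cv u l -> Cseq_cv v l.
Proof.
  intros H Hu e He. destruct (Hu e He) as [M HM]. exists (max M N). intros n Hn.
  rewrite <- H by lia. apply HM. lia.
Qed.

Lemma cv_ext (u v : nat -> Cx) (l : Cx) : (forall n, u n = v n) -> Cseq_cv u l -> Cseq_cv v l.
Proof. intros H. apply (cv_ext_ge u v l 0). intros; apply H. Qed.

Lemma cv_squeeze (u : nat -> Cx) (l : Cx) (b : nat -> R) :
  (forall n, Cnorm (u n - l)%Cx <= b n) -> Un_cv b 0 -> Cseq_cv u l.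
Proof.
  intros H Hb e He. destruct (Hb e He) as [N HN]. exists N. intros n Hn.
  specialize (HN n Hn). unfold Rdist in HN. rewrite Rminus_0_r in HN.
  pose proof (Rle_abs (b n)). specialize (H n). lra.
Qed.

Lemma cv_add (u v : nat -> Cx) (l m : Cx) :
  Cseq_cv u l -> Cseq_cv v m -> Cseq_cv (fun n => (u n + v n)%Cx) (l + m)%Cx.
Proof.
  intros Hu Hv e He. destruct (Hu (e/2)) as [N HN]; [lra|]. destruct (Hv (e/2)) as [M HM]; [lra|].
  exists (max N M). intros n Hn.
  replace (u n + v n - (l + m))%Cx with ((u n - l) + (v n - m))%Cx by ring.
  eapply Rle_lt_trans; [apply Cnorm_triang|].
  specialize (HN n ltac:(lia)). specialize (HM n ltac:(lia)). lra.
Qed.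

Lemma cv_mul (u v : nat -> Cx) (l m : Cx) :
  Cseq_cv u l -> Cseq_cv v m -> Cseq_cv (fun n => (u n * v n)%Cx) (l * m)%Cx.
Proof.
  intros Hu Hv e He.
  pose proof (Cnorm_ge0 l) as Hl. pose proof (Cnorm_ge0 m) as Hm.
  set (d := Rmin 1 (e / (2 * (Cnorm l + Cnorm m + 1)))).
  assert (Hd : 0 < d) by (apply Rmin_glb_lt; [lra|]; apply Rdiv_lt_0_compat; lra).
  destruct (Hu d) as [N HN]; [lra|]. destruct (Hv d) as [M HM]; [lra|].
  exists (max N M). intros n Hn. specialize (HN n ltac:(lia)). specialize (HM n ltac:(lia)).
  replace (u n * v n - l * m)%Cx with ((u n - l) * (v n - m) + (l * (v n - m) + m * (u n - l)))%Cx by ring.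
  eapply Rle_lt_trans; [apply Cnorm_triang|].
  eapply Rle_lt_trans; [apply Rplus_le_compat_l; apply Cnorm_triang|].
  rewrite !Cnorm_mul. pose proof (Cnorm_ge0 (v n - m)%Cx).
  assert (D1 : d <= 1) by apply Rmin_l.
  assert (D2 : d * (Cnorm l + Cnorm m + 1) <= e / 2).
  { apply Rle_trans with (e / (2 * (Cnorm l + Cnorm m + 1)) * (Cnorm l + Cnorm m + 1)).
    - apply Rmult_le_compat_r; [lra | apply Rmin_r].
    - right. field. lra. }
  nra.
Qed.

Lemma cv_opp (u : nat -> Cx) (l : Cx) : Cseq_cv u l -> Cseq_cv (fun n => (- u n)%Cx) (- l)%Cx.
Proof.
  intros H e He. destruct (H e He) as [N HN]. exists N. intros n Hn.
  replace (- u n - - l)%Cx with (- (u n - l))%Cx by ring. rewrite Cnorm_opp. apply HN, Hn.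
Qed.

Lemma cv_sub (u v : nat -> Cx) (l m : Cx) :
  Cseq_cv u l -> Cseq_cv v m -> Cseq_cv (fun n => (u n - v n)%Cx) (l - m)%Cx.
Proof. intros. unfold Csub. apply cv_add; [|apply cv_opp]; assumption. Qed.

Lemma cv_bounded_away (v : nat -> Cx) (m : Cx) :
  Cseq_cv v m -> m <> Cx0 -> exists N, forall n, (N <= n)%nat -> Cnorm m / 2 < Cnorm (v n).
Proof.
  intros Hv Hm. pose proof (Cnorm_pos m Hm). destruct (Hv (Cnorm m / 2)) as [N HN]; [lra|].
  exists N. intros n Hn. specialize (HN n Hn). rewrite Cnorm_sub_sym in HN.
  pose proof (Cnorm_sub_ge m (v n)). lra.
Qed.

Lemma cv_inv (v : nat -> Cx) (m : Cx) :
  Cseq_cv v m -> m <> Cx0 -> Cseq_cv (fun n => Cinv (v n)) (Cinv m).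
Proof.
  intros Hv Hm e He. pose proof (Cnorm_pos m Hm) as Hp.
  destruct (cv_bounded_away v m Hv Hm) as [N0 H0].
  destruct (Hv (e * (Cnorm m * Cnorm m / 2))) as [N HN].
  { assert (0 < Cnorm m * Cnorm m) by nra. nra. }
  exists (max N0 N). intros n Hn. specialize (H0 n ltac:(lia)). specialize (HN n ltac:(lia)).
  assert (Hvn : v n <> Cx0) by (apply Cnorm_neq0; lra).
  replace (Cinv (v n) - Cinv m)%Cx with ((m - v n) * (Cinv (v n) * Cinv m))%Cx by (field; split; assumption).
  rewrite !Cnorm_mul, !Cnorm_inv, Cnorm_sub_sym by assumption.
  apply Rmult_lt_reg_r with (Cnorm (v n) * Cnorm m); [nra|].
  replace (Cnorm (v n - m)%Cx * (/ Cnorm (v n) * / Cnorm m) * (Cnorm (v n) * Cnorm m))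
    with (Cnorm (v n - m)%Cx) by (field; split; lra).
  eapply Rlt_le_trans; [exact HN|]. apply Rmult_le_compat_l; [lra|]. nra.
Qed.

Lemma cv_div (u v : nat -> Cx) (l m : Cx) :
  Cseq_cv u l -> Cseq_cv v m -> m <> Cx0 -> Cseq_cv (fun n => (u n / v n)%Cx) (l / m)%Cx.
Proof. intros. unfold Cdiv. apply cv_mul; [|apply cv_inv]; assumption. Qed.

Lemma cv_pow (u : nat -> Cx) (l : Cx) (k : nat) :
  Cseq_cv u l -> Cseq_cv (fun n => (u n ^ k)%Cx) (l ^ k)%Cx.
Proof. intros H. induction k as [|k IH]; simpl; [apply cv_const | apply cv_mul; assumption]. Qed.

Lemma cv_Csum (f : nat -> nat -> Cx) (g : nat -> Cx) (R : nat) :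
  (forall r, Cseq_cv (fun m => f m r) (g r)) -> Cseq_cv (fun m => Csum (f m) R) (Csum g R).
Proof. intros H. induction R as [|R IH]; simpl; [apply cv_const | apply cv_add; [exact IH | apply H]]. Qed.

Lemma cv_subseq (u : nat -> Cx) (l : Cx) (s : nat -> nat) :
  (forall n, (n <= s n)%nat) -> Cseq_cv u l -> Cseq_cv (fun n => u (s n)) l.
Proof.
  intros Hs H e He. destruct (H e He) as [N HN]. exists N. intros n Hn. apply HN.
  specialize (Hs n). lia.
Qed.

Lemma cv_unshift (u : nat -> Cx) (l : Cx) : Cseq_cv (fun n => u (S n)) l -> Cseq_cv u l.
Proof.
  intros H e He. destruct (H e He) as [N HN]. exists (S N). intros n Hn.
  destruct n; [lia|]. apply HN. lia.
Qed.

Lemma cv_minus_index (u : nat -> Cx) (l : Cx) (r : nat) :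
  Cseq_cv u l -> Cseq_cv (fun N => u (N - r)%nat) l.
Proof.
  intros H e He. destruct (H e He) as [N HN]. exists (N + r)%nat. intros n Hn. apply HN. lia.
Qed.

Lemma cv_unique (u : nat -> Cx) (l m : Cx) : Cseq_cv u l -> Cseq_cv u m -> l = m.
Proof.
  intros Hl Hm. pose proof (cv_sub _ _ _ _ Hl Hm) as H.
  destruct (Rle_lt_dec (Cnorm (l - m)%Cx) 0) as [Hle|Hlt].
  - destruct (Req_dec (Cnorm (l - m)%Cx) 0) as [E|E]; [|pose proof (Cnorm_ge0 (l - m)%Cx); lra].
    replace l with ((l - m) + m)%Cx by ring.
    assert (Z : (l - m)%Cx = Cx0).
    { apply Cnorm_eq0. exact E. }
    rewrite Z. ring.
  - destruct (H _ Hlt) as [N HN]. specialize (HN N (Nat.le_refl _)).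
    replace (u N - u N - (l - m))%Cx with (- (l - m))%Cx in HN by ring.
    rewrite Cnorm_opp in HN. lra.
Qed.

Lemma cv_norm_le (u : nat -> Cx) (l : Cx) (B : R) :
  Cseq_cv u l -> (forall n, Cnorm (u n) <= B) -> Cnorm l <= B.
Proof.
  intros H HB. destruct (Rle_lt_dec (Cnorm l) B) as [|Hlt]; [assumption|].
  destruct (H (Cnorm l - B)) as [N HN]; [lra|]. specialize (HN N (Nat.le_refl _)).
  rewrite Cnorm_sub_sym in HN. pose proof (Cnorm_sub_ge l (u N)). specialize (HB N). lra.
Qed.

Lemma cv_norm_ge (u : nat -> Cx) (l : Cx) (B : R) :
  Cseq_cv u l -> (forall n, B <= Cnorm (u n)) -> B <= Cnorm l.
Proof.
  intros H HB. destruct (Rle_lt_dec B (Cnorm l)) as [|Hlt]; [assumption|].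
  destruct (H (B - Cnorm l)) as [N HN]; [lra|]. specialize (HN N (Nat.le_refl _)).
  pose proof (Cnorm_sub_ge (u N) l). specialize (HB N). lra.
Qed.

Lemma pow_cv0 (x : R) : 0 <= x < 1 -> Un_cv (fun n => x ^ n) 0.
Proof.
  intros Hx e He. destruct (pow_lt_1_zero x) with (y := e) as [N HN]; [rewrite Rabs_pos_eq; lra | lra |].
  exists N. intros n Hn. unfold Rdist. rewrite Rminus_0_r. apply HN, Hn.
Qed.

Lemma geo_cv0 (C x : R) : 0 <= x < 1 -> Un_cv (fun n => C * x ^ n) 0.
Proof.
  intros Hx. replace 0 with (C * 0) by ring. apply CV_mult; [|apply pow_cv0; exact Hx].
  intros e He. exists O. intros. unfold Rdist. rewrite Rminus_diag, Rabs_R0. exact He.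
Qed.

(** The partial geometric sum x^n + ... + x^(n+k-1) is kept in closed form; the factor 1 - x^k is
    what lets the induction on k close. *)
Lemma geo_step_bound (u : nat -> Cx) (C x : R) :
  0 <= x < 1 -> 0 <= C ->
  (forall n, Cnorm (u (S n) - u n)%Cx <= C * x ^ n) ->
  forall n k, Cnorm (u (n + k)%nat - u n)%Cx <= C * x ^ n / (1 - x) * (1 - x ^ k).
Proof.
  intros Hx HC H n k. induction k as [|k IH].
  - rewrite Nat.add_0_r. replace (u n - u n)%Cx with Cx0 by ring. rewrite Cnorm_0. simpl. lra.
  - rewrite Nat.add_succ_r.
    replace (u (S (n + k)) - u n)%Cx with ((u (S (n + k)) - u (n + k)%nat) + (u (n + k)%nat - u n))%Cx by ring.
    eapply Rle_trans; [apply Cnorm_triang|].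
    eapply Rle_trans; [apply Rplus_le_compat; [apply H | exact IH]|].
    right. rewrite pow_add. simpl. field. lra.
Qed.

Lemma geo_step_cv (u : nat -> Cx) (C x : R) :
  0 <= x < 1 -> 0 <= C ->
  (forall n, Cnorm (u (S n) - u n)%Cx <= C * x ^ n) ->
  exists l, Cseq_cv u l /\ forall n, Cnorm (u n - l)%Cx <= C / (1 - x) * x ^ n.
Proof.
  intros Hx HC H.
  assert (B : forall n k, Cnorm (u (n + k)%nat - u n)%Cx <= C / (1 - x) * x ^ n).
  { intros n k. eapply Rle_trans; [apply (geo_step_bound u C x Hx HC H)|].
    assert (0 <= x ^ k) by (apply pow_le; lra). assert (0 <= x ^ n) by (apply pow_le; lra).
    assert (0 <= C * x ^ n / (1 - x)).
    { apply Rmult_le_pos; [apply Rmult_le_pos; lra|]. left. apply Rinv_0_lt_compat. lra. }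
    replace (C / (1 - x) * x ^ n) with (C * x ^ n / (1 - x) * 1) by (field; lra).
    apply Rmult_le_compat_l; lra. }
  (* Completeness of the reals is applied to each coordinate; arguing for any 1-Lipschitz [p] serves
     [Re] and [Im] at once. *)
  assert (Cau : forall p : Cx -> R, (forall z w, Rabs (p z - p w) <= Cnorm (z - w)%Cx) ->
                exists l, Un_cv (fun n => p (u n)) l).
  { intros p Hp. destruct (R_complete (fun n => p (u n))) as [l Hl]; [|exists l; exact Hl].
    intros e He. destruct (geo_cv0 (C / (1 - x)) x Hx (e / 2)) as [N HN]; [lra|].
    exists N. intros n m Hn Hm. unfold Rdist.
    specialize (HN N (Nat.le_refl _)). unfold Rdist in HN. rewrite Rminus_0_r in HN.
    pose proof (Rle_abs (C / (1 - x) * x ^ N)).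
    replace n with (N + (n - N))%nat by lia. replace m with (N + (m - N))%nat by lia.
    pose proof (Hp (u (N + (n - N))%nat) (u N)) as P1. pose proof (Hp (u (N + (m - N))%nat) (u N)) as P2.
    pose proof (B N (n - N)%nat) as B1. pose proof (B N (m - N)%nat) as B2.
    replace (p (u (N + (n - N))%nat) - p (u (N + (m - N))%nat)) with
      ((p (u (N + (n - N))%nat) - p (u N)) - (p (u (N + (m - N))%nat) - p (u N))) by ring.
    eapply Rle_lt_trans; [apply Rabs_triang|]. rewrite Rabs_Ropp. lra. }
  destruct (Cau Re) as [lr Hr].
  { intros z w. replace (Re z - Re w) with (Re (z - w)%Cx) by (simpl; ring). apply Cnorm_Re. }
  destruct (Cau Im) as [li Hi].
  { intros z w. replace (Im z - Im w) with (Im (z - w)%Cx) by (simpl; ring). apply Cnorm_Im. }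
  assert (L : Cseq_cv u (mkC lr li)).
  { intros e He. destruct (Hr (e/2)) as [N HN]; [lra|]. destruct (Hi (e/2)) as [M HM]; [lra|].
    exists (max N M). intros n Hn. specialize (HN n ltac:(lia)). specialize (HM n ltac:(lia)).
    unfold Rdist in *. eapply Rle_lt_trans; [apply Cnorm_le_ReIm|]. simpl.
    replace (Re (u n) + - lr) with (Re (u n) - lr) by ring.
    replace (Im (u n) + - li) with (Im (u n) - li) by ring. lra. }
  exists (mkC lr li). split; [exact L|]. intros n. rewrite Cnorm_sub_sym.
  apply (cv_norm_le (fun k => (u (n + k)%nat - u n)%Cx)); [|apply B].
  apply cv_sub; [|apply cv_const].
  apply (cv_ext (fun k => u (k + n)%nat)); [intros; f_equal; lia|].
  apply (cv_subseq u _ (fun k => (k + n)%nat)); [intros; lia | exact L].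
Qed.

Lemma series_geo_cv (f : nat -> Cx) (C x : R) :
  0 <= x < 1 -> 0 <= C -> (forall n, Cnorm (f n) <= C * x ^ n) ->
  exists l, Cseries_cv f l /\ forall n, Cnorm (Csum f n - l)%Cx <= C / (1 - x) * x ^ n.
Proof.
  intros Hx HC H. apply geo_step_cv; [exact Hx | exact HC |]. intros n. simpl.
  replace (Csum f n + f n - Csum f n)%Cx with (f n) by ring. apply H.
Qed.

Lemma series_geo_tail (f : nat -> Cx) (l : Cx) (C x : R) :
  0 <= x < 1 -> 0 <= C -> (forall n, Cnorm (f n) <= C * x ^ n) -> Cseries_cv f l ->
  forall n, Cnorm (Csum f n - l)%Cx <= C / (1 - x) * x ^ n.
Proof.
  intros Hx HC H Hl n. destruct (series_geo_cv f C x Hx HC H) as [l' [Hl' Hb]].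
  rewrite (cv_unique _ _ _ Hl Hl'). apply Hb.
Qed.

(** Tannery's theorem: a majorant independent of m lets limit and sum be exchanged. The row sums are
    an arbitrary [L], since a series has its value only through a predicate. *)
Lemma tannery (f : nat -> nat -> Cx) (g : nat -> Cx) (C x : R) :
  0 <= x < 1 -> 0 <= C ->
  (forall m r, Cnorm (f m r) <= C * x ^ r) ->
  (forall r, Cseq_cv (fun m => f m r) (g r)) ->
  exists l, Cseries_cv g l /\
    forall L, (forall m, Cseries_cv (f m) (L m)) -> Cseq_cv L l.
Proof.
  intros Hx HC Hf Hg.
  assert (Hgb : forall r, Cnorm (g r) <= C * x ^ r).
  { intros r. apply (cv_norm_le _ _ _ (Hg r)). intros; apply Hf. }
  destruct (series_geo_cv g C x Hx HC Hgb) as [l [Hl Hlb]].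
  exists l. split; [exact Hl|]. intros L HL e He.
  (* One third of e each for the tail of the row, its first R terms, and the tail of the limit
     series. R depends on the majorant only, not on m. *)
  destruct (geo_cv0 (C / (1 - x)) x Hx (e / 3)) as [R HR]; [lra|].
  specialize (HR R (Nat.le_refl _)). unfold Rdist in HR. rewrite Rminus_0_r in HR.
  pose proof (Rle_abs (C / (1 - x) * x ^ R)).
  destruct (cv_Csum f g R Hg (e / 3)) as [M HM]; [lra|].
  exists M. intros m Hm. specialize (HM m Hm).
  pose proof (series_geo_tail (f m) (L m) C x Hx HC (Hf m) (HL m) R) as T1.
  specialize (Hlb R). rewrite Cnorm_sub_sym in T1.
  replace (L m - l)%Cx with ((L m - Csum (f m) R) + ((Csum (f m) R - Csum g R) + (Csum g R - l)))%Cx by ring.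
  eapply Rle_lt_trans; [apply Cnorm_triang|].
  eapply Rle_lt_trans; [apply Rplus_le_compat_l; apply Cnorm_triang|]. lra.
Qed.

(** Reduced to [tannery] by extending each finite sum with zeros; [N <= cnt N] puts every fixed
    index inside the sum from some N on. *)
Lemma tannery_partial (f : nat -> nat -> Cx) (g : nat -> Cx) (cnt : nat -> nat) (C x : R) :
  0 <= x < 1 -> 0 <= C -> (forall N, (N <= cnt N)%nat) ->
  (forall N r, Cnorm (f N r) <= C * x ^ r) ->
  (forall r, Cseq_cv (fun N => f N r) (g r)) ->
  exists l, Cseries_cv g l /\ Cseq_cv (fun N => Csum (f N) (cnt N)) l.
Proof.
  intros Hx HC Hcnt Hf Hg.
  destruct (tannery (fun N r => if (r <? cnt N)%nat then f N r else Cx0) g C x Hx HC) as [l [Hl HL]].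
  - intros N r. destruct (Nat.ltb_spec r (cnt N)); [apply Hf|].
    rewrite Cnorm_0. apply Rmult_le_pos; [exact HC | apply pow_le; lra].
  - intros r. apply (cv_ext_ge (fun N => f N r) _ _ (S r)); [|apply Hg].
    intros n Hn. specialize (Hcnt n). destruct (Nat.ltb_spec r (cnt n)); [reflexivity | lia].
  - exists l. split; [exact Hl|]. apply HL.
    intros N. apply (cv_ext_ge (fun _ => Csum (f N) (cnt N)) _ _ (cnt N)); [|apply cv_const].
    intros n Hn. replace n with (cnt N + (n - cnt N))%nat by lia. rewrite Csum_split.
    rewrite (Csum_ext (fun r => if (r <? cnt N)%nat then f N r else Cx0) (f N)).
    2:{ intros k Hk. destruct (Nat.ltb_spec k (cnt N)); [reflexivity | lia]. }
    (* The zero tail is written as a product so that [Csum_mul] can pull the factor 0 out of the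
       sum. *)
    rewrite (Csum_ext (fun k => if (cnt N + k <? cnt N)%nat then f N (cnt N + k)%nat else Cx0)
      (fun k => (Cx0 * Cx0)%Cx)).
    2:{ intros k Hk. destruct (Nat.ltb_spec (cnt N + k) (cnt N)); [lia | ring]. }
    rewrite Csum_mul. ring.
Qed.

Lemma series_ext (f g : nat -> Cx) (l : Cx) : Cseries_cv f l -> (forall n, f n = g n) -> Cseries_cv g l.
Proof. intros Hf H. revert Hf. apply cv_ext. intros n. apply Csum_ext. intros; apply H. Qed.

Lemma series_add (f g : nat -> Cx) (l m : Cx) :
  Cseries_cv f l -> Cseries_cv g m -> Cseries_cv (fun n => (f n + g n)%Cx) (l + m)%Cx.
Proof.
  intros Hf Hg. apply (cv_ext (fun n => (Csum f n + Csum g n)%Cx)); [|apply cv_add; assumption].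
  intros; symmetry; apply Csum_add.
Qed.

Lemma series_mul (c : Cx) (f : nat -> Cx) (l : Cx) :
  Cseries_cv f l -> Cseries_cv (fun n => (c * f n)%Cx) (c * l)%Cx.
Proof.
  intros Hf. apply (cv_ext (fun n => (c * Csum f n)%Cx)); [|apply cv_mul; [apply cv_const | assumption]].
  intros; symmetry; apply Csum_mul.
Qed.

Lemma series_unS (f : nat -> Cx) (l : Cx) :
  Cseries_cv f l -> Cseries_cv (fun n => f (S n)) (l - f O)%Cx.
Proof.
  intros H. apply (cv_ext (fun n => (Csum f (S n) - f O)%Cx)).
  - intros n. rewrite Csum_S_l. ring.
  - apply cv_sub; [|apply cv_const]. apply (cv_subseq (Csum f) l S); [intros; lia | exact H].
Qed.

Lemma series_pairs (f : nat -> Cx) (l : Cx) :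
  Cseries_cv f l -> Cseries_cv (fun n => (f (2 * n)%nat + f (S (2 * n)))%Cx) l.
Proof.
  intros H. apply (cv_ext (fun n => Csum f (2 * n))).
  - intros n. apply Csum_pairs.
  - apply (cv_subseq (Csum f) l (fun n => (2 * n)%nat)); [intros; lia | exact H].
Qed.

(** * q-shifted factorials *)

Open Scope C_scope.

Lemma qpoch_S (a q : Cx) (n : nat) : qpoch a q (S n) = qpoch a q n * (Cx1 - a * q ^ n).
Proof. reflexivity. Qed.

Lemma qpoch_S_l (a q : Cx) (n : nat) : qpoch a q (S n) = (Cx1 - a) * qpoch (a * q) q n.
Proof.
  induction n as [|n IH].
  - unfold qpoch; simpl. ring.
  - rewrite qpoch_S, IH, qpoch_S. simpl. ring.
Qed.

Lemma qpoch_add (a q : Cx) (m n : nat) :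
  qpoch a q (m + n) = qpoch a q m * qpoch (a * q ^ m) q n.
Proof.
  induction n as [|n IH].
  - rewrite Nat.add_0_r. unfold qpoch at 3; simpl. ring.
  - rewrite Nat.add_succ_r, !qpoch_S, IH, Cpow_add. ring.
Qed.

Lemma qpoch_neq0 (a q : Cx) (n : nat) :
  (forall k, Cx1 - a * q ^ k <> Cx0) -> qpoch a q n <> Cx0.
Proof.
  intros H. induction n as [|n IH]; [exact Cx1_neq0|]. apply Cmul_neq0; [exact IH | apply H].
Qed.

Lemma qpoch_0_l (q : Cx) (n : nat) : qpoch Cx0 q n = Cx1.
Proof. induction n as [|n IH]; [reflexivity|]. rewrite qpoch_S, IH. ring. Qed.

Fixpoint tri (n : nat) : nat := match n with O => O | S m => (S m + tri m)%nat end.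

Lemma tri_double (n : nat) : (2 * tri n = n * n + n)%nat.
Proof. induction n as [|n IH]; simpl; lia. Qed.

(** Factor by factor, 1 - x q^(-j) = -x q^(-j) (1 - q^j / x) for j = 1, ..., m. *)
Lemma qpoch_rev (x q : Cx) (m : nat) : q <> Cx0 -> x <> Cx0 ->
  qpoch (x / q ^ m) q m * q ^ tri m = (- x) ^ m * qpoch (q / x) q m.
Proof.
  intros Hq Hx. induction m as [|m IH].
  - unfold qpoch; simpl. ring.
  - rewrite qpoch_S_l, qpoch_S. cbn [tri]. rewrite Cpow_add.
    replace (x / q ^ S m * q) with (x / q ^ m).
    2:{ simpl. field. split; [apply Cpow_neq0|]; exact Hq. }
    replace ((- x) ^ S m * (qpoch (q / x) q m * (Cx1 - q / x * q ^ m)))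
      with ((- x) * (Cx1 - q / x * q ^ m) * ((- x) ^ m * qpoch (q / x) q m)) by (simpl; ring).
    rewrite <- IH. simpl.
    assert (q ^ m <> Cx0) by (apply Cpow_neq0; exact Hq). field. repeat split; assumption.
Qed.

(* pentagonal numbers r(3r-1)/2 *)
Fixpoint pent (n : nat) : nat := match n with O => O | S m => (pent m + 3 * m + 1)%nat end.

(** Links the exponent of q in [wz_term] to the one in [rhs_term]: they differ by r. *)
Lemma pent_tri (n : nat) : (pent n + n = n * n + tri n)%nat.
Proof. induction n as [|n IH]; simpl; lia. Qed.

(** * A terminating sum evaluated by a WZ pair *)

Section Finite.
Variable q : Cx.
Hypothesis Hq : forall k, Cx1 - q ^ S k <> Cx0.

Lemma qq_neq0 (n : nat) : qpoch q q n <> Cx0.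
Proof.
  apply qpoch_neq0. intros k. exact (Hq k).
Qed.

(** Divided by (q)_n, this is the r-th summand of the Bailey relation for beta_n = 1/(q)_n, a
    limiting case of the terminating very-well-poised 6phi5 sum. *)
Definition wz_term (a : Cx) (n r : nat) : Cx :=
  (- Cx1) ^ r * q ^ pent r * a ^ r * (Cx1 - a * q ^ (2 * r)) * qpoch q q n
  / (qpoch q q r * qpoch q q (n - r) * qpoch (a * q ^ r) q (S n)).

(** The WZ certificate: its differences in r are the differences of [wz_term] in n. The factor 1 -
    q^r makes it vanish at r = 0. *)
Definition wz_cert (a : Cx) (n r : nat) : Cx :=
  - ((Cx1 - q ^ r) * qpoch q q n * (- Cx1) ^ r * a ^ r * q ^ (pent r + (S n - r))
     / (qpoch q q r * qpoch q q (S n - r) * qpoch (a * q ^ r) q (S n))).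

Lemma shift_neq0 (a : Cx) (r : nat) :
  (forall k, Cx1 - a * q ^ k <> Cx0) -> forall k, Cx1 - a * q ^ r * q ^ k <> Cx0.
Proof.
  intros H k. specialize (H (r + k)%nat). rewrite Cpow_add in H.
  replace (a * q ^ r * q ^ k) with (a * (q ^ r * q ^ k)) by ring. exact H.
Qed.

(** Parametrised by n = r + m to avoid truncated subtraction. Once the q-factorials are peeled down
    to common ones, a rational identity is left. *)
Lemma wz_step (a : Cx) (r m : nat) : (forall k, Cx1 - a * q ^ k <> Cx0) ->
  wz_term a (S (r + m)) r - wz_term a (r + m) r
  = wz_cert a (r + m) (S r) - wz_cert a (r + m) r.
Proof.
  intros Ha. unfold wz_term, wz_cert.
  replace (S (r + m) - r)%nat with (S m) by lia. replace (r + m - r)%nat with m by lia.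
  replace (S (r + m) - S r)%nat with m by lia.
  rewrite (qpoch_S_l (a * q ^ r) q (S (r + m))), (qpoch_S_l (a * q ^ r) q (r + m)).
  replace (a * q ^ S r) with (a * q ^ r * q) by (simpl; ring).
  pose proof (qpoch_neq0 _ q (r + m) (shift_neq0 a (S r) Ha)) as HP.
  replace (a * q ^ S r) with (a * q ^ r * q) in HP by (simpl; ring).
  rewrite !(qpoch_S (a * q ^ r * q)), !(qpoch_S q q).
  pose proof (qq_neq0 r) as H1. pose proof (qq_neq0 m) as H2.
  pose proof (Ha r) as H3. pose proof (Ha (S (r + r + m))) as H4.
  pose proof (Hq r) as H5. pose proof (Hq m) as H6.
  replace (S (r + r + m)) with (1 + (r + (r + m)))%nat in H4 by lia.
  replace (2 * r)%nat with (r + r)%nat by lia.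
  cbn [pent]. replace (3 * r)%nat with (r + (r + r))%nat by lia.
  rewrite !Cpow_add in *. cbn [Cpow] in *. field; nz.
Qed.

Lemma wz_sum (a : Cx) (n : nat) : (forall k, Cx1 - a * q ^ k <> Cx0) ->
  Csum (wz_term a n) (S n) = Cx1.
Proof.
  intros Ha. induction n as [|n IH].
  - unfold wz_term, qpoch; simpl. specialize (Ha O). simpl in Ha. field; nz.
  - cbn [Csum]. cbn [Csum] in IH.
    assert (E : Csum (wz_term a (S n)) (S n) - Csum (wz_term a n) (S n)
                = wz_cert a n (S n) - wz_cert a n O).
    { rewrite <- Csum_telescope.
      replace (Csum (wz_term a (S n)) (S n) - Csum (wz_term a n) (S n))
        with (Csum (wz_term a (S n)) (S n) + (- Cx1) * Csum (wz_term a n) (S n)) by ring.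
      rewrite <- Csum_mul, <- Csum_add. apply Csum_ext. intros k Hk.
      pose proof (wz_step a k (n - k) Ha) as H. replace (k + (n - k))%nat with n in H by lia.
      rewrite <- H. ring. }
    assert (E0 : wz_cert a n O = Cx0).
    { unfold wz_cert. unfold Cdiv. simpl. ring. }
    (* [wz_step] covers r <= n only; the new term r = n + 1 cancels the boundary value of the
       certificate. *)
    assert (E1 : wz_term a (S n) (S n) + wz_cert a n (S n) = Cx0).
    { unfold wz_term, wz_cert. replace (S n - S n)%nat with O by lia.
      rewrite (qpoch_S (a * q ^ S n) q (S n)). rewrite (qpoch_S q q n).
      replace (2 * S n)%nat with (S n + S n)%nat by lia.
      replace (pent (S n) + 0)%nat with (pent (S n)) by lia.
      pose proof (qpoch_neq0 _ q (S n) (shift_neq0 a (S n) Ha)) as HP.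
      pose proof (qq_neq0 n) as H1. pose proof (Hq n) as H2.
      pose proof (Ha (S n + S n)%nat) as H3. rewrite !Cpow_add in *.
      change (qpoch q q 0) with Cx1.
      change (q ^ S n) with (q * q ^ n) in *. field; nz. }
    cbn [Csum] in E.
    replace (Csum (wz_term a (S n)) n + wz_term a (S n) n + wz_term a (S n) (S n))
      with ((Csum (wz_term a (S n)) n + wz_term a (S n) n - (Csum (wz_term a n) n + wz_term a n n))
            + (Csum (wz_term a n) n + wz_term a n n) + (wz_term a (S n) (S n) + wz_cert a n (S n)) - wz_cert a n (S n)) by ring.
    rewrite E, E0, E1, IH. ring.
Qed.

(** * The finite identity behind the bilateral transformation *)

Definition lhs_term (b c : Cx) (n k : nat) : Cx :=
  q ^ (k * k) * (b * c) ^ k / (qpoch q q (n - k) * qpoch b q (S k) * qpoch c q (S k)).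

Definition rhs_term (b c : Cx) (n r : nat) : Cx :=
  (- Cx1) ^ r * q ^ (r * r + tri r) * (b * c) ^ r * (Cx1 - b * c * q ^ (2 * r))
  / ((Cx1 - b * q ^ r) * (Cx1 - c * q ^ r) * qpoch q q r * qpoch q q (n - r)
     * qpoch (b * c * q ^ r) q (S n)).

(** Put r = t + 1 and a = b c. The reason is q^r L_0 = L_r - (1 - q^r)(1 - a q^r). After division by
    q^r L_r the first part has lost its denominator L_r and is a [wz_term]. In the second part both
    factors cancel against q-factorials, which leaves a term for (b q, c q): their L_t is the old
    L_r. *)
Lemma rhs_term_rec (b c : Cx) (t m : nat) :
  (forall k, Cx1 - b * q ^ k <> Cx0) -> (forall k, Cx1 - c * q ^ k <> Cx0) ->
  (forall k, Cx1 - b * c * q ^ k <> Cx0) ->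
  (Cx1 - b) * (Cx1 - c) * rhs_term b c (S (t + m)) (S t)
  = wz_term (b * c) (S (t + m)) (S t) / qpoch q q (S (t + m))
    + b * c * q * rhs_term (b * q) (c * q) (t + m) t.
Proof.
  intros Hb Hc Ha. unfold rhs_term, wz_term.
  replace (S (t + m) - S t)%nat with m by lia. replace (t + m - t)%nat with m by lia.
  rewrite (qpoch_S_l (b * c * q ^ S t) q (S (t + m))).
  replace (b * q * (c * q) * q ^ t) with (b * c * q ^ S t * q) by (simpl; ring).
  pose proof (qpoch_neq0 _ q (S (t + m)) (shift_neq0 (b * c) (S (S t)) Ha)) as HP.
  replace (b * c * q ^ S (S t)) with (b * c * q ^ S t * q) in HP by (simpl; ring).
  pose proof (qq_neq0 (S (t + m))) as H0.
  pose proof (qq_neq0 m) as H2.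
  rewrite (qpoch_S q q t). pose proof (qq_neq0 t) as H1.
  pose proof (Hb (S t)) as H3. pose proof (Hc (S t)) as H4. pose proof (Ha (S t)) as H5.
  pose proof (Hq t) as H6.
  replace (b * q * (c * q)) with (b * c * (q * q)) by ring. rewrite (Cpow_mul_l (b * c) (q * q)).
  replace ((q * q) ^ t) with (q ^ t * q ^ t) by (rewrite <- Cpow_mul_l; reflexivity).
  replace (q ^ (S t * S t + tri (S t))) with (q ^ pent (S t) * q ^ S t)
    by (rewrite <- pent_tri, Cpow_add; reflexivity).
  pose proof (pent_tri t) as E. pose proof (f_equal (fun e => q ^ e) E) as E'.
  rewrite <- E'. clear E E'. cbn [pent].
  replace (3 * t)%nat with (t + (t + t))%nat by lia.
  replace (2 * S t)%nat with (S t + S t)%nat by lia. replace (2 * t)%nat with (t + t)%nat by lia.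
  rewrite !Cpow_add. cbn [Cpow] in *. field; nz.
Qed.

(** Both sides S_n(b,c) satisfy (1 - b)(1 - c) S_(n+1)(b,c) = 1/(q)_(n+1) + b c q S_n(b q, c q), so
    b and c must vary in the induction. On the left this is a shift of k; on the right it is
    [rhs_term_rec] summed over r, with the [wz_term] part evaluated by [wz_sum]. *)
Lemma finite_identity (n : nat) : forall b c : Cx,
  (forall k, Cx1 - b * q ^ k <> Cx0) -> (forall k, Cx1 - c * q ^ k <> Cx0) ->
  (forall k, Cx1 - b * c * q ^ k <> Cx0) ->
  Csum (lhs_term b c n) (S n) = Csum (rhs_term b c n) (S n).
Proof.
  induction n as [|n IH]; intros b c Hb Hc Ha.
  - unfold lhs_term, rhs_term, qpoch; simpl.
    pose proof (Hb O) as H1. pose proof (Hc O) as H2. pose proof (Ha O) as H3. simpl in H1, H2, H3.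
    field; nz.
  - pose proof (Hb O) as H1. pose proof (Hc O) as H2. simpl in H1, H2.
    assert (Hb' : forall k, Cx1 - b * q * q ^ k <> Cx0) by (intros k; replace (b * q) with (b * q ^ 1) by (simpl; ring); apply shift_neq0, Hb).
    assert (Hc' : forall k, Cx1 - c * q * q ^ k <> Cx0) by (intros k; replace (c * q) with (c * q ^ 1) by (simpl; ring); apply shift_neq0, Hc).
    assert (Ha' : forall k, Cx1 - b * q * (c * q) * q ^ k <> Cx0).
    { intros k. replace (b * q * (c * q)) with (b * c * q ^ 2) by (simpl; ring). apply shift_neq0, Ha. }
    specialize (IH (b * q) (c * q) Hb' Hc' Ha').
    pose proof (qq_neq0 (S n)) as HQ.
    assert (EL : (Cx1 - b) * (Cx1 - c) * Csum (lhs_term b c (S n)) (S (S n))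
            = Cx1 / qpoch q q (S n) + b * c * q * Csum (lhs_term (b * q) (c * q) n) (S n)).
    { rewrite Csum_S_l.
      rewrite (Csum_ext (fun k => lhs_term b c (S n) (S k))
        (fun k => b * c * q / ((Cx1 - b) * (Cx1 - c)) * lhs_term (b * q) (c * q) n k)).
      - rewrite Csum_mul. replace (lhs_term b c (S n) 0) with (Cx1 / (qpoch q q (S n) * (Cx1 - b) * (Cx1 - c))).
        + intros. field; nz.
        + unfold lhs_term. rewrite Nat.sub_0_r. generalize dependent (qpoch q q (S n)). intros.
          unfold qpoch; simpl. field; nz.
      - intros k Hk. unfold lhs_term. rewrite Nat.sub_succ.
        rewrite (qpoch_S_l b q (S k)), (qpoch_S_l c q (S k)).
        replace (S k * S k)%nat with (k * k + (k + k) + 1)%nat by lia.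
        rewrite !Cpow_add. replace (b * q * (c * q)) with (b * c * (q * q)) by ring.
        rewrite (Cpow_mul_l (b * c) (q * q)), (Cpow_mul_l q q).
        pose proof (qpoch_neq0 _ q (S k) Hb') as P1. pose proof (qpoch_neq0 _ q (S k) Hc') as P2.
        pose proof (qq_neq0 (n - k)) as P3. simpl (_ ^ 1). simpl ((b * c) ^ S k). intros. field; nz. }
    assert (ER : (Cx1 - b) * (Cx1 - c) * Csum (rhs_term b c (S n)) (S (S n))
            = Cx1 / qpoch q q (S n) + b * c * q * Csum (rhs_term (b * q) (c * q) n) (S n)).
    { pose proof (wz_sum (b * c) (S n) Ha) as W. rewrite Csum_S_l in W.
      (* Stated under a division so that only the 1 in 1/(q)_(n+1) is expanded into the full sum. *)
      assert (W' : forall z, Cx1 / z = (wz_term (b * c) (S n) 0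
          + Csum (fun k => wz_term (b * c) (S n) (S k)) (S n)) / z) by (intros; rewrite W; reflexivity).
      rewrite W', Csum_S_l. clear W W'.
      replace (Csum (fun k => rhs_term b c (S n) (S k)) (S n))
        with (Cinv ((Cx1 - b) * (Cx1 - c)) *
              (Cinv (qpoch q q (S n)) * Csum (fun k => wz_term (b * c) (S n) (S k)) (S n)
               + b * c * q * Csum (rhs_term (b * q) (c * q) n) (S n))).
      - replace (rhs_term b c (S n) 0) with (wz_term (b * c) (S n) 0 / (qpoch q q (S n) * (Cx1 - b) * (Cx1 - c))).
        + intros. field; nz.
        + unfold rhs_term, wz_term. rewrite Nat.sub_0_r.
          change (q ^ 0) with Cx1. replace (b * c * Cx1) with (b * c) by ring.
          pose proof (qpoch_neq0 _ q (S (S n)) Ha) as P.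
          generalize dependent (qpoch (b * c) q (S (S n))).
          generalize dependent (qpoch q q (S n)). intros. unfold qpoch; simpl. field; nz.
      - rewrite <- !Csum_mul, <- Csum_add, <- Csum_mul. apply Csum_ext. intros k Hk.
        pose proof (rhs_term_rec b c k (n - k) Hb Hc Ha) as E.
        replace (k + (n - k))%nat with n in E by lia.
        replace (rhs_term b c (S n) (S k)) with
          (Cinv ((Cx1 - b) * (Cx1 - c)) * ((Cx1 - b) * (Cx1 - c) * rhs_term b c (S n) (S k)))
          by (field; nz).
        rewrite E. unfold Cdiv. ring. }
    rewrite IH in EL. rewrite <- ER in EL.
    replace (Csum (lhs_term b c (S n)) (S (S n)))
      with (((Cx1 - b) * (Cx1 - c) * Csum (lhs_term b c (S n)) (S (S n))) / ((Cx1 - b) * (Cx1 - c))) by (field; nz).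
    rewrite EL. field; nz.
Qed.

End Finite.

Lemma Cpow_div (z w : Cx) (n : nat) : w <> Cx0 -> (z / w) ^ n = z ^ n / w ^ n.
Proof. intros Hw. unfold Cdiv. rewrite Cpow_mul_l, Cpow_inv by exact Hw. reflexivity. Qed.

Lemma Cpow_opp (z : Cx) (n : nat) : (- z) ^ n = (- Cx1) ^ n * z ^ n.
Proof. rewrite <- Cpow_mul_l. f_equal. ring. Qed.

Lemma Cpow_m1_sq (n : nat) : (- Cx1) ^ n * (- Cx1) ^ n = Cx1.
Proof. rewrite <- Cpow_mul_l. replace (- Cx1 * - Cx1) with Cx1 by ring. apply Cpow_1_l. Qed.

Lemma Cpow_m1_neq0 (n : nat) : (- Cx1) ^ n <> Cx0.
Proof.
  intros E. apply Cx1_neq0. rewrite <- (Cpow_m1_sq n), E. ring.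
Qed.

Lemma Cpow_m1_cases (n : nat) : (- Cx1) ^ n = Cx1 \/ (- Cx1) ^ n = - Cx1.
Proof. induction n as [|n [IH|IH]]; simpl; [left; reflexivity | right | left]; rewrite IH; ring. Qed.

Lemma Cdiv_neq0 (z w : Cx) : z <> Cx0 -> w <> Cx0 -> z / w <> Cx0.
Proof. intros. unfold Cdiv. apply Cmul_neq0; [|apply Cinv_neq0]; assumption. Qed.

Lemma qpoch_rev_div (x q : Cx) (m : nat) : q <> Cx0 -> x <> Cx0 ->
  qpoch (x / q ^ m) q m = (- Cx1) ^ m * x ^ m * qpoch (q / x) q m / q ^ tri m.
Proof.
  intros Hq Hx. pose proof (qpoch_rev x q m Hq Hx) as E. rewrite Cpow_opp in E.
  rewrite <- E. field. apply Cpow_neq0, Hq.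
Qed.

Lemma mulq_neq0 (q x : Cx) : (forall k, Cx1 - x * q ^ k <> Cx0) -> forall k, Cx1 - x * q * q ^ k <> Cx0.
Proof. intros H k. specialize (H (S k)). simpl in H. replace (x * q * q ^ k) with (x * (q * q ^ k)) by ring. exact H. Qed.

(** * The finite identity recentred at index N *)

Section Bilateral.
Ltac nzq :=
  nz; try (apply qpoch_neq0; assumption); try (apply qq_neq0; assumption);
  try (apply qpoch_neq0, mulq_neq0; assumption); try apply Cpow_m1_neq0.

Variables q b c : Cx.
Hypothesis Hq0 : q <> Cx0.
Hypothesis Hb0 : b <> Cx0.
Hypothesis Hc0 : c <> Cx0.
Hypothesis Hq : forall k, Cx1 - q ^ S k <> Cx0.
Hypothesis Hb : forall k, Cx1 - b * q ^ k <> Cx0.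
Hypothesis Hc : forall k, Cx1 - c * q ^ k <> Cx0.
Hypothesis Ha : forall k, Cx1 - b * c * q ^ k <> Cx0.
Hypothesis Hb' : forall k, Cx1 - q / b * q ^ k <> Cx0.
Hypothesis Hc' : forall k, Cx1 - q / c * q ^ k <> Cx0.
Hypothesis Ha' : forall k, Cx1 - q / (b * c) * q ^ k <> Cx0.

(** The terms with index N + r and N - (n + 1) of [finite_identity] for 2N, b/q^N and c/q^N,
    stripped of the factors that do not depend on the index: [bigK] on the left, q^N on the right.
    In [lneg] and [rneg] the negative powers of q have been cleared. *)
Definition lpos (N r : nat) : Cx :=
  q ^ (r * r) * (b * c) ^ r / (qpoch q q (N - r) * qpoch (b * q) q r * qpoch (c * q) q r).
Definition lneg (N n : nat) : Cx :=
  q ^ S n * qpoch (Cx1 / b) q (S n) * qpoch (Cx1 / c) q (S n) / qpoch q q (N + S n).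
Definition rpos (N r : nat) : Cx :=
  (Cx1 - b * c * q ^ (2 * r)) * (b * c) ^ (2 * r) * q ^ (2 * r * r)
  / ((Cx1 - b * q ^ r) * (Cx1 - c * q ^ r))
  / (qpoch q q (N + r) * qpoch q q (N - r) * qpoch (q / (b * c)) q (N - r) * qpoch (b * c) q (S (N + r))).
Definition rneg (N n : nat) : Cx :=
  (q ^ (2 * S n) - b * c) * q ^ (2 * S n * S n)
  / ((b * c) ^ (2 * S n) * (q ^ S n - b) * (q ^ S n - c))
  / (qpoch q q (N + S n) * qpoch q q (N - S n) * qpoch (q / (b * c)) q (N + S n)
     * qpoch (b * c) q (S (N - S n))).

(** For k >= N this is a factor of (x)_oo; for k < N it is a nonzero multiple of a factor of
    (q/x)_oo. *)
Lemma shifted_neq0 (x : Cx) (N : nat) : x <> Cx0 ->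
  (forall k, Cx1 - x * q ^ k <> Cx0) -> (forall k, Cx1 - q / x * q ^ k <> Cx0) ->
  forall k, Cx1 - x / q ^ N * q ^ k <> Cx0.
Proof.
  intros Hx H1 H2 k. destruct (Nat.le_gt_cases N k) as [H|H].
  - replace k with (N + (k - N))%nat by lia. rewrite Cpow_add.
    specialize (H1 (k - N)%nat).
    replace (x / q ^ N * (q ^ N * q ^ (k - N))) with (x * q ^ (k - N)); [exact H1|].
    field. apply Cpow_neq0, Hq0.
  - replace N with (k + S (N - S k))%nat by lia. rewrite Cpow_add. specialize (H2 (N - S k)%nat).
    cbn [Cpow]. set (y := q ^ (N - S k)) in *.
    intros E. apply H2.
    replace (Cx1 - q / x * y) with (- (q / x * y) * (Cx1 - x / (q ^ k * (q * y)) * q ^ k)).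
    + rewrite E. ring.
    + field; nz.
Qed.

Let bcq (N : nat) : b / q ^ N * (c / q ^ N) = b * c / q ^ (2 * N).
Proof.
  replace (2 * N)%nat with (N + N)%nat by lia. rewrite Cpow_add. field; nz.
Qed.

Let bc0 : b * c <> Cx0.
Proof. apply Cmul_neq0; assumption. Qed.

Let bigK (N : nat) : Cx := q ^ N / ((Cx1 - b) * (Cx1 - c) * qpoch (q / b) q N * qpoch (q / c) q N).

Let b1 : Cx1 - b <> Cx0.
Proof. specialize (Hb O). simpl in Hb. replace (b * Cx1) with b in Hb by ring. exact Hb. Qed.
Let c1 : Cx1 - c <> Cx0.
Proof. specialize (Hc O). simpl in Hc. replace (c * Cx1) with c in Hc by ring. exact Hc. Qed.

(** With N = i + r, the factorial (b q^(-N))_(N+r+1) splits after N factors into a part that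
    [qpoch_rev_div] reverses and (b)_(r+1); likewise for c. *)
Lemma lhs_pos (i r : nat) :
  lhs_term q (b / q ^ (i + r)) (c / q ^ (i + r)) (2 * (i + r)) (i + r + r)
  = bigK (i + r) * lpos (i + r) r.
Proof.
  unfold lhs_term, bigK, lpos. set (N := (i + r)%nat).
  replace (2 * N - (N + r))%nat with i by lia. replace (N - r)%nat with i by lia.
  replace (S (N + r)) with (N + S r)%nat by lia. rewrite !qpoch_add.
  replace (b / q ^ N * q ^ N) with b by (field; apply Cpow_neq0, Hq0).
  replace (c / q ^ N * q ^ N) with c by (field; apply Cpow_neq0, Hq0).
  rewrite !qpoch_rev_div by assumption. rewrite !(qpoch_S_l _ q r). rewrite bcq.
  rewrite Cpow_div, Cpow_pow by (apply Cpow_neq0, Hq0). rewrite (Cpow_add (b * c) N r).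
  replace (q ^ (2 * N * (N + r))) with (q ^ ((N + r) * (N + r)) * q ^ (tri N + tri N) / (q ^ (r * r) * q ^ N)).
  2:{ apply Cdiv_eq; [apply Cmul_neq0; apply Cpow_neq0, Hq0|]. rewrite <- !Cpow_add. f_equal.
      pose proof (tri_double N). nia. }
  rewrite (Cpow_add q (tri N)). rewrite !(Cpow_mul_l b c).
  (* The sign (-1)^N occurs squared, which [field] does not see; it is replaced by each of its two
     values. *)
  destruct (Cpow_m1_cases N) as [E|E]; rewrite E; clear E; field; nzq.
Qed.

Lemma lhs_neg (j n : nat) :
  lhs_term q (b / q ^ (j + S n)) (c / q ^ (j + S n)) (2 * (j + S n)) j
  = bigK (j + S n) * lneg (j + S n) n.
Proof.
  unfold lhs_term, bigK, lneg. set (N := (j + S n)%nat).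
  replace (2 * N - j)%nat with (N + S n)%nat by lia.
  (* Since N = j + 1 + n, the factorial (x q^(-N))_(j+1) is the quotient of (x q^(-N))_N by (x
     q^(-n))_n, and both of these can be reversed. *)
  assert (B : forall x, x <> Cx0 -> (forall k, Cx1 - x * q ^ k <> Cx0) ->
    (forall k, Cx1 - q / x * q ^ k <> Cx0) ->
    qpoch (x / q ^ N) q (S j) = (- Cx1) ^ N * x ^ N * qpoch (q / x) q N * q ^ tri n
         / ((- Cx1) ^ n * x ^ n * qpoch (q / x) q n * q ^ tri N)).
  { intros x Hx H1 H2. pose proof (qpoch_rev_div x q N Hq0 Hx) as E.
    pose proof (qpoch_rev_div x q n Hq0 Hx) as E2.
    replace (qpoch (x / q ^ N) q N) with (qpoch (x / q ^ N) q (S j) * qpoch (x / q ^ n) q n) in E.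
    - rewrite E2 in E.
      replace (qpoch (x / q ^ N) q (S j)) with
        (qpoch (x / q ^ N) q (S j) * ((- Cx1) ^ n * x ^ n * qpoch (q / x) q n / q ^ tri n)
          * (q ^ tri n / ((- Cx1) ^ n * x ^ n * qpoch (q / x) q n))) by (field; nzq).
      rewrite E. field; nzq.
    - replace N with (S j + n)%nat at 3 by (unfold N; lia). rewrite qpoch_add. f_equal. f_equal.
      replace N with (S j + n)%nat by (unfold N; lia). rewrite Cpow_add.
      field; nzq. }
  rewrite !B by assumption. rewrite bcq.
  rewrite !(qpoch_S_l (Cx1 / _) q n).
  replace (Cx1 / b * q) with (q / b) by (field; exact Hb0).
  replace (Cx1 / c * q) with (q / c) by (field; exact Hc0).
  rewrite Cpow_div, Cpow_pow by (apply Cpow_neq0, Hq0).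
  replace (q ^ (2 * N * j)) with (q ^ (j * j) * q ^ (tri N + tri N) / (q ^ (tri n + tri n) * q ^ N * q ^ S n)).
  2:{ apply Cdiv_eq; [apply Cmul_neq0; [apply Cmul_neq0|]; apply Cpow_neq0, Hq0|].
      rewrite <- !Cpow_add. f_equal. pose proof (tri_double N). pose proof (tri_double n). nia. }
  rewrite !(Cpow_mul_l b c).
  replace (b ^ N) with (b ^ j * (b * b ^ n)) by (unfold N; rewrite Cpow_add; reflexivity).
  replace (c ^ N) with (c ^ j * (c * c ^ n)) by (unfold N; rewrite Cpow_add; reflexivity).
  rewrite (Cpow_add q (tri N)), (Cpow_add q (tri n)).
  destruct (Cpow_m1_cases N) as [E|E]; rewrite E; clear E;
  destruct (Cpow_m1_cases n) as [E|E]; rewrite E; clear E; field; nzq.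
Qed.

Let qbc_split (i j : nat) :
  qpoch (b * c / q ^ i) q (i + S j)
  = (- Cx1) ^ i * (b * c) ^ i * qpoch (q / (b * c)) q i / q ^ tri i * qpoch (b * c) q (S j).
Proof.
  rewrite qpoch_add, qpoch_rev_div by assumption. f_equal. f_equal. field. apply Cpow_neq0, Hq0.
Qed.

Lemma rhs_pos (i r : nat) :
  rhs_term q (b / q ^ (i + r)) (c / q ^ (i + r)) (2 * (i + r)) (i + r + r)
  = q ^ (i + r) * rpos (i + r) r.
Proof.
  unfold rhs_term, rpos. set (N := (i + r)%nat).
  replace (2 * N - (N + r))%nat with i by lia. replace (N - r)%nat with i by lia.
  rewrite bcq.
  replace (b * c / q ^ (2 * N) * q ^ (N + r)) with (b * c / q ^ i).
  2:{ replace (2 * N)%nat with ((N + r) + i)%nat by lia. rewrite (Cpow_add q (N + r) i).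
      field. split; apply Cpow_neq0, Hq0. }
  replace (S (2 * N)) with (i + S (N + r))%nat by lia. rewrite qbc_split.
  rewrite Cpow_div, Cpow_pow by (apply Cpow_neq0, Hq0).
  replace (b / q ^ N * q ^ (N + r)) with (b * q ^ r) by (rewrite Cpow_add; field; apply Cpow_neq0, Hq0).
  replace (c / q ^ N * q ^ (N + r)) with (c * q ^ r) by (rewrite Cpow_add; field; apply Cpow_neq0, Hq0).
  replace (b * c / q ^ (2 * N) * q ^ (2 * (N + r))) with (b * c * q ^ (2 * r)).
  2:{ replace (2 * (N + r))%nat with (2 * N + 2 * r)%nat by lia. rewrite (Cpow_add q (2 * N)).
      field. apply Cpow_neq0, Hq0. }
  replace (q ^ (2 * N * (N + r))) with (q ^ ((N + r) * (N + r) + tri (N + r)) * q ^ tri i / (q ^ (2 * r * r) * q ^ N)).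
  2:{ apply Cdiv_eq; [apply Cmul_neq0; apply Cpow_neq0, Hq0|]. rewrite <- !Cpow_add. f_equal.
      pose proof (tri_double (N + r)). pose proof (tri_double i). unfold N in *. nia. }
  (* N + r = i + 2r, so this sign cancels the one produced by reversing the factorial of b c. *)
  replace ((- Cx1) ^ (N + r)) with ((- Cx1) ^ i * ((- Cx1) ^ r * (- Cx1) ^ r))
    by (unfold N; rewrite !Cpow_add; ring).
  rewrite Cpow_m1_sq.
  replace ((b * c) ^ (N + r)) with ((b * c) ^ i * (b * c) ^ (2 * r))
    by (rewrite <- Cpow_add; f_equal; unfold N; lia).
  pose proof (Hb r) as P11. pose proof (Hc r) as P12. field; nzq.
Qed.

Lemma rhs_neg (j n : nat) :
  rhs_term q (b / q ^ (j + S n)) (c / q ^ (j + S n)) (2 * (j + S n)) j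
  = q ^ (j + S n) * rneg (j + S n) n.
Proof.
  unfold rhs_term, rneg. set (N := (j + S n)%nat). set (m := S n) in *.
  replace (2 * N - j)%nat with (N + m)%nat by lia. replace (N - m)%nat with j by lia.
  rewrite bcq.
  replace (b * c / q ^ (2 * N) * q ^ j) with (b * c / q ^ (N + m)).
  2:{ replace (2 * N)%nat with (j + (N + m))%nat by lia. rewrite (Cpow_add q j (N + m)).
      field. split; apply Cpow_neq0, Hq0. }
  replace (S (2 * N)) with (N + m + S j)%nat by lia. rewrite qbc_split.
  rewrite Cpow_div, Cpow_pow by (apply Cpow_neq0, Hq0).
  replace (b / q ^ N * q ^ j) with (b / q ^ m) by (unfold N; rewrite Cpow_add; field; nzq).
  replace (c / q ^ N * q ^ j) with (c / q ^ m) by (unfold N; rewrite Cpow_add; field; nzq).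
  replace (b * c / q ^ (2 * N) * q ^ (2 * j)) with (b * c / (q ^ m * q ^ m)).
  2:{ replace (2 * N)%nat with (2 * j + (m + m))%nat by lia. rewrite !Cpow_add.
      replace (2 * j)%nat with (j + j)%nat by lia. field; nzq. }
  replace (q ^ (2 * N * j)) with (q ^ (j * j + tri j) * q ^ tri (N + m) / (q ^ (2 * m * m) * q ^ N)).
  2:{ apply Cdiv_eq; [apply Cmul_neq0; apply Cpow_neq0, Hq0|]. rewrite <- !Cpow_add. f_equal.
      pose proof (tri_double (N + m)). pose proof (tri_double j). unfold N in *. nia. }
  replace ((- Cx1) ^ (N + m)) with ((- Cx1) ^ j * ((- Cx1) ^ m * (- Cx1) ^ m))
    by (unfold N; rewrite !Cpow_add; ring).
  rewrite Cpow_m1_sq.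
  replace ((b * c) ^ (N + m)) with ((b * c) ^ j * (b * c) ^ (2 * m))
    by (rewrite <- Cpow_add; f_equal; unfold N; lia).
  replace (q ^ (2 * m)) with (q ^ m * q ^ m) by (rewrite <- Cpow_add; f_equal; lia).
  assert (G : forall x, x <> Cx0 -> (forall k, Cx1 - q / x * q ^ k <> Cx0) -> q ^ m - x <> Cx0).
  { intros x Hx H E. apply (H n). unfold m in E. cbn [Cpow] in E.
    replace (Cx1 - q / x * q ^ n) with (- (q * q ^ n - x) / x) by (field; exact Hx).
    rewrite E. field. exact Hx. }
  pose proof (G b Hb0 Hb') as P11. pose proof (G c Hc0 Hc') as P12. clear G. field; nzq.
Qed.

Lemma bilateral_finite (N : nat) :
  Csum (lpos N) (S N) + Csum (lneg N) N
  = (Cx1 - b) * (Cx1 - c) * qpoch (q / b) q N * qpoch (q / c) q N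
    * (Csum (rpos N) (S N) + Csum (rneg N) N).
Proof.
  assert (H1 := shifted_neq0 b N Hb0 Hb Hb'). assert (H2 := shifted_neq0 c N Hc0 Hc Hc').
  assert (H3 := shifted_neq0 (b * c) (2 * N) bc0 Ha Ha').
  assert (E := finite_identity q Hq (2 * N) _ _ H1 H2 ltac:(rewrite bcq; exact H3)).
  (* Splits the 2N + 1 terms at the middle index N and reverses the lower half. *)
  assert (Sp : forall (f p m : nat -> Cx) K,
     (forall r, (r <= N)%nat -> f (N + r)%nat = K * p r) ->
     (forall n, (n < N)%nat -> f (N - S n)%nat = K * m n) ->
     Csum f (S (2 * N)) = K * (Csum p (S N) + Csum m N)).
  { intros f p m K F1 F2. replace (S (2 * N)) with (N + S N)%nat by lia.
    rewrite Csum_split, Csum_rev. rewrite (Csum_ext _ (fun n => K * m n)) by (exact F2).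
    rewrite (Csum_ext _ (fun r => K * p r) (S N)) by (intros; apply F1; lia).
    rewrite !Csum_mul. ring. }
  rewrite (Sp _ (lpos N) (lneg N) (bigK N)) in E.
  - rewrite (Sp _ (rpos N) (rneg N) (q ^ N)) in E.
    + unfold bigK in E.
      replace (Csum (lpos N) (S N) + Csum (lneg N) N) with
        (q ^ N / ((Cx1 - b) * (Cx1 - c) * qpoch (q / b) q N * qpoch (q / c) q N) *
         (Csum (lpos N) (S N) + Csum (lneg N) N) *
         ((Cx1 - b) * (Cx1 - c) * qpoch (q / b) q N * qpoch (q / c) q N / q ^ N)) by (field; nzq).
      rewrite E. field; nzq.
    + intros r Hr. pose proof (rhs_pos (N - r) r) as T. replace (N - r + r)%nat with N in T by lia. exact T.
    + intros n Hn. pose proof (rhs_neg (N - S n) n) as T. replace (N - S n + S n)%nat with N in T by lia. exact T.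
  - intros r Hr. pose proof (lhs_pos (N - r) r) as T. replace (N - r + r)%nat with N in T by lia. exact T.
  - intros n Hn. pose proof (lhs_neg (N - S n) n) as T. replace (N - S n + S n)%nat with N in T by lia. exact T.
Qed.

End Bilateral.

Close Scope C_scope.

(** * Infinite products *)

Lemma Rdiv_ge0 (a b : R) : 0 <= a -> 0 < b -> 0 <= a / b.
Proof. intros. apply Rmult_le_pos; [assumption | left; apply Rinv_0_lt_compat; assumption]. Qed.

Lemma exp_ge_1_add (x : R) : 1 + x <= exp x.
Proof.
  destruct (Req_dec x 0) as [->|H]; [rewrite exp_0; lra|]. left. apply exp_ineq1. exact H.
Qed.

Lemma Cnorm_mul_le (z w : Cx) (A B : R) :
  Cnorm z <= A -> Cnorm w <= B -> Cnorm (z * w)%Cx <= A * B.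
Proof.
  intros. rewrite Cnorm_mul. apply Rmult_le_compat; try apply Cnorm_ge0; assumption.
Qed.

Lemma Cnorm_mul_ge (z w : Cx) (A B : R) :
  0 < A -> 0 < B -> A <= Cnorm z -> B <= Cnorm w -> A * B <= Cnorm (z * w)%Cx.
Proof. intros. rewrite Cnorm_mul. apply Rmult_le_compat; lra. Qed.

Lemma Cnorm_div_le (z w : Cx) (A B : R) :
  Cnorm z <= A -> 0 < B -> B <= Cnorm w -> Cnorm (z / w)%Cx <= A / B.
Proof.
  intros HA HB HW. rewrite Cnorm_div by (apply Cnorm_neq0; lra).
  apply Rmult_le_compat; [apply Cnorm_ge0 | left; apply Rinv_0_lt_compat; lra | exact HA |].
  apply Rinv_le_contravar; assumption.
Qed.

Lemma one_minus_ge (z : Cx) : 1 - Cnorm z <= Cnorm (Cx1 - z)%Cx.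
Proof. pose proof (Cnorm_sub_ge Cx1 z) as H. rewrite Cnorm_1 in H. exact H. Qed.

Lemma one_minus_le (z : Cx) : Cnorm (Cx1 - z)%Cx <= 1 + Cnorm z.
Proof. pose proof (Cnorm_sub Cx1 z) as H. rewrite Cnorm_1 in H. exact H. Qed.

Lemma one_minus_neq0 (z : Cx) : Cnorm z < 1 -> (Cx1 - z)%Cx <> Cx0.
Proof. intros H. apply Cnorm_neq0. pose proof (one_minus_ge z). lra. Qed.

Lemma pow_le_1 (x : R) (n : nat) : 0 <= x <= 1 -> x ^ n <= 1.
Proof. intros H. rewrite <- (pow1 n). apply pow_incr. exact H. Qed.

(** K^r x^(r^2) = (K x^r)^r, and 2 K x^r < 1 from some R on; the finitely many earlier r are
    absorbed into C. This turns Gaussian decay into the geometric majorant for [tannery], however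
    large K is. *)
Lemma gauss_bound (K x : R) : 0 <= K -> 0 <= x < 1 ->
  exists C, 0 <= C /\ forall r : nat, K ^ r * x ^ (r * r) <= C * (1 / 2) ^ r.
Proof.
  intros HK Hx.
  destruct (geo_cv0 (2 * K) x Hx 1) as [R HR]; [lra|].
  assert (B : forall n, exists M, 1 <= M /\ forall r, (r <= n)%nat -> (2 * K) ^ r * x ^ (r * r) <= M).
  { induction n as [|n [M [HM IH]]].
    - exists 1. split; [lra|]. intros r Hr. replace r with O by lia. simpl. lra.
    - exists (Rmax M ((2 * K) ^ S n * x ^ (S n * S n))). split.
      + eapply Rle_trans; [exact HM | apply Rmax_l].
      + intros r Hr. destruct (Nat.eq_dec r (S n)) as [->|Hne]; [apply Rmax_r|].
        eapply Rle_trans; [apply IH; lia | apply Rmax_l]. }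
  destruct (B R) as [M [HM HB]]. exists M. split; [lra|]. intros r.
  assert (HH : (2 * K) ^ r * x ^ (r * r) <= M).
  { destruct (Nat.le_gt_cases r R) as [H|H]; [apply HB, H|].
    rewrite pow_mult, <- Rpow_mult_distr.
    specialize (HR r ltac:(lia)). unfold Rdist in HR. rewrite Rminus_0_r in HR.
    assert (0 <= 2 * K * x ^ r) by (apply Rmult_le_pos; [lra | apply pow_le; lra]).
    rewrite Rabs_pos_eq in HR by assumption.
    eapply Rle_trans; [apply pow_le_1; lra | lra]. }
  replace (K ^ r * x ^ (r * r)) with ((2 * K) ^ r * x ^ (r * r) * (1 / 2) ^ r).
  - apply Rmult_le_compat_r; [apply pow_le; lra | exact HH].
  - rewrite Rpow_mult_distr.
    replace (2 ^ r * K ^ r * x ^ (r * r) * (1 / 2) ^ r) with ((2 ^ r * (1 / 2) ^ r) * (K ^ r * x ^ (r * r))) by ring.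
    rewrite <- Rpow_mult_distr. replace (2 * (1 / 2)) with 1 by field. rewrite pow1. ring.
Qed.

Section Products.
Variable q : Cx.
Hypothesis hq : Cnorm q < 1.
Let x := Cnorm q.
Let Hx : 0 <= x < 1. Proof. split; [apply Cnorm_ge0 | exact hq]. Qed.

Definition geo_sum (n : nat) : R := (1 - x ^ n) / (1 - x).

Lemma geo_sum_S (n : nat) : geo_sum (S n) = geo_sum n + x ^ n.
Proof. unfold geo_sum. simpl. field. lra. Qed.

Lemma geo_sum_bounds (n : nat) : 0 <= geo_sum n <= 1 / (1 - x).
Proof.
  unfold geo_sum. pose proof (pow_le_1 x n ltac:(lra)). pose proof (pow_le x n ltac:(lra)).
  assert (0 < / (1 - x)) by (apply Rinv_0_lt_compat; lra). unfold Rdiv. nra.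
Qed.

(** Bounds for |(a;q)_n| that hold for all n at once, from 1 + A x^j <= exp (A x^j) and from 1 - v
    >= exp (-v / (1 - rho)) for 0 <= v <= rho. *)
Definition ubound (A : R) : R := exp (A * (1 / (1 - x))).
Definition lbound (rho : R) : R := exp (- (rho / (1 - rho) * (1 / (1 - x)))).

Lemma qpoch_le (a : Cx) (A : R) (n : nat) : Cnorm a <= A -> Cnorm (qpoch a q n) <= ubound A.
Proof.
  intros HA. pose proof (Cnorm_ge0 a).
  apply Rle_trans with (exp (A * geo_sum n)).
  - induction n as [|n IH].
    + unfold qpoch; simpl. rewrite Cnorm_1. pose proof (geo_sum_bounds 0).
      pose proof (exp_ge_1_add (A * geo_sum 0)). nra.
    + rewrite qpoch_S, geo_sum_S, Rmult_plus_distr_l, exp_plus.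
      apply Cnorm_mul_le; [exact IH|]. eapply Rle_trans; [apply one_minus_le|].
      rewrite Cnorm_mul, Cnorm_pow. fold x. pose proof (exp_ge_1_add (A * x ^ n)).
      pose proof (pow_le x n ltac:(lra)). nra.
  - unfold ubound. pose proof (geo_sum_bounds n).
    destruct (Req_dec (A * geo_sum n) (A * (1 / (1 - x)))) as [->|]; [lra|].
    left. apply exp_increasing. nra.
Qed.

Lemma lbound_pos (rho : R) : 0 < lbound rho.
Proof. apply exp_pos. Qed.

Lemma qpoch_ge (a : Cx) (rho : R) (n : nat) :
  Cnorm a <= rho -> rho < 1 -> lbound rho <= Cnorm (qpoch a q n).
Proof.
  intros HA Hr. pose proof (Cnorm_ge0 a).
  assert (Hd : 0 <= rho / (1 - rho)) by (apply Rdiv_ge0; lra).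
  apply Rle_trans with (exp (- (rho / (1 - rho) * geo_sum n))).
  - unfold lbound. pose proof (geo_sum_bounds n).
    destruct (Req_dec (geo_sum n) (1 / (1 - x))) as [->|]; [lra|].
    assert (rho / (1 - rho) * geo_sum n <= rho / (1 - rho) * (1 / (1 - x))) by (apply Rmult_le_compat_l; lra).
    destruct (Req_dec (rho / (1 - rho) * geo_sum n) (rho / (1 - rho) * (1 / (1 - x)))) as [->|]; [lra|].
    left. apply exp_increasing. lra.
  - induction n as [|n IH].
    + unfold qpoch, geo_sum; simpl. rewrite Cnorm_1.
      replace (- (rho / (1 - rho) * ((1 - 1) / (1 - x)))) with 0 by (field; lra). rewrite exp_0. lra.
    + rewrite qpoch_S, geo_sum_S, Rmult_plus_distr_l, Ropp_plus_distr, exp_plus.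
      apply Cnorm_mul_ge; try apply exp_pos; [exact IH|].
      eapply Rle_trans; [|apply one_minus_ge]. rewrite Cnorm_mul, Cnorm_pow. fold x.
      pose proof (pow_le x n ltac:(lra)). pose proof (pow_le_1 x n ltac:(lra)).
      (* 1 - v >= 1 / (1 + v/(1 - rho)), because (1 - v)(1 + v/(1 - rho)) exceeds 1 by v (rho -
         v)/(1 - rho). *)
      set (v := rho * x ^ n). replace (rho / (1 - rho) * x ^ n) with (v / (1 - rho)) by (unfold v; field; lra).
      assert (Hv : 0 <= v <= rho) by (unfold v; nra).
      assert (Cnorm a * x ^ n <= v) by (unfold v; nra).
      rewrite exp_Ropp. apply Rle_trans with (1 - v); [|lra].
      assert (0 <= v / (1 - rho)) by (apply Rdiv_ge0; lra).
      apply Rle_trans with (/ (1 + v / (1 - rho))).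
      * apply Rinv_le_contravar; [lra | apply exp_ge_1_add].
      * apply Rmult_le_reg_r with (1 + v / (1 - rho)); [lra|]. rewrite Rinv_l by lra.
        replace ((1 - v) * (1 + v / (1 - rho))) with (1 + v * (rho - v) / (1 - rho)) by (field; lra).
        assert (0 <= v * (rho - v) / (1 - rho)); [|lra].
        apply Rdiv_ge0; nra.
Qed.

Lemma qpoch_cv (a : Cx) : exists P, qpoch_inf_cv a q P.
Proof.
  destruct (geo_step_cv (qpoch a q) (ubound (Cnorm a) * Cnorm a) x Hx) as [P [HP _]].
  - apply Rmult_le_pos; [left; apply exp_pos | apply Cnorm_ge0].
  - intros n. rewrite qpoch_S.
    replace (qpoch a q n * (Cx1 - a * q ^ n) - qpoch a q n)%Cx with (- (qpoch a q n * (a * q ^ n)))%Cx by ring.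
    rewrite Cnorm_opp, !Cnorm_mul, Cnorm_pow, Rmult_assoc. fold x.
    apply Rmult_le_compat_r; [apply Rmult_le_pos; [apply Cnorm_ge0 | apply pow_le; lra]|].
    apply qpoch_le. lra.
  - exists P. exact HP.
Qed.

Lemma qpoch_inf_neq0 (a P : Cx) : Cnorm a < 1 -> qpoch_inf_cv a q P -> P <> Cx0.
Proof.
  intros Ha HP. apply Cnorm_neq0. eapply Rlt_le_trans; [apply (lbound_pos (Cnorm a))|].
  apply (cv_norm_ge _ _ _ HP). intros n. apply qpoch_ge; [lra | exact Ha].
Qed.

Lemma qpoch_lipschitz (a b : Cx) (A : R) (n : nat) : Cnorm a <= A -> Cnorm b <= A ->
  Cnorm (qpoch a q n - qpoch b q n)%Cx <= Cnorm (a - b)%Cx * (ubound A * ubound A * geo_sum n).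
Proof.
  intros Ha Hb. set (d := Cnorm (a - b)%Cx). assert (Hd : 0 <= d) by apply Cnorm_ge0.
  assert (HA : 0 <= A) by (pose proof (Cnorm_ge0 a); lra).
  assert (HU : 1 <= ubound A).
  { unfold ubound. assert (0 < 1 / (1 - x)) by (apply Rmult_lt_0_compat; [lra | apply Rinv_0_lt_compat; lra]).
    pose proof (exp_ge_1_add (A * (1 / (1 - x)))). nra. }
  (* the factor exp (A * geo_sum n) grows with n and absorbs the factors 1 + A x^n of the telescoping estimate *)
  apply Rle_trans with (d * (exp (A * geo_sum n) * ubound A * geo_sum n)).
  - induction n as [|n IH].
    + unfold qpoch; simpl. replace (Cx1 - Cx1)%Cx with Cx0 by ring. rewrite Cnorm_0.
      pose proof (geo_sum_bounds 0). pose proof (exp_pos (A * geo_sum 0)).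
      apply Rmult_le_pos; [exact Hd|]. apply Rmult_le_pos; [|lra]. nra.
    + rewrite !qpoch_S.
      replace (qpoch a q n * (Cx1 - a * q ^ n) - qpoch b q n * (Cx1 - b * q ^ n))%Cx with
        ((qpoch a q n - qpoch b q n) * (Cx1 - a * q ^ n) + - (qpoch b q n * ((a - b) * q ^ n)))%Cx by ring.
      eapply Rle_trans; [apply Cnorm_triang|].
      rewrite Cnorm_opp, !Cnorm_mul, Cnorm_pow. fold x d.
      pose proof (one_minus_le (a * q ^ n)%Cx) as O. rewrite Cnorm_mul, Cnorm_pow in O. fold x in O.
      pose proof (qpoch_le b A n Hb) as U. pose proof (pow_le x n ltac:(lra)) as X.
      pose proof (exp_ge_1_add (A * x ^ n)) as E1.
      pose proof (geo_sum_bounds n) as G.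
      rewrite geo_sum_S, (Rmult_plus_distr_l A), exp_plus.
      assert (E0 : 1 <= exp (A * geo_sum n)) by (pose proof (exp_ge_1_add (A * geo_sum n)); nra).
      assert (E2 : Cnorm (Cx1 - a * q ^ n)%Cx <= exp (A * x ^ n)) by (pose proof (Cnorm_ge0 a); nra).
      assert (E3 : 1 <= exp (A * x ^ n)) by nra.
      replace (d * (exp (A * geo_sum n) * exp (A * x ^ n) * ubound A * (geo_sum n + x ^ n))) with
        (d * (exp (A * geo_sum n) * ubound A * geo_sum n) * exp (A * x ^ n)
         + ubound A * (d * x ^ n) * (exp (A * geo_sum n) * exp (A * x ^ n))) by ring.
      apply Rplus_le_compat.
      * apply Rmult_le_compat; try apply Cnorm_ge0; assumption.
      * assert (Y : 0 <= d * x ^ n) by nra.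
        apply Rle_trans with (ubound A * (d * x ^ n)); [apply Rmult_le_compat_r; assumption|].
        rewrite <- (Rmult_1_r (ubound A * (d * x ^ n))) at 1. apply Rmult_le_compat_l; nra.
  - apply Rmult_le_compat_l; [exact Hd|]. pose proof (geo_sum_bounds n).
    apply Rmult_le_compat_r; [lra|]. apply Rmult_le_compat_r; [lra|].
    unfold ubound. destruct (Req_dec (A * geo_sum n) (A * (1 / (1 - x)))) as [->|]; [lra|].
    left. apply exp_increasing. nra.
Qed.

(** Once [geo_sum] is bounded, the constant in [qpoch_lipschitz] no longer depends on n, so the
    estimate passes to the infinite products. *)
Lemma qpoch_inf_continuous (t : nat -> Cx) (P : nat -> Cx) (t0 P0 : Cx) (A : R) :
  (forall m, Cnorm (t m) <= A) -> Cseq_cv t t0 ->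
  (forall m, qpoch_inf_cv (t m) q (P m)) -> qpoch_inf_cv t0 q P0 -> Cseq_cv P P0.
Proof.
  intros HA Ht HP HP0. pose proof (cv_norm_le _ _ _ Ht HA) as HA0.
  set (M := ubound A * ubound A * (1 / (1 - x)) + 1).
  assert (HM : 0 < M).
  { unfold M. assert (0 <= ubound A * ubound A * (1 / (1 - x))); [|lra]. unfold ubound.
    assert (0 < / (1 - x)) by (apply Rinv_0_lt_compat; lra). unfold Rdiv in *.
    apply Rmult_le_pos; nra. }
  assert (D : forall m, Cnorm (P m - P0)%Cx <= Cnorm (t m - t0)%Cx * M).
  { intros m. apply (cv_norm_le (fun n => (qpoch (t m) q n - qpoch t0 q n)%Cx)).
    - apply cv_sub; [apply HP | exact HP0].
    - intros n. eapply Rle_trans; [apply (qpoch_lipschitz _ _ A n (HA m) HA0)|].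
      apply Rmult_le_compat_l; [apply Cnorm_ge0|]. unfold M. pose proof (geo_sum_bounds n).
      pose proof (exp_pos (A * (1 / (1 - x)))) as U. fold (ubound A) in U. nra. }
  intros e He. destruct (Ht (e / M)) as [N HN]; [apply Rdiv_lt_0_compat; lra|].
  exists N. intros n Hn. specialize (HN n Hn). eapply Rle_lt_trans; [apply D|].
  replace e with (e / M * M) by (field; lra). apply Rmult_lt_compat_r; assumption.
Qed.

End Products.

(** * The bilateral transformation *)

(** The factor k = 0 is controlled by t <> 1, all others by |t q| < 1. The number t itself may lie
    outside the unit disc, as the scaled b and c of f and phi do. *)
Lemma one_minus_pow_ge (q t : Cx) : Cnorm q < 1 -> t <> Cx1 -> Cnorm (t * q)%Cx < 1 ->
  exists d, 0 < d /\ forall k, d <= Cnorm (Cx1 - t * q ^ k)%Cx.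
Proof.
  intros hq Ht Htq.
  assert (H0 : (Cx1 - t)%Cx <> Cx0) by (apply Csub_neq0; congruence).
  exists (Rmin (Cnorm (Cx1 - t)%Cx) (1 - Cnorm (t * q)%Cx)). split.
  - apply Rmin_glb_lt; [apply Cnorm_pos, H0 | lra].
  - intros [|k].
    + simpl. replace (t * Cx1)%Cx with t by ring. apply Rmin_l.
    + eapply Rle_trans; [apply Rmin_r|]. eapply Rle_trans; [|apply one_minus_ge].
      replace (t * q ^ S k)%Cx with (t * q * q ^ k)%Cx by (simpl; ring).
      rewrite (Cnorm_mul (t * q)%Cx), Cnorm_pow. pose proof (Cnorm_ge0 (t * q)%Cx). pose proof (Cnorm_ge0 q).
      pose proof (pow_le_1 (Cnorm q) k ltac:(lra)). nra.
Qed.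

Lemma one_minus_pow_neq0 (q t : Cx) : Cnorm q < 1 -> t <> Cx1 -> Cnorm (t * q)%Cx < 1 ->
  forall k, (Cx1 - t * q ^ k)%Cx <> Cx0.
Proof.
  intros hq Ht Htq k. destruct (one_minus_pow_ge q t hq Ht Htq) as [d [Hd H]].
  apply Cnorm_neq0. specialize (H k). lra.
Qed.

Lemma one_minus_small_pow_ge (q t : Cx) (k : nat) : Cnorm q < 1 -> Cnorm t < 1 ->
  1 - Cnorm t <= Cnorm (Cx1 - t * q ^ k)%Cx.
Proof.
  intros hq Ht. eapply Rle_trans; [|apply one_minus_ge]. rewrite Cnorm_mul, Cnorm_pow.
  pose proof (Cnorm_ge0 t). pose proof (Cnorm_ge0 q).
  pose proof (pow_le_1 (Cnorm q) k ltac:(lra)). nra.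
Qed.

Lemma one_minus_small_pow_neq0 (q t : Cx) : Cnorm q < 1 -> Cnorm t < 1 ->
  forall k, (Cx1 - t * q ^ k)%Cx <> Cx0.
Proof.
  intros hq Ht k. apply Cnorm_neq0. pose proof (one_minus_small_pow_ge q t k hq Ht). lra.
Qed.

Section Transform.
Variables q b c : Cx.
Hypothesis hq : Cnorm q < 1.
Hypothesis hq0 : q <> Cx0.
Hypothesis hb0 : b <> Cx0.
Hypothesis hc0 : c <> Cx0.
Hypothesis hb1 : b <> Cx1.
Hypothesis hc1 : c <> Cx1.
Hypothesis ha1 : (b * c)%Cx <> Cx1.
Hypothesis hb : Cnorm (b * q)%Cx < 1.
Hypothesis hc : Cnorm (c * q)%Cx < 1.
Hypothesis ha : Cnorm (b * c * q)%Cx < 1.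
Hypothesis hb' : Cnorm (q / b)%Cx < 1.
Hypothesis hc' : Cnorm (q / c)%Cx < 1.
Hypothesis ha' : Cnorm (q / (b * c))%Cx < 1.
Let x := Cnorm q.
Let Hx : 0 <= x < 1. Proof. split; [apply Cnorm_ge0 | exact hq]. Qed.
Let Hx0 : 0 < x. Proof. apply Cnorm_pos, hq0. Qed.
Let a0 : (b * c)%Cx <> Cx0. Proof. apply Cmul_neq0; assumption. Qed.

Let sq_lt1 (y : R) : 0 <= y < 1 -> 0 <= y * y < 1. Proof. nra. Qed.

Lemma lpos_bound : exists C, 0 <= C /\ forall N r, Cnorm (lpos q b c N r) <= C * (1 / 2) ^ r.
Proof.
  destruct (gauss_bound (Cnorm (b * c)%Cx) x (Cnorm_ge0 _) Hx) as [C [HC HB]].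
  set (D := lbound q x * lbound q (Cnorm (b * q)%Cx) * lbound q (Cnorm (c * q)%Cx)).
  pose proof (lbound_pos q x) as L1. pose proof (lbound_pos q (Cnorm (b * q)%Cx)) as L2.
  pose proof (lbound_pos q (Cnorm (c * q)%Cx)) as L3.
  assert (HD : 0 < D) by (unfold D; apply Rmult_lt_0_compat; [apply Rmult_lt_0_compat|]; assumption).
  exists (C / D). split; [apply Rdiv_ge0; lra|].
  intros N r. unfold lpos. replace (C / D * (1 / 2) ^ r) with (C * (1 / 2) ^ r / D) by (field; lra).
  apply Cnorm_div_le; [| exact HD |].
  - rewrite Cnorm_mul, !Cnorm_pow. rewrite Rmult_comm. apply HB.
  - apply Cnorm_mul_ge; [apply Rmult_lt_0_compat; assumption | assumption | |].
    + apply Cnorm_mul_ge; try assumption; apply (qpoch_ge q hq); unfold x; lra.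
    + apply (qpoch_ge q hq); lra.
Qed.

(** There is no quadratic exponent here: the decay comes from q^(n+1) alone, the two q-factorials
    above being bounded. *)
Lemma lneg_bound : exists C, 0 <= C /\ forall N n, Cnorm (lneg q b c N n) <= C * x ^ n.
Proof.
  set (U := ubound q (Cnorm (Cx1 / b)%Cx) * ubound q (Cnorm (Cx1 / c)%Cx)).
  assert (HU : 0 < U) by (apply Rmult_lt_0_compat; apply exp_pos).
  pose proof (lbound_pos q x) as L1.
  exists (U / lbound q x). split; [apply Rdiv_ge0; lra|].
  intros N n. unfold lneg. replace (U / lbound q x * x ^ n) with (x ^ n * U / lbound q x) by (field; lra).
  apply Cnorm_div_le; [| exact L1 | apply (qpoch_ge q hq); unfold x; lra].
  unfold U. rewrite <- Rmult_assoc.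
  apply Cnorm_mul_le; [apply Cnorm_mul_le|]; try (apply (qpoch_le q hq); lra).
  rewrite Cnorm_pow. fold x. simpl. pose proof (pow_le x n ltac:(lra)). nra.
Qed.

(** The factor 1 - b c is split off because |b c| may exceed 1, while |b c q| < 1. *)
Lemma qpoch_a_ge (j : nat) :
  Cnorm (Cx1 - b * c)%Cx * lbound q (Cnorm (b * c * q)%Cx) <= Cnorm (qpoch (b * c) q (S j))%Cx.
Proof.
  rewrite qpoch_S_l. apply Cnorm_mul_ge; [| apply lbound_pos | lra | apply (qpoch_ge q hq); lra].
  apply Cnorm_pos, Csub_neq0. congruence.
Qed.

(** The part of [rpos] and [rneg] that does not depend on N; the remaining q-factorials converge to
    a constant. *)
Definition rpos_limit (r : nat) : Cx :=
  ((Cx1 - b * c * q ^ (2 * r)) * (b * c) ^ (2 * r) * q ^ (2 * r * r)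
  / ((Cx1 - b * q ^ r) * (Cx1 - c * q ^ r)))%Cx.
Definition rneg_limit (n : nat) : Cx :=
  ((q ^ (2 * S n) - b * c) * q ^ (2 * S n * S n)
  / ((b * c) ^ (2 * S n) * (q ^ S n - b) * (q ^ S n - c)))%Cx.

Let wbound (i j k : nat) : exists D, 0 < D /\ forall i j k l,
  D <= Cnorm (qpoch q q i * qpoch q q j * qpoch (q / (b * c)) q k * qpoch (b * c) q (S l))%Cx.
Proof.
  pose proof (lbound_pos q x) as L1. pose proof (lbound_pos q (Cnorm (q / (b * c))%Cx)) as L2.
  pose proof (lbound_pos q (Cnorm (b * c * q)%Cx)) as L3.
  assert (L4 : 0 < Cnorm (Cx1 - b * c)%Cx) by (apply Cnorm_pos, Csub_neq0; congruence).
  (* The constant is left open and read off from the lower bounds of the four factors. *)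
  eexists. split.
  2:{ intros i' j' k' l. apply Cnorm_mul_ge; [| | | apply qpoch_a_ge].
      3: apply Cnorm_mul_ge; [| | | apply (qpoch_ge q hq); [apply Rle_refl | exact ha']].
      5: apply Cnorm_mul_ge; [| | apply (qpoch_ge q hq) | apply (qpoch_ge q hq)].
      7: apply Rle_refl. 8: apply Rle_refl. all: try exact hq; fold x; repeat apply Rmult_lt_0_compat; assumption. }
  fold x. repeat apply Rmult_lt_0_compat; assumption.
Qed.

Lemma rpos_limit_bound : exists C, 0 <= C /\ forall r, Cnorm (rpos_limit r) <= C * (1 / 2) ^ r.
Proof.
  destruct (gauss_bound (Cnorm (b * c)%Cx * Cnorm (b * c)%Cx) (x * x)) as [C [HC HB]].
  { apply Rmult_le_pos; apply Cnorm_ge0. } { apply sq_lt1, Hx. }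
  destruct (one_minus_pow_ge q b hq hb1 hb) as [d1 [Hd1 B1]].
  destruct (one_minus_pow_ge q c hq hc1 hc) as [d2 [Hd2 B2]].
  assert (HD : 0 < d1 * d2) by nra.
  set (E := 1 + Cnorm (b * c)%Cx). assert (HE : 0 < E) by (unfold E; pose proof (Cnorm_ge0 (b * c)%Cx); lra).
  exists (E * C / (d1 * d2)). split.
  { apply Rdiv_ge0; nra. }
  intros r. unfold rpos_limit.
  replace (E * C / (d1 * d2) * (1 / 2) ^ r) with (E * (C * (1 / 2) ^ r) / (d1 * d2)) by (field; lra).
  apply Cnorm_div_le; [| exact HD | apply Cnorm_mul_ge; auto].
  match goal with |- Cnorm (?u * ?v * ?w)%Cx <= _ => replace (u * v * w)%Cx with (u * (v * w))%Cx by ring end.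
  apply Cnorm_mul_le.
  - eapply Rle_trans; [apply one_minus_le|]. rewrite (Cnorm_mul (b * c)%Cx), Cnorm_pow. fold x. unfold E.
    pose proof (pow_le_1 x (2 * r) ltac:(lra)). pose proof (Cnorm_ge0 (b * c)%Cx). nra.
  - rewrite Cnorm_mul, !Cnorm_pow. fold x. eapply Rle_trans; [|apply (HB r)]. right.
    rewrite !Rpow_mult_distr, <- !pow_add. f_equal; f_equal; lia.
Qed.

Lemma rneg_limit_bound : exists C, 0 <= C /\ forall n, Cnorm (rneg_limit n) <= C * (1 / 2) ^ n.
Proof.
  pose proof (Cnorm_pos _ a0) as Pa. pose proof (Cnorm_pos _ hb0) as Pb. pose proof (Cnorm_pos _ hc0) as Pc.
  destruct (gauss_bound (/ (Cnorm (b * c)%Cx * Cnorm (b * c)%Cx)) (x * x)) as [C [HC HB]].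
  { left. apply Rinv_0_lt_compat. nra. } { apply sq_lt1, Hx. }
  set (E := 1 + Cnorm (b * c)%Cx). assert (HE : 0 < E) by (unfold E; lra).
  set (d1 := Cnorm b * (1 - Cnorm (q / b)%Cx)). set (d2 := Cnorm c * (1 - Cnorm (q / c)%Cx)).
  assert (H1 : 0 < d1) by (unfold d1; apply Rmult_lt_0_compat; lra).
  assert (H2 : 0 < d2) by (unfold d2; apply Rmult_lt_0_compat; lra).
  assert (HD : 0 < d1 * d2) by nra.
  assert (G : forall t n, t <> Cx0 -> Cnorm (q / t)%Cx < 1 ->
             Cnorm t * (1 - Cnorm (q / t)%Cx) <= Cnorm (q ^ S n - t)%Cx).
  { intros t n Ht Hqt. replace (q ^ S n - t)%Cx with (- (t * (Cx1 - q / t * q ^ n)))%Cx by (simpl; field; exact Ht).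
    rewrite Cnorm_opp, Cnorm_mul. apply Rmult_le_compat_l; [apply Cnorm_ge0|].
    apply one_minus_small_pow_ge; assumption. }
  exists (E * C / (d1 * d2)). split.
  { apply Rdiv_ge0; nra. }
  intros n. unfold rneg_limit.
  replace ((q ^ (2 * S n) - b * c) * q ^ (2 * S n * S n) / ((b * c) ^ (2 * S n) * (q ^ S n - b) * (q ^ S n - c)))%Cx
   with ((q ^ (2 * S n) - b * c) * (q ^ (2 * S n * S n) * Cinv ((b * c) ^ (2 * S n))) / ((q ^ S n - b) * (q ^ S n - c)))%Cx.
  2:{ assert (Z1 : (q ^ S n - b)%Cx <> Cx0) by (apply Cnorm_neq0; eapply Rlt_le_trans; [exact H1 | apply G; assumption]).
      assert (Z2 : (q ^ S n - c)%Cx <> Cx0) by (apply Cnorm_neq0; eapply Rlt_le_trans; [exact H2 | apply G; assumption]).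
      pose proof (Cpow_neq0 _ (2 * S n) a0) as Z3. intros. field; nz. }
  apply Rle_trans with (E * (C * (1 / 2) ^ n) / (d1 * d2)).
  2:{ right. field. lra. }
  apply Cnorm_div_le; [| exact HD | apply Cnorm_mul_ge; auto; apply G; assumption].
  apply Cnorm_mul_le.
  - eapply Rle_trans; [apply Cnorm_sub|]. rewrite Cnorm_pow. fold x. unfold E.
    pose proof (pow_le_1 x (2 * S n) ltac:(lra)). lra.
  - rewrite Cnorm_mul, Cnorm_inv, !Cnorm_pow by (apply Cpow_neq0; exact a0). fold x.
    eapply Rle_trans; [|eapply Rle_trans; [apply (HB (S n))|]].
    + right. rewrite pow_inv, !Rpow_mult_distr, <- !pow_add, Rmult_comm. f_equal; [f_equal|]; f_equal; lia.
    + simpl. pose proof (pow_le (1 / 2) n ltac:(lra)). nra.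
Qed.

(** N tends to infinity in [bilateral_finite], with [tannery_partial] for each of the four sums. The
    product (b c)_oo appears as (1 - b c) times (b c q)_oo, whose argument lies in the unit disc. *)
Theorem bilateral_transform (Q Kb Kc E1 E2 : Cx) :
  qpoch_inf_cv q q Q -> qpoch_inf_cv (q / b)%Cx q Kb -> qpoch_inf_cv (q / c)%Cx q Kc ->
  qpoch_inf_cv (q / (b * c))%Cx q E1 -> qpoch_inf_cv (b * c * q)%Cx q E2 ->
  exists Lp Ln Rp Rn : Cx,
    Cseries_cv (fun r => (q ^ (r * r) * (b * c) ^ r / (qpoch (b * q) q r * qpoch (c * q) q r))%Cx) Lp /\
    Cseries_cv (fun n => (q ^ S n * qpoch (Cx1 / b) q (S n) * qpoch (Cx1 / c) q (S n))%Cx) Ln /\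
    Cseries_cv rpos_limit Rp /\ Cseries_cv rneg_limit Rn /\
    (Lp + Ln = (Cx1 - b) * (Cx1 - c) * Kb * Kc / (Q * E1 * (Cx1 - b * c) * E2) * (Rp + Rn))%Cx.
Proof.
  intros HQ HKb HKc HE1 HE2.
  assert (NQ := qpoch_inf_neq0 q hq q Q hq HQ). assert (NE1 := qpoch_inf_neq0 q hq _ E1 ha' HE1).
  assert (NE2 := qpoch_inf_neq0 q hq _ E2 ha HE2).
  assert (Na : (Cx1 - b * c)%Cx <> Cx0) by (apply Csub_neq0; congruence).
  assert (HEa : Cseq_cv (fun n => qpoch (b * c) q (S n))%Cx ((Cx1 - b * c) * E2)%Cx).
  { apply (cv_ext (fun n => ((Cx1 - b * c) * qpoch (b * c * q) q n)%Cx)); [intros; symmetry; apply qpoch_S_l|].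
    apply cv_mul; [apply cv_const | exact HE2]. }
  assert (Sh : forall u l k, Cseq_cv u l -> Cseq_cv (fun N => u (N + k)%nat) l).
  { intros u l k H. apply (cv_subseq u l (fun N => (N + k)%nat)); [intros; lia | exact H]. }
  destruct lpos_bound as [C1 [HC1 B1]]. destruct lneg_bound as [C2 [HC2 B2]].
  destruct rpos_limit_bound as [C3 [HC3 B3]]. destruct rneg_limit_bound as [C4 [HC4 B4]].
  destruct (wbound 0 0 0) as [D [HD BD]].
  destruct (tannery_partial (lpos q b c)
     (fun r => q ^ (r * r) * (b * c) ^ r / (Q * qpoch (b * q) q r * qpoch (c * q) q r))%Cx S C1 (1/2)
     ltac:(lra) HC1 ltac:(lia) B1) as [lp [Lp1 Lp2]].
  { intros r. apply cv_div; [apply cv_const | |].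
    - apply cv_mul; [apply cv_mul|]; try apply cv_const. apply cv_minus_index, HQ.
    - apply Cmul_neq0; [apply Cmul_neq0; [exact NQ|]|]; apply qpoch_neq0; apply one_minus_small_pow_neq0; assumption. }
  destruct (tannery_partial (lneg q b c)
     (fun n => q ^ S n * qpoch (Cx1 / b) q (S n) * qpoch (Cx1 / c) q (S n) / Q)%Cx (fun N => N) C2 x
     Hx HC2 ltac:(lia) B2) as [ln [Ln1 Ln2]].
  { intros n. apply cv_div; [apply cv_const | apply Sh, HQ | exact NQ]. }
  assert (NW : (Q * Q * E1 * ((Cx1 - b * c) * E2))%Cx <> Cx0) by (repeat apply Cmul_neq0; assumption).
  destruct (tannery_partial (rpos q b c)
     (fun r => rpos_limit r / (Q * Q * E1 * ((Cx1 - b * c) * E2)))%Cx S (C3 / D) (1/2)) as [rp [Rp1 Rp2]].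
  { lra. } { apply Rdiv_ge0; lra. } { lia. }
  { intros N r. unfold rpos. fold (rpos_limit r).
    replace (C3 / D * (1 / 2) ^ r) with (C3 * (1 / 2) ^ r / D) by (field; lra).
    apply Cnorm_div_le; [apply B3 | exact HD | apply BD]. }
  { intros r. apply cv_div; [apply cv_const | | exact NW].
    apply cv_mul; [apply cv_mul; [apply cv_mul|]|].
    - apply Sh, HQ. - apply cv_minus_index, HQ. - apply cv_minus_index, HE1.
    - apply (Sh (fun n => qpoch (b * c) q (S n))%Cx), HEa. }
  destruct (tannery_partial (rneg q b c)
     (fun r => rneg_limit r / (Q * Q * E1 * ((Cx1 - b * c) * E2)))%Cx (fun N => N) (C4 / D) (1/2)) as [rn [Rn1 Rn2]].
  { lra. } { apply Rdiv_ge0; lra. } { lia. }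
  { intros N r. unfold rneg. fold (rneg_limit r).
    replace (C4 / D * (1 / 2) ^ r) with (C4 * (1 / 2) ^ r / D) by (field; lra).
    apply Cnorm_div_le; [apply B4 | exact HD | apply BD]. }
  { intros r. apply cv_div; [apply cv_const | | exact NW].
    apply cv_mul; [apply cv_mul; [apply cv_mul|]|].
    - apply Sh, HQ. - apply cv_minus_index, HQ. - apply Sh, HE1.
    - apply (cv_minus_index (fun n => qpoch (b * c) q (S n))%Cx), HEa. }
  assert (Fin : forall N, (Csum (lpos q b c N) (S N) + Csum (lneg q b c N) N)%Cx
     = ((Cx1 - b) * (Cx1 - c) * qpoch (q / b) q N * qpoch (q / c) q N
       * (Csum (rpos q b c N) (S N) + Csum (rneg q b c N) N))%Cx).
  { intros N. apply bilateral_finite; try assumption;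
      try (apply one_minus_pow_neq0; assumption); try (apply one_minus_small_pow_neq0; assumption).
  }
  assert (EQ : (lp + ln)%Cx = ((Cx1 - b) * (Cx1 - c) * Kb * Kc * (rp + rn))%Cx).
  { apply (cv_unique (fun N => (Csum (lpos q b c N) (S N) + Csum (lneg q b c N) N)%Cx)).
    - apply cv_add; assumption.
    - apply (cv_ext _ _ _ (fun N => eq_sym (Fin N))).
      apply cv_mul; [|apply cv_add; assumption].
      apply cv_mul; [|exact HKc]. apply cv_mul; [apply cv_const | exact HKb]. }
  (* The limits of the finite sums carry 1/Q on the left and the inverse of Q Q E1 (1 - b c) E2 on
     the right; these constants are multiplied back in. *)
  exists (Q * lp)%Cx, (Q * ln)%Cx, (Q * Q * E1 * ((Cx1 - b * c) * E2) * rp)%Cx, (Q * Q * E1 * ((Cx1 - b * c) * E2) * rn)%Cx.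
  repeat split.
  - apply (series_ext _ _ _ (series_mul Q _ _ Lp1)). intros r.
    assert (Z1 : qpoch (b * q)%Cx q r <> Cx0) by (apply qpoch_neq0, one_minus_small_pow_neq0; assumption).
    assert (Z2 : qpoch (c * q)%Cx q r <> Cx0) by (apply qpoch_neq0, one_minus_small_pow_neq0; assumption).
    field; nz.
  - apply (series_ext _ _ _ (series_mul Q _ _ Ln1)). intros n. field; nz.
  - apply (series_ext _ _ _ (series_mul (Q * Q * E1 * ((Cx1 - b * c) * E2))%Cx _ _ Rp1)). intros n. field; nz.
  - apply (series_ext _ _ _ (series_mul (Q * Q * E1 * ((Cx1 - b * c) * E2))%Cx _ _ Rn1)). intros n. field; nz.
  - replace (Q * lp + Q * ln)%Cx with (Q * (lp + ln))%Cx by ring. rewrite EQ. field; nz.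
Qed.

End Transform.

(** * The limit [b c -> 1] or [b c -> q] *)

Lemma cv_qpoch (a : nat -> Cx) (a0 q : Cx) (n : nat) :
  Cseq_cv a a0 -> Cseq_cv (fun m => qpoch (a m) q n) (qpoch a0 q n).
Proof.
  intros H. induction n as [|n IH]; [exact (cv_const Cx1)|].
  apply (cv_mul (fun m => qpoch (a m) q n) (fun m => Cx1 - a m * q ^ n)%Cx); [exact IH|].
  apply cv_sub; [apply cv_const|]. apply cv_mul; [exact H | apply cv_const].
Qed.

Section LimitTransform.
Variables (q : Cx) (b c : nat -> Cx) (b0 c0 : Cx) (rho M : R).
Hypothesis hq : Cnorm q < 1.
Hypothesis hq0 : q <> Cx0.
Hypothesis hrho : rho < 1.
Hypothesis hb0 : forall m, b m <> Cx0.
Hypothesis hc0 : forall m, c m <> Cx0.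
Hypothesis hb1 : forall m, b m <> Cx1.
Hypothesis hc1 : forall m, c m <> Cx1.
Hypothesis ha1 : forall m, (b m * c m)%Cx <> Cx1.
Hypothesis hb : forall m, Cnorm (b m * q)%Cx <= rho.
Hypothesis hc : forall m, Cnorm (c m * q)%Cx <= rho.
Hypothesis hbM : forall m, Cnorm (Cx1 / b m)%Cx <= M.
Hypothesis hcM : forall m, Cnorm (Cx1 / c m)%Cx <= M.
Hypothesis hb' : forall m, Cnorm (q / b m)%Cx <= rho.
Hypothesis hc' : forall m, Cnorm (q / c m)%Cx <= rho.
Hypothesis ha : forall m, Cnorm (b m * c m * q)%Cx < 1.
Hypothesis ha' : forall m, Cnorm (q / (b m * c m))%Cx < 1.
Hypothesis cvb : Cseq_cv b b0.
Hypothesis cvc : Cseq_cv c c0.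
Hypothesis lb0 : b0 <> Cx0.
Hypothesis lc0 : c0 <> Cx0.
Let x := Cnorm q.
Let Hx : 0 <= x < 1. Proof. split; [apply Cnorm_ge0 | exact hq]. Qed.
Let Hx0 : 0 < x. Proof. apply Cnorm_pos, hq0. Qed.

Definition lpos_limit (b c : Cx) (r : nat) : Cx :=
  (q ^ (r * r) * (b * c) ^ r / (qpoch (b * q) q r * qpoch (c * q) q r))%Cx.
Definition lneg_limit (b c : Cx) (n : nat) : Cx :=
  (q ^ S n * qpoch (Cx1 / b) q (S n) * qpoch (Cx1 / c) q (S n))%Cx.

Let limb : Cnorm (b0 * q)%Cx <= rho.
Proof. apply (cv_norm_le (fun m => (b m * q)%Cx)); [apply cv_mul; [exact cvb | apply cv_const] | exact hb]. Qed.
Let limc : Cnorm (c0 * q)%Cx <= rho.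
Proof. apply (cv_norm_le (fun m => (c m * q)%Cx)); [apply cv_mul; [exact cvc | apply cv_const] | exact hc]. Qed.

Lemma lpos_tannery : exists l, Cseries_cv (lpos_limit b0 c0) l /\
  forall L, (forall m, Cseries_cv (lpos_limit (b m) (c m)) (L m)) -> Cseq_cv L l.
Proof.
  assert (Hrho : 0 <= rho) by (pose proof (Cnorm_ge0 (b0 * q)%Cx); lra).
  (* |b_m q| <= rho gives |b_m| <= rho / |q|, likewise for c_m; so |b_m c_m| is bounded uniformly in
     m. *)
  destruct (gauss_bound (rho / x * (rho / x)) x) as [C [HC HB]]; [|exact Hx|].
  { nra. }
  pose proof (lbound_pos q rho) as L.
  apply (tannery (fun m => lpos_limit (b m) (c m)) _ (C / (lbound q rho * lbound q rho)) (1/2)); [lra | | |].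
  - apply Rdiv_ge0; nra.
  - intros m r. unfold lpos_limit.
    replace (C / (lbound q rho * lbound q rho) * (1 / 2) ^ r) with (C * (1 / 2) ^ r / (lbound q rho * lbound q rho)) by (field; lra).
    apply Cnorm_div_le; [| nra |].
    + rewrite Cnorm_mul, !Cnorm_pow, Rmult_comm. eapply Rle_trans; [|apply HB].
      apply Rmult_le_compat_r; [apply pow_le; lra|]. apply pow_incr. split; [apply Cnorm_ge0|].
      assert (G : forall t, Cnorm (t * q)%Cx <= rho -> Cnorm t <= rho / x).
      { intros t Ht. rewrite Cnorm_mul in Ht. fold x in Ht.
        apply Rmult_le_reg_r with x; [exact Hx0|]. replace (rho / x * x) with rho by (field; lra). exact Ht. }
      apply Cnorm_mul_le; apply G; auto.
    + apply Cnorm_mul_ge; try exact L; apply (qpoch_ge q hq); auto.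
  - intros r. apply cv_div.
    + apply cv_mul; [apply cv_const | apply cv_pow, cv_mul; assumption].
    + apply cv_mul; [apply (cv_qpoch (fun m => b m * q)%Cx) | apply (cv_qpoch (fun m => c m * q)%Cx)]; apply cv_mul; try assumption; apply cv_const.
    + apply Cmul_neq0; apply qpoch_neq0, one_minus_small_pow_neq0; lra.
Qed.

Lemma lneg_tannery : exists l, Cseries_cv (lneg_limit b0 c0) l /\
  forall L, (forall m, Cseries_cv (lneg_limit (b m) (c m)) (L m)) -> Cseq_cv L l.
Proof.
  apply (tannery (fun m => lneg_limit (b m) (c m)) _ (ubound q M * ubound q M) x Hx); [nra | |].
  - intros m n. unfold lneg_limit.
    replace (ubound q M * ubound q M * x ^ n) with (x ^ n * ubound q M * ubound q M) by ring.
    apply Cnorm_mul_le; [apply Cnorm_mul_le|]; try (apply (qpoch_le q hq); auto).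
    rewrite Cnorm_pow. fold x. simpl. pose proof (pow_le x n ltac:(lra)). nra.
  - intros n. apply cv_mul; [apply cv_mul; [apply cv_const|]|];
        [apply (cv_qpoch (fun m => Cx1 / b m)%Cx) | apply (cv_qpoch (fun m => Cx1 / c m)%Cx)]; apply cv_div; try assumption; apply cv_const.
Qed.

(** [sigma] tracks the variable whose value 1 is critical. The prefactor has the denominator (1 -
    sigma_m) W_m, the bilateral sum divided by 1 - sigma_m tends to X, and so 1 - sigma_m cancels
    before the limit is taken. *)
Theorem limit_transform (sigma W : nat -> Cx) (W0 X Q Kb Kc : Cx) :
  (forall m, sigma m <> Cx1) ->
  (forall m E1 E2, qpoch_inf_cv (q / (b m * c m))%Cx q E1 -> qpoch_inf_cv (b m * c m * q)%Cx q E2 ->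
     E1 * (Cx1 - b m * c m) * E2 = (Cx1 - sigma m) * W m)%Cx ->
  (Cseq_cv W W0) -> W0 <> Cx0 ->
  (forall R1 R2, (forall m, Cseries_cv (rpos_limit q (b m) (c m)) (R1 m)) ->
     (forall m, Cseries_cv (rneg_limit q (b m) (c m)) (R2 m)) ->
     Cseq_cv (fun m => (R1 m + R2 m) / (Cx1 - sigma m))%Cx X) ->
  qpoch_inf_cv q q Q -> qpoch_inf_cv (q / b0)%Cx q Kb -> qpoch_inf_cv (q / c0)%Cx q Kc ->
  exists Lp Ln, Cseries_cv (lpos_limit b0 c0) Lp /\ Cseries_cv (lneg_limit b0 c0) Ln /\
    (Lp + Ln = (Cx1 - b0) * (Cx1 - c0) * Kb * Kc / (Q * W0) * X)%Cx.
Proof.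
  intros Hs HW cvW HW0 HX HQ HKb HKc.
  (* The infinite products change with m, so choice makes them values of a function [P] of the
     argument. *)
  destruct (functional_choice (fun a P => qpoch_inf_cv a q P) (qpoch_cv q hq)) as [P HP].
  (* The four sums belonging to one m are packed into pairs, so that a single further choice yields
     four sequences. *)
  assert (T : forall m, exists t : (Cx * Cx) * (Cx * Cx),
     Cseries_cv (lpos_limit (b m) (c m)) (fst (fst t)) /\ Cseries_cv (lneg_limit (b m) (c m)) (snd (fst t)) /\
     Cseries_cv (rpos_limit q (b m) (c m)) (fst (snd t)) /\ Cseries_cv (rneg_limit q (b m) (c m)) (snd (snd t)) /\
     (fst (fst t) + snd (fst t) = (Cx1 - b m) * (Cx1 - c m) * P (q / b m) * P (q / c m)
        / (Q * P (q / (b m * c m)) * (Cx1 - b m * c m) * P (b m * c m * q)) * (fst (snd t) + snd (snd t)))%Cx).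
  { intros m.
    destruct (bilateral_transform q (b m) (c m) hq hq0 (hb0 m) (hc0 m) (hb1 m) (hc1 m) (ha1 m)
      (Rle_lt_trans _ _ _ (hb m) hrho) (Rle_lt_trans _ _ _ (hc m) hrho) (ha m)
      (Rle_lt_trans _ _ _ (hb' m) hrho) (Rle_lt_trans _ _ _ (hc' m) hrho) (ha' m) _ _ _ _ _ HQ
      (HP _) (HP _) (HP _) (HP _)) as (l1 & l2 & r1 & r2 & H1 & H2 & H3 & H4 & H5).
    exists ((l1, l2), (r1, r2)). simpl. auto. }
  destruct (functional_choice _ T) as [t Ht]. clear T.
  destruct lpos_tannery as [Lp [HLp HLp']]. destruct lneg_tannery as [Ln [HLn HLn']].
  exists Lp, Ln. split; [exact HLp|]. split; [exact HLn|].
  assert (C1 : Cseq_cv (fun m => fst (fst (t m))) Lp) by (apply HLp'; intros m; apply (Ht m)).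
  assert (C2 : Cseq_cv (fun m => snd (fst (t m))) Ln) by (apply HLn'; intros m; apply (Ht m)).
  assert (C3 := HX (fun m => fst (snd (t m))) (fun m => snd (snd (t m)))
     ltac:(intros m; apply (Ht m)) ltac:(intros m; apply (Ht m))).
  assert (NQ := qpoch_inf_neq0 q hq q Q hq HQ).
  assert (CK : forall u u0, (forall m, u m <> Cx0) -> u0 <> Cx0 -> Cseq_cv u u0 ->
     (forall m, Cnorm (q / u m)%Cx <= rho) -> forall K, qpoch_inf_cv (q / u0)%Cx q K ->
     Cseq_cv (fun m => P (q / u m)%Cx) K).
  { intros u u0 Hu Hu0 cvu Hr K HK.
    apply (qpoch_inf_continuous q hq (fun m => (q / u m)%Cx) _ (q / u0)%Cx K rho Hr); [|intros; apply HP|exact HK].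
    apply cv_div; [apply cv_const | exact cvu | exact Hu0]. }
  apply (cv_unique (fun m => fst (fst (t m)) + snd (fst (t m)))%Cx); [apply cv_add; assumption|].
  apply (cv_ext (fun m => (Cx1 - b m) * (Cx1 - c m) * P (q / b m) * P (q / c m) / (Q * W m)
       * ((fst (snd (t m)) + snd (snd (t m))) / (Cx1 - sigma m)))%Cx).
  - intros m. destruct (Ht m) as (_ & _ & _ & _ & E). rewrite E.
    pose proof (HW m _ _ (HP _) (HP _)) as EW.
    assert (N1 := qpoch_inf_neq0 q hq _ _ (ha' m) (HP _)). assert (N2 := qpoch_inf_neq0 q hq _ _ (ha m) (HP _)).
    assert (N3 : (Cx1 - b m * c m)%Cx <> Cx0) by (apply Csub_neq0, not_eq_sym, ha1).
    assert (N4 : (Cx1 - sigma m)%Cx <> Cx0) by (apply Csub_neq0, not_eq_sym, Hs).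
    replace (Q * P (q / (b m * c m)) * (Cx1 - b m * c m) * P (b m * c m * q))%Cx
      with (Q * ((Cx1 - sigma m) * W m))%Cx by (rewrite <- EW; ring).
    assert (N5 : W m <> Cx0).
    { intros Z. rewrite Z in EW. assert (Z' : (P (q / (b m * c m)) * (Cx1 - b m * c m) * P (b m * c m * q))%Cx <> Cx0)
        by (repeat apply Cmul_neq0; assumption).
      apply Z'. rewrite EW. ring. }
    field; nz.
  - apply cv_mul; [|exact C3]. apply cv_div; [| |apply Cmul_neq0; assumption].
    + apply cv_mul; [apply cv_mul; [apply cv_mul|]|].
      * apply cv_sub; [apply cv_const | exact cvb].
      * apply cv_sub; [apply cv_const | exact cvc].
      * apply (CK b b0); assumption.
      * apply (CK c c0); assumption.
    + apply cv_mul; [apply cv_const | exact cvW].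
Qed.

End LimitTransform.

(** * The divided difference of [(1 - s w) / (1 + s w) * s ^ N] under [s -> 1/s] *)

(** Written with the geometric sum of the s^j instead of a division by 1 - s, so that it makes sense
    and is continuous at s = 1. *)
Definition diffquot (s w : Cx) (N : nat) : Cx :=
  (Cx0 - (Cx1 - s * w) / (Cx1 + s * w) * Csum (fun j => s ^ j) (2 * N) / s ^ N
   + (Cx1 + Cx1) * w * (Cx1 + s) / ((Cx1 + s * w) * (s + w)) / s ^ N)%Cx.

Lemma geometric_Csum (s : Cx) (n : nat) : ((Cx1 - s) * Csum (fun j => s ^ j) n = Cx1 - s ^ n)%Cx.
Proof.
  induction n as [|n IH]; simpl; [ring|].
  transitivity ((Cx1 - s) * Csum (fun j => s ^ j) n + (Cx1 - s) * s ^ n)%Cx; [ring|]. rewrite IH. ring.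
Qed.

(** s^N - s^(-N) = -(1 - s^(2N)) / s^N gives the geometric sum, and the two fractions on the right
    differ by 2 w (1 - s)(1 + s) / ((1 + s w)(s + w)). *)
Lemma diffquot_spec (s w : Cx) (N : nat) : s <> Cx0 ->
  (Cx1 + s * w)%Cx <> Cx0 -> (s + w)%Cx <> Cx0 ->
  ((Cx1 - s) * diffquot s w N
   = (Cx1 - s * w) / (Cx1 + s * w) * s ^ N - (s - w) / (s + w) / s ^ N)%Cx.
Proof.
  intros Hs H1 H2. unfold diffquot.
  pose proof (geometric_Csum s (2 * N)) as G. replace (2 * N)%nat with (N + N)%nat in * by lia.
  rewrite Cpow_add in G. pose proof (Cpow_neq0 s N Hs) as HN.
  generalize dependent (Csum (fun j => s ^ j)%Cx (N + N)). generalize dependent (s ^ N)%Cx.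
  intros y Hy z G.
  transitivity (Cx0 - (Cx1 - s * w) / (Cx1 + s * w) * ((Cx1 - s) * z) / y
    + (Cx1 - s) * ((Cx1 + Cx1) * w * (Cx1 + s) / ((Cx1 + s * w) * (s + w)) / y))%Cx; [field; nz|].
  rewrite G. field; nz.
Qed.

Definition CINR (n : nat) : Cx := RtoC (INR n).

Definition diffquot1 (w : Cx) (N : nat) : Cx :=
  (Cx0 - (Cx1 - w) / (Cx1 + w) * CINR (2 * N)
   + (Cx1 + Cx1) * w * (Cx1 + Cx1) / ((Cx1 + w) * (Cx1 + w)))%Cx.

Lemma CINR_S (n : nat) : CINR (S n) = (CINR n + Cx1)%Cx.
Proof. unfold CINR. rewrite S_INR. apply Cx_eq; simpl; ring. Qed.

Lemma Csum_ones (n : nat) : Csum (fun j => (Cx1 ^ j)%Cx) n = CINR n.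
Proof.
  induction n as [|n IH]; [reflexivity|]. rewrite CINR_S. simpl. rewrite IH, Cpow_1_l. reflexivity.
Qed.

Lemma Csum_norm_le (f : nat -> Cx) (B : R) (n : nat) :
  (forall k, (k < n)%nat -> Cnorm (f k) <= B) -> Cnorm (Csum f n) <= INR n * B.
Proof.
  induction n as [|n IH]; intros H.
  - simpl. rewrite Cnorm_0. lra.
  - rewrite S_INR. simpl. eapply Rle_trans; [apply Cnorm_triang|].
    specialize (IH ltac:(intros; apply H; lia)). specialize (H n ltac:(lia)). lra.
Qed.

Lemma INR_le_pow2 (n : nat) : INR n <= 2 ^ n.
Proof. induction n as [|n IH]; [simpl; lra|]. rewrite S_INR. simpl. pose proof (pow_R1_Rle 2 n ltac:(lra)). lra. Qed.

(** [diffquot] grows at most like a power with exponent N, which is linear in n, and the factor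
    x^(n^2) beats it. The bound 4n + 4 admits the exponents 4(n+1), 2(n+1) and 2n + 1 that occur. *)
Lemma diffquot_tannery (sigma w g : nat -> Cx) (N : nat -> nat) (x s0 : R) :
  0 <= x < 1 -> s0 * x < 1 -> (forall m, 1 <= Cnorm (sigma m) <= s0) -> Cseq_cv sigma Cx1 ->
  (forall n, Cnorm (w n) <= x) -> (forall n, (N n <= 4 * n + 4)%nat) ->
  (forall n, Cnorm (g n) <= x ^ (n * n)) ->
  exists l, Cseries_cv (fun n => g n * diffquot1 (w n) (N n))%Cx l /\
  forall L, (forall m, Cseries_cv (fun n => g n * diffquot (sigma m) (w n) (N n))%Cx (L m)) -> Cseq_cv L l.
Proof.
  intros Hx Hs0x Hsig cvs Hw HN Hg.
  assert (Hs0 : 1 <= s0) by (specialize (Hsig O); lra).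
  set (d := 1 - s0 * x). assert (Hd : 0 < d) by (unfold d; lra).
  set (e := 1 - x). assert (He : 0 < e) by (unfold e; lra).
  set (C0 := 2 / d + 2 * (1 + s0) / (d * e)).
  assert (P1 : 0 <= 2 / d) by (apply Rdiv_ge0; lra).
  assert (P2 : 0 <= 2 * (1 + s0) / (d * e)).
  { apply Rdiv_ge0; nra. }
  assert (HC0 : 0 <= C0) by (unfold C0; lra).
  (* The geometric sum has 2N <= 2^(2N) terms of modulus at most s0^(2N), hence the base (2
     s0)^2. *)
  set (S2 := (2 * s0) * (2 * s0)). assert (HS2 : 1 <= S2) by (unfold S2; nra).
  assert (B : forall m n, Cnorm (diffquot (sigma m) (w n) (N n)) <= C0 * S2 ^ (N n)).
  { intros m n. unfold diffquot. set (s := sigma m). set (v := w n). set (K := N n).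
    assert (Hs : 1 <= Cnorm s <= s0) by apply Hsig. assert (Hv : Cnorm v <= x) by apply Hw.
    assert (Hsv : Cnorm (s * v)%Cx <= s0 * x) by (apply Cnorm_mul_le; lra).
    assert (D1 : d <= Cnorm (Cx1 + s * v)%Cx).
    { replace (Cx1 + s * v)%Cx with (Cx1 - - (s * v))%Cx by ring.
      pose proof (one_minus_ge (- (s * v))%Cx) as O. rewrite Cnorm_opp in O. unfold d. lra. }
    assert (D2 : e <= Cnorm (s + v)%Cx).
    { replace (s + v)%Cx with (s - - v)%Cx by ring. pose proof (Cnorm_sub_ge s (- v)%Cx) as O.
      rewrite Cnorm_opp in O. unfold e. lra. }
    assert (D3 : 1 <= Cnorm (s ^ K)%Cx) by (rewrite Cnorm_pow; apply pow_R1_Rle; lra).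
    assert (D4 : Cnorm (Csum (fun j => s ^ j)%Cx (2 * K)) <= S2 ^ K).
    { eapply Rle_trans; [apply (Csum_norm_le _ (s0 ^ (2 * K)))|].
      - intros k Hk. rewrite Cnorm_pow. apply Rle_trans with (s0 ^ k); [apply pow_incr; lra|].
        apply Rle_pow; [lra | lia].
      - apply Rle_trans with (2 ^ (2 * K) * s0 ^ (2 * K)).
        + apply Rmult_le_compat_r; [apply pow_le; lra | apply INR_le_pow2].
        + right. unfold S2. rewrite <- Rpow_mult_distr, pow_mult. f_equal. simpl. ring. }
    assert (D5 : 1 <= S2 ^ K) by (apply pow_R1_Rle; exact HS2).
    eapply Rle_trans; [apply Cnorm_triang|]. unfold C0. rewrite Rmult_plus_distr_r. apply Rplus_le_compat.
    - replace (Cx0 - (Cx1 - s * v) / (Cx1 + s * v) * Csum (fun j => s ^ j) (2 * K) / s ^ K)%Cx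
        with (- ((Cx1 - s * v) / (Cx1 + s * v) * Csum (fun j => s ^ j) (2 * K) / s ^ K))%Cx by (unfold Cdiv; ring).
      rewrite Cnorm_opp. replace (2 / d * S2 ^ K) with (2 / d * S2 ^ K / 1) by (field; lra).
      apply Cnorm_div_le; [|lra|exact D3]. apply Cnorm_mul_le; [|exact D4].
      apply Cnorm_div_le; [|exact Hd|exact D1]. eapply Rle_trans; [apply one_minus_le|]. lra.
    - apply Rle_trans with (2 * (1 + s0) / (d * e) / 1).
      + apply Cnorm_div_le; [|lra|exact D3]. apply Cnorm_div_le; [|nra|apply Cnorm_mul_ge; assumption].
        apply Cnorm_mul_le.
        * replace 2 with (2 * 1) by ring. apply Cnorm_mul_le; [|lra].
          eapply Rle_trans; [apply Cnorm_triang|]. rewrite Cnorm_1. lra.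
        * eapply Rle_trans; [apply Cnorm_triang|]. rewrite Cnorm_1. lra.
      + replace (2 * (1 + s0) / (d * e) / 1) with (2 * (1 + s0) / (d * e) * 1) by (field; lra).
        apply Rmult_le_compat_l; assumption. }
  destruct (gauss_bound (S2 ^ 4) x) as [C [HC HB]]; [apply pow_le; lra | exact Hx |].
  apply (tannery (fun m n => g n * diffquot (sigma m) (w n) (N n))%Cx _ (C0 * S2 ^ 4 * C) (1/2)); [lra | | |].
  - apply Rmult_le_pos; [apply Rmult_le_pos; [exact HC0 | apply pow_le; lra] | exact HC].
  - intros m n. apply Rle_trans with (x ^ (n * n) * (C0 * S2 ^ (4 * n + 4))).
    + apply Cnorm_mul_le; [apply Hg|]. eapply Rle_trans; [apply B|].
      apply Rmult_le_compat_l; [exact HC0|]. apply Rle_pow; [exact HS2 | apply HN].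
    + rewrite pow_add, (pow_mult S2 4 n).
      replace (x ^ (n * n) * (C0 * ((S2 ^ 4) ^ n * S2 ^ 4))) with (C0 * S2 ^ 4 * ((S2 ^ 4) ^ n * x ^ (n * n))) by ring.
      rewrite (Rmult_assoc (C0 * S2 ^ 4)). apply Rmult_le_compat_l; [|apply HB].
      apply Rmult_le_pos; [exact HC0 | apply pow_le; lra].
  - intros n. apply cv_mul; [apply cv_const|]. unfold diffquot, diffquot1.
    assert (N1 : (Cx1 + w n)%Cx <> Cx0).
    { replace (Cx1 + w n)%Cx with (Cx1 - - w n)%Cx by ring. apply one_minus_neq0. rewrite Cnorm_opp.
      specialize (Hw n). lra. }
    assert (N2 : (Cx1 ^ N n)%Cx <> Cx0) by (apply Cpow_neq0, Cx1_neq0).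
    assert (CS : Cseq_cv (fun m => Csum (fun j => sigma m ^ j)%Cx (2 * N n)) (CINR (2 * N n))).
    { rewrite <- Csum_ones. apply cv_Csum. intros j. apply cv_pow, cvs. }
    assert (CW : Cseq_cv (fun m => Cx1 + sigma m * w n)%Cx (Cx1 + Cx1 * w n)%Cx).
    { apply cv_add; [apply cv_const | apply cv_mul; [exact cvs | apply cv_const]]. }
    (* The limit is rewritten with a 1 wherever [diffquot] has s, so that the limit rules apply
       factor by factor. *)
    replace (Cx0 - (Cx1 - w n) / (Cx1 + w n) * CINR (2 * N n)
       + (Cx1 + Cx1) * w n * (Cx1 + Cx1) / ((Cx1 + w n) * (Cx1 + w n)))%Cx
      with (Cx0 - (Cx1 - Cx1 * w n) / (Cx1 + Cx1 * w n) * CINR (2 * N n) / Cx1 ^ N n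
       + (Cx1 + Cx1) * w n * (Cx1 + Cx1) / ((Cx1 + Cx1 * w n) * (Cx1 + w n)) / Cx1 ^ N n)%Cx.
    2:{ rewrite Cpow_1_l. field; nz. }
    assert (N3 : (Cx1 + Cx1 * w n)%Cx <> Cx0) by (replace (Cx1 * w n)%Cx with (w n) by ring; exact N1).
    apply cv_add.
    + apply cv_sub; [apply cv_const|]. apply cv_div; [|apply cv_pow, cvs|exact N2].
      apply cv_mul; [|exact CS]. apply cv_div; [|exact CW|exact N3].
      apply cv_sub; [apply cv_const|]. apply cv_mul; [exact cvs | apply cv_const].
    + apply cv_div; [|apply cv_pow, cvs|exact N2]. apply cv_div; [| |apply Cmul_neq0; assumption].
      * apply cv_mul; [apply cv_const|]. apply cv_add; [apply cv_const | exact cvs].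
      * apply cv_mul; [exact CW|]. apply cv_add; [exact cvs | apply cv_const].
Qed.

(** * The identities for f, phi and nu *)

Lemma RtoC_mul (x y : R) : RtoC (x * y) = (RtoC x * RtoC y)%Cx.
Proof. apply Cx_eq; simpl; ring. Qed.

(** The choice eta = (1 - x)/4 keeps (1 + eta)^2 x below 1, so that q s^2 stays in the unit disc.
    Modulus above 1 keeps s and s^2 different from 1. *)
Lemma approach_1 (x : R) : 0 <= x < 1 ->
  exists (s0 : R) (s : nat -> Cx), 1 <= s0 /\ s0 * s0 * x < 1 /\
    (forall m, 1 < Cnorm (s m) <= s0) /\ Cseq_cv s Cx1.
Proof.
  intros Hx. set (eta := (1 - x) / 4). assert (Heta : 0 < eta) by (unfold eta; lra).
  exists (1 + eta), (fun m => RtoC (1 + eta * / (INR m + 1))).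
  assert (P : forall m, 0 < / (INR m + 1) <= 1).
  { intros m. pose proof (pos_INR m). split; [apply Rinv_0_lt_compat; lra|].
    rewrite <- Rinv_1. apply Rinv_le_contravar; lra. }
  split; [lra|]. split; [unfold eta; nra|]. split.
  - intros m. specialize (P m). rewrite Cnorm_RtoC, Rabs_pos_eq by nra. split; nra.
  - apply (cv_squeeze _ _ (fun m => eta * / (INR m + 1))).
    + intros m. specialize (P m).
      replace (RtoC (1 + eta * / (INR m + 1)) - Cx1)%Cx with (RtoC (eta * / (INR m + 1))) by (apply Cx_eq; simpl; ring).
      rewrite Cnorm_RtoC, Rabs_pos_eq by nra. lra.
    + intros e He. destruct (archimed_cor1 (e / eta)) as [N [HN HN']]; [apply Rdiv_lt_0_compat; lra|].
      exists N. intros n Hn. specialize (P n). unfold Rdist. rewrite Rminus_0_r, Rabs_pos_eq by nra.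
      assert (/ (INR n + 1) < e / eta).
      { eapply Rlt_trans; [|exact HN]. apply Rinv_lt_contravar.
        - apply Rmult_lt_0_compat; [apply lt_0_INR; lia | pose proof (pos_INR n); lra].
        - pose proof (le_INR N n ltac:(lia)). lra. }
      replace e with (eta * (e / eta)) by (field; lra). apply Rmult_lt_compat_l; lra.
Qed.

Lemma Cpowz_nat (q : Cx) (n : nat) : (q ^^ Z.of_nat n)%Cx = (q ^ n)%Cx.
Proof.
  destruct n as [|n]; [reflexivity|]. simpl Z.of_nat. unfold Cpowz.
  rewrite SuccNat2Pos.id_succ. reflexivity.
Qed.

Lemma Cpowz_neg (q : Cx) (n : nat) : (q ^^ (- Z.of_nat (S n)))%Cx = Cinv (q ^ S n)%Cx.
Proof. simpl Z.of_nat. simpl Z.opp. unfold Cpowz. rewrite SuccNat2Pos.id_succ. reflexivity. Qed.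

Lemma ZtoC_nat (n : nat) : ZtoC (Z.of_nat n) = CINR n.
Proof. unfold ZtoC, CINR. rewrite INR_IZR_INZ. reflexivity. Qed.

Lemma ZtoC_neg (n : nat) : ZtoC (- Z.of_nat n) = (- CINR n)%Cx.
Proof.
  unfold ZtoC, CINR. rewrite INR_IZR_INZ, opp_IZR. apply Cx_eq; simpl; ring.
Qed.

Lemma ZtoC_2 : ZtoC 2 = (Cx1 + Cx1)%Cx.
Proof. apply Cx_eq; simpl; ring. Qed.

Lemma ZtoC_4 : ZtoC 4 = ((Cx1 + Cx1) * (Cx1 + Cx1))%Cx.
Proof. apply Cx_eq; simpl; ring. Qed.

Lemma CINR_add (m n : nat) : CINR (m + n) = (CINR m + CINR n)%Cx.
Proof. unfold CINR. rewrite plus_INR. apply Cx_eq; simpl; ring. Qed.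

Lemma CINR_mul (m n : nat) : CINR (m * n) = (CINR m * CINR n)%Cx.
Proof. unfold CINR. rewrite mult_INR. apply RtoC_mul. Qed.

Lemma CINR_2 : CINR 2 = (Cx1 + Cx1)%Cx.
Proof. apply Cx_eq; simpl; ring. Qed.

Lemma CINR_4 : CINR 4 = ((Cx1 + Cx1) * (Cx1 + Cx1))%Cx.
Proof. apply Cx_eq; simpl; ring. Qed.

Lemma Cnorm_CINR (n : nat) : Cnorm (CINR n) = INR n.
Proof. unfold CINR. rewrite Cnorm_RtoC. apply Rabs_pos_eq, pos_INR. Qed.

Lemma two_neq0 : (Cx1 + Cx1)%Cx <> Cx0.
Proof. intros E. apply (f_equal Re) in E. simpl in E. lra. Qed.

(** For the series of the theorem: a quadratic power of q, a coefficient linear in n, a denominator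
    bounded below. The majorant 9 * 2^n is the one of [Cnorm_linear]. *)
Lemma gauss_series_cv (u v y : nat -> Cx) (x d : R) : 0 <= x < 1 -> 0 < d ->
  (forall n, Cnorm (u n) <= x ^ (n * n)) -> (forall n, Cnorm (v n) <= 9 * 2 ^ n) ->
  (forall n, d <= Cnorm (y n)) ->
  exists l, Cseries_cv (fun n => u n * v n / y n)%Cx l.
Proof.
  intros Hx Hd Hu Hv Hy.
  destruct (gauss_bound 2 x) as [C [HC HB]]; [lra | exact Hx |].
  destruct (series_geo_cv (fun n => u n * v n / y n)%Cx (9 * C / d) (1/2)) as [l [Hl _]].
  - lra.
  - apply Rdiv_ge0; lra.
  - intros n. replace (9 * C / d * (1 / 2) ^ n) with (9 * (C * (1 / 2) ^ n) / d) by (field; lra).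
    apply Cnorm_div_le; [|exact Hd|apply Hy].
    eapply Rle_trans; [apply Cnorm_mul_le; [apply Hu | apply Hv]|].
    specialize (HB n). lra.
  - exists l. exact Hl.
Qed.

Lemma Cnorm_pow_le (q : Cx) (e n : nat) : Cnorm q < 1 -> (n * n <= e)%nat ->
  Cnorm (q ^ e)%Cx <= Cnorm q ^ (n * n).
Proof.
  intros hq H. rewrite Cnorm_pow. replace e with (n * n + (e - n * n))%nat by lia.
  rewrite pow_add. pose proof (Cnorm_ge0 q).
  pose proof (pow_le_1 (Cnorm q) (e - n * n) ltac:(lra)). pose proof (pow_le (Cnorm q) (n * n) ltac:(lra)). nra.
Qed.

Lemma Cnorm_pow_le1 (q : Cx) (e : nat) : Cnorm q < 1 -> Cnorm (q ^ e)%Cx <= 1.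
Proof. intros hq. rewrite Cnorm_pow. apply pow_le_1. pose proof (Cnorm_ge0 q). lra. Qed.

Lemma Cnorm_pow_S_le (q : Cx) (e : nat) : Cnorm q < 1 -> Cnorm (q ^ S e)%Cx <= Cnorm q.
Proof.
  intros hq. cbn [Cpow]. rewrite Cnorm_mul. pose proof (Cnorm_pow_le1 q e hq). pose proof (Cnorm_ge0 q). nra.
Qed.

(** Opposite parameters merge into base q^2; this is how i and q^(1/2) disappear from the results
    for phi and nu. *)
Lemma qpoch_pm (t q : Cx) (n : nat) :
  (qpoch t q n * qpoch (- t) q n)%Cx = qpoch (t * t)%Cx (q ^ 2)%Cx n.
Proof.
  induction n as [|n IH]; [unfold qpoch; simpl; ring|].
  rewrite !qpoch_S, <- IH. replace ((q ^ 2) ^ n)%Cx with (q ^ n * q ^ n)%Cx; [ring|].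
  rewrite <- Cpow_mul_l. f_equal. simpl. ring.
Qed.

Lemma qpoch_inf_pm (t q P1 P2 P : Cx) : qpoch_inf_cv t q P1 -> qpoch_inf_cv (- t)%Cx q P2 ->
  qpoch_inf_cv (t * t)%Cx (q ^ 2)%Cx P -> (P1 * P2 = P)%Cx.
Proof.
  intros H1 H2 H. apply (cv_unique (fun n => qpoch t q n * qpoch (- t) q n)%Cx).
  - apply cv_mul; assumption.
  - apply (cv_ext _ _ _ (fun n => eq_sym (qpoch_pm t q n))). exact H.
Qed.

Lemma qpoch_inf_S (a q P : Cx) : qpoch_inf_cv (a * q)%Cx q P -> qpoch_inf_cv a q ((Cx1 - a) * P)%Cx.
Proof.
  intros H. apply cv_unshift. apply (cv_ext (fun n => ((Cx1 - a) * qpoch (a * q) q n)%Cx)).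
  - intros; symmetry; apply qpoch_S_l.
  - apply cv_mul; [apply cv_const | exact H].
Qed.

Lemma one_plus_pow_ge (q : Cx) : Cnorm q < 1 ->
  exists d, 0 < d /\ forall k, d <= Cnorm (Cx1 + q ^ k)%Cx.
Proof.
  intros hq. destruct (one_minus_pow_ge q (- Cx1)%Cx hq) as [d [Hd H]].
  - intros E. apply (f_equal Re) in E. simpl in E. lra.
  - replace (- Cx1 * q)%Cx with (- q)%Cx by ring. rewrite Cnorm_opp. exact hq.
  - exists d. split; [exact Hd|]. intros k.
    replace (Cx1 + q ^ k)%Cx with (Cx1 - - Cx1 * q ^ k)%Cx by ring. apply H.
Qed.

Lemma one_plus_pow_neq0 (q : Cx) : Cnorm q < 1 -> forall k, (Cx1 + q ^ k)%Cx <> Cx0.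
Proof.
  intros hq k. destruct (one_plus_pow_ge q hq) as [d [Hd H]]. apply Cnorm_neq0. specialize (H k). lra.
Qed.

(* case [b c -> 1]: the terms r and -r are paired, the term r = 0 contributes 1/2 *)
Lemma paired_limit (q : Cx) (b c sigma : nat -> Cx) (g w : nat -> Cx) (N : nat -> nat) (l : Cx) :
  (forall m, sigma m <> Cx1) -> (forall m, (Cx1 + sigma m)%Cx <> Cx0) -> Cseq_cv sigma Cx1 ->
  (forall m, rpos_limit q (b m) (c m) 0 = (Cx1 - sigma m) / (Cx1 + sigma m))%Cx ->
  (forall m n, rpos_limit q (b m) (c m) (S n) + rneg_limit q (b m) (c m) n
     = (Cx1 - sigma m) * (g n * diffquot (sigma m) (w n) (N n)))%Cx ->
  (forall L, (forall m, Cseries_cv (fun n => g n * diffquot (sigma m) (w n) (N n))%Cx (L m)) -> Cseq_cv L l) ->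
  forall R1 R2, (forall m, Cseries_cv (rpos_limit q (b m) (c m)) (R1 m)) ->
     (forall m, Cseries_cv (rneg_limit q (b m) (c m)) (R2 m)) ->
     Cseq_cv (fun m => (R1 m + R2 m) / (Cx1 - sigma m))%Cx (Cx1 / (Cx1 + Cx1) + l)%Cx.
Proof.
  intros Hs Hs' cvs H0 Hp HL R1 R2 H1 H2.
  assert (N4 : forall m, (Cx1 - sigma m)%Cx <> Cx0).
  { intros m. apply Csub_neq0, not_eq_sym, Hs. }
  apply (cv_ext (fun m => Cx1 / (Cx1 + sigma m)
     + Cinv (Cx1 - sigma m) * (R1 m - rpos_limit q (b m) (c m) 0 + R2 m))%Cx).
  - intros m. rewrite H0. specialize (N4 m). specialize (Hs' m). field; nz.
  - apply cv_add.
    + apply cv_div; [apply cv_const | apply cv_add; [apply cv_const | exact cvs] | exact two_neq0].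
    + apply HL. intros m. specialize (N4 m).
      apply (series_ext _ _ _ (series_mul (Cinv (Cx1 - sigma m)%Cx) _ _
         (series_add _ _ _ _ (series_unS _ _ (H1 m)) (H2 m)))).
      intros n. rewrite Hp. field; nz.
Qed.

Lemma two_e_mul (z : Cx) (n : nat) : (z ^ (2 * n) = z ^ n * z ^ n)%Cx.
Proof. replace (2 * n)%nat with (n + n)%nat by lia. apply Cpow_add. Qed.

(** * Uniform bounds for the scaled parameters *)

Section Scaling.
Variables (q : Cx) (s0 : R) (s : nat -> Cx).
Hypothesis hq : Cnorm q < 1.
Hypothesis Hs : forall m, 1 < Cnorm (s m) <= s0.
Hypothesis cvs : Cseq_cv s Cx1.

Lemma scaled_bounds (u : Cx) (rho : R) : 0 < Cnorm u -> Cnorm u * s0 * Cnorm q <= rho -> Cnorm q / Cnorm u <= rho ->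
  (forall m, (u * s m)%Cx <> Cx0) /\ (forall m, Cnorm (u * s m * q)%Cx <= rho)
  /\ (forall m, Cnorm (Cx1 / (u * s m))%Cx <= 1 / Cnorm u) /\ (forall m, Cnorm (q / (u * s m))%Cx <= rho)
  /\ Cseq_cv (fun m => u * s m)%Cx u.
Proof.
  intros Hu H1 H2. set (y := Cnorm u) in *. pose proof (Cnorm_ge0 q).
  assert (E : forall m, y <= Cnorm (u * s m)%Cx <= y * s0).
  { intros m. rewrite Cnorm_mul. fold y. specialize (Hs m). nra. }
  repeat split.
  - intros m. apply Cnorm_neq0. specialize (E m). lra.
  - intros m. rewrite Cnorm_mul. specialize (E m). eapply Rle_trans; [|exact H1]. apply Rmult_le_compat_r; lra.
  - intros m. apply Cnorm_div_le; [rewrite Cnorm_1; lra | exact Hu | apply E].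
  - intros m. eapply Rle_trans; [|exact H2]. apply Cnorm_div_le; [lra | exact Hu | apply E].
  - pose proof (cv_mul _ _ _ _ (cv_const u) cvs) as H3. replace (u * Cx1)%Cx with u in H3 by ring. exact H3.
Qed.

Lemma square_bounds : (forall m, 1 < Cnorm (s m * s m)%Cx <= s0 * s0) /\ (forall m, s m <> Cx0)
  /\ (forall m, (s m * s m)%Cx <> Cx1) /\ Cseq_cv (fun m => s m * s m)%Cx Cx1.
Proof.
  assert (E : forall m, 1 < Cnorm (s m * s m)%Cx <= s0 * s0) by (intros m; rewrite Cnorm_mul; specialize (Hs m); nra).
  repeat split; try apply E.
  - intros m. apply Cnorm_neq0. specialize (Hs m). lra.
  - intros m Z. specialize (E m). rewrite Z, Cnorm_1 in E. lra.
  - pose proof (cv_mul _ _ _ _ cvs cvs) as H. replace (Cx1 * Cx1)%Cx with Cx1 in H by ring. exact H.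
Qed.

Lemma square_products (P : Cx -> Cx) (B : Cx) : (forall a, qpoch_inf_cv a q (P a)) -> qpoch_inf_cv q q B ->
  Cseq_cv (fun m => P (q / (s m * s m))%Cx) B /\ Cseq_cv (fun m => P (s m * s m * q)%Cx) B.
Proof.
  intros HP HB. destruct square_bounds as (sq & _ & _ & cvsq). pose proof (Cnorm_ge0 q). split.
  - apply (qpoch_inf_continuous q hq (fun m => q / (s m * s m))%Cx _ q B 1); [ | | intros; apply HP | exact HB].
    + intros m. specialize (sq m). replace 1 with (1 / 1) by field. apply Cnorm_div_le; lra.
    + pose proof (cv_div _ _ _ _ (cv_const q) cvsq Cx1_neq0) as H1.
      replace (q / Cx1)%Cx with q in H1 by (field; nz). exact H1.
  - apply (qpoch_inf_continuous q hq (fun m => s m * s m * q)%Cx _ q B (s0 * s0 * Cnorm q)); [ | | intros; apply HP | exact HB].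
    + intros m. specialize (sq m). rewrite (Cnorm_mul (s m * s m)%Cx). apply Rmult_le_compat_r; lra.
    + pose proof (cv_mul _ _ _ _ cvsq (cv_const q)) as H1.
      replace (Cx1 * q)%Cx with q in H1 by ring. exact H1.
Qed.

End Scaling.

(** * The case b c -> 1, common to f and phi *)

Section UnitCase.
Variables q beta gamma : Cx.
Hypothesis hq : Cnorm q < 1.
Hypothesis hq0 : q <> Cx0.
Hypothesis hbeta : Cnorm beta = 1.
Hypothesis hgamma : Cnorm gamma = 1.
Hypothesis hbg : (beta * gamma)%Cx = Cx1.
Let x := Cnorm q.
Let Hx : 0 <= x < 1. Proof. split; [apply Cnorm_ge0 | exact hq]. Qed.
Variables (s0 : R) (s : nat -> Cx).
Hypothesis Hs0 : 1 <= s0.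
Hypothesis Hsx : s0 * s0 * x < 1.
Hypothesis Hs : forall m, 1 < Cnorm (s m) <= s0.
Hypothesis cvs : Cseq_cv s Cx1.

Let bc_sq (m : nat) : (beta * s m * (gamma * s m) = s m * s m)%Cx.
Proof. transitivity (beta * gamma * (s m * s m))%Cx; [ring|]. rewrite hbg. ring. Qed.

(** [sigma] is the natural variable of the r-th term. For beta = gamma = -1 the quotient (1 - s^2
    q^(2r)) / (1 + s q^r)^2 reduces to (1 - s q^r) / (1 + s q^r), so it is s; for i and -i the
    denominator is 1 + s^2 q^(2r), so it is s^2. [kappa] is the cofactor of 1 - sigma in 1 - s^2. *)
Lemma unit_bilateral (sigma kappa : nat -> Cx) (kappa0 : Cx) (g w : nat -> Cx) (N : nat -> nat) (s1 : R) (Kb Kc B : Cx) :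
  (forall m, 1 < Cnorm (sigma m) <= s1) -> s1 * x < 1 -> Cseq_cv sigma Cx1 ->
  Cseq_cv kappa kappa0 -> kappa0 <> Cx0 ->
  (forall m, Cx1 - s m * s m = (Cx1 - sigma m) * kappa m)%Cx ->
  (forall n, Cnorm (w n) <= x) -> (forall n, (N n <= 4 * n + 4)%nat) ->
  (forall n, Cnorm (g n) <= x ^ (n * n)) ->
  (forall m, rpos_limit q (beta * s m) (gamma * s m) 0 = (Cx1 - sigma m) / (Cx1 + sigma m))%Cx ->
  (forall m n, (Cx1 + sigma m * w n) <> Cx0 -> (sigma m + w n) <> Cx0 ->
     rpos_limit q (beta * s m) (gamma * s m) (S n) + rneg_limit q (beta * s m) (gamma * s m) n
     = g n * ((Cx1 - sigma m * w n) / (Cx1 + sigma m * w n) * sigma m ^ N n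
              - (sigma m - w n) / (sigma m + w n) / sigma m ^ N n))%Cx ->
  qpoch_inf_cv (q / beta)%Cx q Kb -> qpoch_inf_cv (q / gamma)%Cx q Kc -> qpoch_inf_cv q q B ->
  exists Lp Ln l, Cseries_cv (lpos_limit q beta gamma) Lp /\ Cseries_cv (lneg_limit q beta gamma) Ln /\
    Cseries_cv (fun n => g n * diffquot1 (w n) (N n))%Cx l /\
    (Lp + Ln = (Cx1 - beta) * (Cx1 - gamma) * Kb * Kc / (B * (kappa0 * B * B)) * (Cx1 / (Cx1 + Cx1) + l))%Cx.
Proof.
  intros Hsig Hs1 cvsig cvk Hk0 Hk Hw HN Hg Hr0 Hr HKb HKc HB.
  destruct (functional_choice (fun a P => qpoch_inf_cv a q P) (qpoch_cv q hq)) as [P HP].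
  assert (Hs0x : s0 * x < 1) by nra.
  assert (SB : forall u, Cnorm u = 1 -> (forall m, (u * s m)%Cx <> Cx1) /\ 1 / Cnorm u <= 1 /\ u <> Cx0
    /\ 0 < Cnorm u /\ Cnorm u * s0 * x <= s0 * x /\ x / Cnorm u <= s0 * x).
  { intros u Hu. repeat split; try (apply Cnorm_neq0); rewrite ?Hu; try lra; [|nra].
    intros m Z. specialize (Hs m). pose proof (f_equal Cnorm Z) as Z'. rewrite Cnorm_mul, Hu, Cnorm_1 in Z'. lra. }
  destruct (SB beta hbeta) as (b1 & b2 & b3 & b4 & b5 & b6).
  destruct (SB gamma hgamma) as (c1 & c2 & c3 & c4 & c5 & c6).
  destruct (scaled_bounds q s0 s Hs cvs beta (s0 * x) b4 b5 b6) as (b7 & b8 & b9 & b10 & b11).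
  destruct (scaled_bounds q s0 s Hs cvs gamma (s0 * x) c4 c5 c6) as (c7 & c8 & c9 & c10 & c11).
  destruct (square_bounds s0 s Hs cvs) as (sq & _ & sq1 & _). destruct (square_products q s0 s hq Hs cvs P B HP HB) as [cp1 cp2].
  assert (sig1 : forall m, sigma m <> Cx1).
  { intros m E. specialize (Hsig m). rewrite E, Cnorm_1 in Hsig. lra. }
  assert (sig0 : forall m, sigma m <> Cx0) by (intros m; apply Cnorm_neq0; specialize (Hsig m); lra).
  assert (P1 : forall m n, (Cx1 + sigma m * w n)%Cx <> Cx0).
  { intros m n. replace (Cx1 + sigma m * w n)%Cx with (Cx1 - - (sigma m * w n))%Cx by ring.
    apply one_minus_neq0. rewrite Cnorm_opp, Cnorm_mul. specialize (Hsig m). specialize (Hw n). nra. }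
  assert (P2 : forall m z, Cnorm z <= 1 -> (sigma m + z)%Cx <> Cx0).
  { intros m z Hz. apply Cnorm_neq0. replace (sigma m + z)%Cx with (sigma m - - z)%Cx by ring.
    pose proof (Cnorm_sub_ge (sigma m) (- z)%Cx) as G. rewrite Cnorm_opp in G. specialize (Hsig m). lra. }
  assert (P3 : forall m, (Cx1 + sigma m)%Cx <> Cx0).
  { intros m. replace (Cx1 + sigma m)%Cx with (sigma m + Cx1)%Cx by ring. apply P2. rewrite Cnorm_1. lra. }
  destruct (diffquot_tannery sigma w g N x s1 Hx Hs1 ltac:(intros m; specialize (Hsig m); lra) cvsig Hw HN Hg) as [l [Hl HL]].
  assert (NB := qpoch_inf_neq0 q hq q B hq HB).
  destruct (limit_transform q (fun m => beta * s m)%Cx (fun m => gamma * s m)%Cx beta gamma (s0 * x) 1 hq hq0 Hs0x)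
    with (sigma := sigma) (W := fun m => (kappa m * P (q / (s m * s m)) * P (s m * s m * q))%Cx)
         (W0 := (kappa0 * B * B)%Cx) (X := (Cx1 / (Cx1 + Cx1) + l)%Cx) (Q := B) (Kb := Kb) (Kc := Kc)
    as (Lp & Ln & HLp & HLn & E); try assumption.
  - intros m. rewrite bc_sq. apply sq1.
  - intros m. eapply Rle_trans; [apply b9 | exact b2].
  - intros m. eapply Rle_trans; [apply c9 | exact c2].
  - intros m. rewrite bc_sq, Cnorm_mul. specialize (sq m). fold x. nra.
  - intros m. rewrite bc_sq. specialize (sq m). apply Rle_lt_trans with (x / 1); [|lra].
    apply Cnorm_div_le; [fold x; lra | lra | lra].
  - intros m E1 E2 H1 H2. rewrite bc_sq in *.
    rewrite (cv_unique _ _ _ H1 (HP _)), (cv_unique _ _ _ H2 (HP _)), Hk. ring.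
  - apply cv_mul; [apply cv_mul|]; assumption.
  - repeat apply Cmul_neq0; assumption.
  - apply (paired_limit q _ _ sigma g w N l sig1 P3 cvsig Hr0); [|exact HL].
    intros m n.
    assert (Pw : (sigma m + w n)%Cx <> Cx0) by (apply P2; specialize (Hw n); lra).
    rewrite Hr by auto. rewrite <- diffquot_spec by auto. ring.
  - exists Lp, Ln, l. repeat split; assumption.
Qed.

End UnitCase.

Section FandPhi.
Variable q : Cx.
Hypothesis hq : Cnorm q < 1.
Hypothesis hq0 : q <> Cx0.
Let x := Cnorm q.
Let Hx : 0 <= x < 1. Proof. split; [apply Cnorm_ge0 | exact hq]. Qed.

(** The constant 2 is (1 - b)(1 - c) = 4 divided by the limit 2 of [kappa]; the products for q/b and
    q/c are both [A]. *)
Lemma f_bilateral (A B : Cx) : qpoch_inf_cv (- q)%Cx q A -> qpoch_inf_cv q q B ->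
  exists Lp Ln l, Cseries_cv (lpos_limit q (- Cx1) (- Cx1))%Cx Lp /\ Cseries_cv (lneg_limit q (- Cx1) (- Cx1))%Cx Ln /\
    Cseries_cv (fun n => q ^ (2 * S n * S n) * diffquot1 (q ^ S n) (4 * S n))%Cx l /\
    (Lp + Ln = (Cx1 + Cx1) * A * A / (B * B * B) * (Cx1 / (Cx1 + Cx1) + l))%Cx.
Proof.
  intros HA HB. destruct (approach_1 x Hx) as (s0 & s & Hs0 & Hsx & Hs & cvs).
  assert (Hs0x : s0 * x < 1) by nra.
  assert (NB := qpoch_inf_neq0 q hq q B hq HB).
  assert (N1 : Cnorm (- Cx1)%Cx = 1) by (rewrite Cnorm_opp; apply Cnorm_1).
  assert (Hqm : (q / - Cx1 = - q)%Cx) by (field; nz).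
  assert (s_neq0 : forall m, s m <> Cx0) by (intros m; apply Cnorm_neq0; specialize (Hs m); lra).
  destruct (unit_bilateral q (- Cx1)%Cx (- Cx1)%Cx hq hq0 N1 N1 ltac:(ring) s0 s Hs0 Hsx Hs cvs
    s (fun m => Cx1 + s m)%Cx (Cx1 + Cx1)%Cx (fun n => q ^ (2 * S n * S n))%Cx (fun n => q ^ S n)%Cx
    (fun n => 4 * S n)%nat s0 A A B) as (Lp & Ln & l & HLp & HLn & Hl & E); try assumption.
  - apply cv_add; [apply cv_const | exact cvs].
  - exact two_neq0.
  - intros m. ring.
  - intros n. apply Cnorm_pow_S_le, hq.
  - intros n. lia.
  - intros n. apply Cnorm_pow_le; [exact hq | nia].
  - intros m. unfold rpos_limit. simpl.
    assert (P3 : (Cx1 + s m)%Cx <> Cx0).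
    { apply Cnorm_neq0. replace (Cx1 + s m)%Cx with (s m - - Cx1)%Cx by ring.
      pose proof (Cnorm_sub_ge (s m) (- Cx1)%Cx). specialize (Hs m). lra. }
    field; nz.
  - intros m n. set (r := S n). intros Z1 Z2. unfold rpos_limit, rneg_limit. fold r.
    replace (- Cx1 * s m * (- Cx1 * s m))%Cx with (s m ^ 2)%Cx by (simpl; ring). rewrite Cpow_pow.
    replace (2 * (2 * r))%nat with (4 * r)%nat by lia.
    rewrite (two_e_mul q r).
    pose proof (Cpow_neq0 (s m) (4 * r) (s_neq0 m)) as Z3.
    replace (s m ^ 2)%Cx with (s m * s m)%Cx by (simpl; ring). intros. field; nz.
  - rewrite Hqm. exact HA.
  - rewrite Hqm. exact HA.
  - exists Lp, Ln, l. repeat split; try assumption. rewrite E. field; nz. exact two_neq0.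
Qed.

Definition Ci : Cx := mkC 0 1.

Lemma Ci_sq : (Ci * Ci = - Cx1)%Cx.
Proof. apply Cx_eq; simpl; ring. Qed.

Lemma Ci_neq0 : Ci <> Cx0.
Proof. intros E. apply (f_equal Im) in E. simpl in E. lra. Qed.

Lemma Cnorm_Ci : Cnorm Ci = 1.
Proof. unfold Cnorm; simpl. replace (0 * 0 + 1 * 1) with 1 by ring. apply sqrt_1. Qed.

(** The constant 2 is (1 - i)(1 + i), and the products for q/i and -q/i merge into [A]. *)
Lemma phi_bilateral (A B : Cx) : qpoch_inf_cv (- q ^ 2)%Cx (q ^ 2)%Cx A -> qpoch_inf_cv q q B ->
  exists Lp Ln l, Cseries_cv (lpos_limit q Ci (- Ci)%Cx) Lp /\ Cseries_cv (lneg_limit q Ci (- Ci)%Cx) Ln /\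
    Cseries_cv (fun n => q ^ (2 * S n * S n) * diffquot1 (q ^ (2 * S n)) (2 * S n))%Cx l /\
    (Lp + Ln = (Cx1 + Cx1) * A / (B * B * B) * (Cx1 / (Cx1 + Cx1) + l))%Cx.
Proof.
  intros HA HB. destruct (approach_1 x Hx) as (s0 & s & Hs0 & Hsx & Hs & cvs).
  assert (NB := qpoch_inf_neq0 q hq q B hq HB).
  assert (N2 : Cnorm (- Ci)%Cx = 1) by (rewrite Cnorm_opp; apply Cnorm_Ci).
  assert (s_neq0 : forall m, s m <> Cx0) by (intros m; apply Cnorm_neq0; specialize (Hs m); lra).
  pose proof Ci_neq0 as I0.
  destruct (square_bounds s0 s Hs cvs) as (sq & _ & _ & cvsq).
  destruct (qpoch_cv q hq (q / Ci)%Cx) as [Kb HKb]. destruct (qpoch_cv q hq (q / - Ci)%Cx) as [Kc HKc].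
  assert (EK : (Kb * Kc = A)%Cx).
  { apply (qpoch_inf_pm (q / Ci)%Cx q); [exact HKb | |].
    - replace (- (q / Ci))%Cx with (q / - Ci)%Cx by (field; nz). exact HKc.
    - replace (q / Ci * (q / Ci))%Cx with (- q ^ 2)%Cx; [exact HA|].
      transitivity (q * q / (Ci * Ci))%Cx; [rewrite Ci_sq; simpl; field; nz | field; nz]. }
  destruct (unit_bilateral q Ci (- Ci)%Cx hq hq0 Cnorm_Ci N2) with (s0 := s0) (s := s) (sigma := fun m => (s m * s m)%Cx)
    (kappa := fun _ : nat => Cx1) (kappa0 := Cx1) (g := fun n => (q ^ (2 * S n * S n))%Cx)
    (w := fun n => (q ^ (2 * S n))%Cx) (N := fun n => (2 * S n)%nat) (s1 := s0 * s0) (Kb := Kb) (Kc := Kc) (B := B)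
    as (Lp & Ln & l & HLp & HLn & Hl & E); try assumption.
  - replace (Ci * - Ci)%Cx with (- (Ci * Ci))%Cx by ring. rewrite Ci_sq. ring.
  - apply cv_const.
  - exact Cx1_neq0.
  - intros m. ring.
  - intros n. apply Cnorm_pow_S_le, hq.
  - intros n. lia.
  - intros n. apply Cnorm_pow_le; [exact hq | nia].
  - intros m.
    assert (P3 : (Cx1 + s m * s m)%Cx <> Cx0).
    { apply Cnorm_neq0. replace (Cx1 + s m * s m)%Cx with (s m * s m - - Cx1)%Cx by ring.
      pose proof (Cnorm_sub_ge (s m * s m)%Cx (- Cx1)%Cx) as G. rewrite Cnorm_opp, Cnorm_1 in G. specialize (sq m). lra. }
    unfold rpos_limit. cbn [Nat.mul Nat.add Cpow].
    replace ((Cx1 - Ci * s m * Cx1) * (Cx1 - - Ci * s m * Cx1))%Cx with (Cx1 - (Ci * Ci) * (s m * s m))%Cx by ring.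
    replace (Ci * s m * (- Ci * s m))%Cx with (- (Ci * Ci) * (s m * s m))%Cx by ring.
    rewrite Ci_sq. field; nz.
  - intros m n. set (r := S n). intros Z1 Z2. unfold rpos_limit, rneg_limit. fold r.
    replace (Ci * s m * (- Ci * s m))%Cx with (- (Ci * Ci) * (s m * s m))%Cx by ring.
    replace ((Cx1 - Ci * s m * q ^ r) * (Cx1 - - Ci * s m * q ^ r))%Cx
      with (Cx1 - (Ci * Ci) * (s m * s m * (q ^ r * q ^ r)))%Cx by ring.
    replace ((- (Ci * Ci) * (s m * s m)) ^ (2 * r) * (q ^ r - Ci * s m) * (q ^ r - - Ci * s m))%Cx
      with ((- (Ci * Ci) * (s m * s m)) ^ (2 * r) * (q ^ r * q ^ r - (Ci * Ci) * (s m * s m)))%Cx by ring.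
    rewrite Ci_sq. replace (- - Cx1 * (s m * s m))%Cx with (s m * s m)%Cx by ring.
    rewrite <- two_e_mul.
    assert (Z3 : ((s m * s m) ^ (2 * r))%Cx <> Cx0) by (apply Cpow_neq0, Cmul_neq0; apply s_neq0). intros. field; nz.
  - exists Lp, Ln, l. repeat split; try assumption. rewrite E.
    replace ((Cx1 - Ci) * (Cx1 - - Ci) * Kb * Kc)%Cx with ((Cx1 - Ci * Ci) * (Kb * Kc))%Cx by ring.
    rewrite EK, Ci_sq. field; nz. exact two_neq0.
Qed.

End FandPhi.

Lemma diffquot1_spec (w : Cx) (N : nat) : (Cx1 + w)%Cx <> Cx0 ->
  diffquot1 w N = ((Cx1 + Cx1) * ((Cx1 + Cx1) * w - CINR N * (Cx1 - w * w)) / ((Cx1 + w) * (Cx1 + w)))%Cx.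
Proof. intros H. unfold diffquot1. rewrite CINR_mul, CINR_2. field; nz. Qed.

(** 4 (n + 1) + 1 <= 4 * 2^(n+1) + 2^n = 9 * 2^n. *)
Lemma Cnorm_linear (k n : nat) (z w : Cx) : (k <= 4)%nat ->
  Cnorm z <= 1 -> Cnorm w <= 1 -> Cnorm (CINR k * CINR (S n) * z + w)%Cx <= 9 * 2 ^ n.
Proof.
  intros Hk Hz Hw. eapply Rle_trans; [apply Cnorm_triang|]. rewrite !Cnorm_mul, !Cnorm_CINR.
  pose proof (le_INR k 4 Hk) as K. simpl (INR 4) in K. pose proof (INR_le_pow2 (S n)) as P.
  pose proof (pow_R1_Rle 2 n ltac:(lra)) as P1. cbn [pow] in P.
  pose proof (pos_INR k). pose proof (pos_INR (S n)).
  assert (0 <= INR k * INR (S n)) by (apply Rmult_le_pos; assumption). nra.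
Qed.

Lemma Cnorm_linear0 (k n : nat) (z w : Cx) : (k <= 4)%nat ->
  Cnorm z <= 1 -> Cnorm w <= 1 -> Cnorm (CINR k * CINR n * z + w)%Cx <= 9 * 2 ^ n.
Proof.
  intros Hk Hz Hw. destruct n as [|n].
  - replace (CINR k * CINR 0 * z + w)%Cx with w; [simpl; lra|].
    replace (CINR 0) with Cx0 by reflexivity. ring.
  - eapply Rle_trans; [apply Cnorm_linear; assumption|]. simpl. pose proof (pow_R1_Rle 2 n ltac:(lra)). lra.
Qed.

(** * From divided differences to the stated series for f and phi *)

Section Identities.
Variable q : Cx.
Hypothesis hq : Cnorm q < 1.
Hypothesis hq0 : q <> Cx0.
Let x := Cnorm q.
Let Hx : 0 <= x < 1. Proof. split; [apply Cnorm_ge0 | exact hq]. Qed.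

Let sq_ge (d : R) (u : nat -> Cx) : 0 < d -> (forall k, d <= Cnorm (u k)) -> forall k, d * d <= Cnorm (u k * u k)%Cx.
Proof. intros Hd H k. apply Cnorm_mul_ge; auto. Qed.

(** [h] is the series of divided differences; each of its terms is twice the pair r = n + 1, r = -(n
    + 1) of the stated series, whose term r = 0 is left over. *)
Let paired_sum (p m : nat -> Cx) (lp lm l : Cx) (h : nat -> Cx) :
  Cseries_cv p lp -> Cseries_cv m lm -> Cseries_cv h l ->
  (forall n, h n = (Cx1 + Cx1) * (p (S n) + m n))%Cx -> (l = (Cx1 + Cx1) * (lp - p O + lm))%Cx.
Proof.
  intros Hp Hm Hh E. apply (cv_unique _ _ _ Hh).
  apply (series_ext _ _ _ (series_mul (Cx1 + Cx1)%Cx _ _ (series_add _ _ _ _ (series_unS _ _ Hp) Hm))).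
  intros n. symmetry. apply E.
Qed.

Lemma f_identity : exists F Sr A B T : Cx,
     mock_f_cv q F /\
     Cseries_cv (fun m => (qpoch (- Cx1) q (S m) * qpoch (- Cx1) q (S m) * q ^ (S m))%Cx) Sr /\
     qpoch_inf_cv (- q)%Cx q A /\
     qpoch_inf_cv q q B /\
     Cbiseries_cv (fun r : Z =>
        (q ^^ (2 * r * r + r)%Z * (ZtoC 4 * ZtoC r * q ^^ r + Cx1)
         / ((Cx1 + q ^^ r) * (Cx1 + q ^^ r)))%Cx) T /\
     F = (- Sr + ZtoC 4 * (A * A) / (B * B * B) * T)%Cx.
Proof.
  destruct (qpoch_cv q hq (- q)%Cx) as [A HA]. destruct (qpoch_cv q hq q) as [B HB].
  destruct (f_bilateral q hq hq0 A B HA HB) as (Lp & Ln & l & HLp & HLn & Hl & E).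
  destruct (one_plus_pow_ge q hq) as [d [Hd Hdk]].
  pose proof (one_plus_pow_neq0 q hq) as NZ.
  assert (NB := qpoch_inf_neq0 q hq q B hq HB).
  destruct (gauss_series_cv (fun n => q ^ (2 * n * n + n))%Cx (fun n => CINR 4 * CINR n * q ^ n + Cx1)%Cx
    (fun n => (Cx1 + q ^ n) * (Cx1 + q ^ n))%Cx x (d * d) Hx ltac:(nra)) as [l1 Hl1].
  { intros n. apply Cnorm_pow_le; [exact hq | nia]. }
  { intros n. apply Cnorm_linear0; [lia | apply Cnorm_pow_le1, hq | rewrite Cnorm_1; lra]. }
  { apply (sq_ge d (fun n => Cx1 + q ^ n)%Cx Hd Hdk). }
  (* The terms r = -(n + 1) of the stated series, multiplied above and below by q^(2(n+1)) to clear
     negative powers. *)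
  destruct (gauss_series_cv (fun n => q ^ (2 * S n * S n))%Cx (fun n => CINR 4 * CINR (S n) * (- Cx1) + q ^ S n)%Cx
    (fun n => (Cx1 + q ^ S n) * (Cx1 + q ^ S n))%Cx x (d * d) Hx ltac:(nra)) as [l2 Hl2].
  { intros n. apply Cnorm_pow_le; [exact hq | nia]. }
  { intros n. apply Cnorm_linear; [lia | rewrite Cnorm_opp, Cnorm_1; lra | apply Cnorm_pow_le1, hq]. }
  { intros n. apply (sq_ge d (fun n => Cx1 + q ^ n)%Cx Hd Hdk). }
  exists Lp, Ln, A, B, (l1 + l2)%Cx. split; [|split; [|split; [exact HA | split; [exact HB | split]]]].
  - apply (series_ext _ _ _ HLp). intros n. unfold lpos_limit.
    replace (- Cx1 * - Cx1)%Cx with Cx1 by ring. replace (- Cx1 * q)%Cx with (- q)%Cx by ring.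
    rewrite Cpow_1_l. f_equal. ring.
  - apply (series_ext _ _ _ HLn). intros n. unfold lneg_limit.
    replace (Cx1 / - Cx1)%Cx with (- Cx1)%Cx by (field; nz). ring.
  - exists l1, l2. split; [|split; [|reflexivity]].
    + apply (series_ext _ _ _ Hl1). intros n.
      replace (2 * Z.of_nat n * Z.of_nat n + Z.of_nat n)%Z with (Z.of_nat (2 * n * n + n)) by lia.
      rewrite !Cpowz_nat, ZtoC_nat, ZtoC_4, CINR_4. reflexivity.
    + apply (series_ext _ _ _ Hl2). intros n.
      replace (2 * - Z.of_nat (S n) * - Z.of_nat (S n) + - Z.of_nat (S n))%Z with (Z.of_nat (S n * (2 * n + 1))) by lia.
      rewrite Cpowz_nat, Cpowz_neg, ZtoC_neg, ZtoC_4, CINR_4.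
      replace (2 * S n * S n)%nat with (S n * (2 * n + 1) + S n)%nat by lia. rewrite Cpow_add.
      pose proof (NZ (S n)) as Z1. pose proof (Cpow_neq0 q (S n) hq0) as Z2. intros. field; nz.
  (* The term r = 0 is 1/4, so 1/2 + l = 2 (l1 + l2), which turns the constant 2 of [f_bilateral]
     into 4. *)
  - pose proof (paired_sum _ _ _ _ _ _ Hl1 Hl2 Hl) as EL.
    rewrite EL in E.
    + transitivity ((Lp + Ln) - Ln)%Cx; [ring|]. rewrite E. simpl. rewrite ZtoC_4, CINR_4.
      replace (CINR 0) with Cx0 by reflexivity. pose proof two_neq0 as H2.
      generalize dependent (Cx1 + Cx1)%Cx. intros. field; nz.
    + intros n. pose proof (NZ (S n)) as Z1. rewrite diffquot1_spec by exact Z1.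
      rewrite CINR_mul. rewrite Cpow_add. intros. field; nz.
Qed.

Lemma phi_identity : exists F Sr A B T : Cx,
     mock_phi_cv q F /\
     Cseries_cv (fun m => (qpoch (- Cx1) (q ^ 2) (S m) * q ^ (S m))%Cx) Sr /\
     qpoch_inf_cv (- (q ^ 2))%Cx (q ^ 2)%Cx A /\
     qpoch_inf_cv q q B /\
     Cbiseries_cv (fun r : Z =>
        (q ^^ (2 * r * r + 2 * r)%Z * (ZtoC 2 * ZtoC r * q ^^ (2 * r)%Z + Cx1)
         / ((Cx1 + q ^^ (2 * r)%Z) * (Cx1 + q ^^ (2 * r)%Z)))%Cx) T /\
     F = (- Sr + ZtoC 4 * A / (B * B * B) * T)%Cx.
Proof.
  assert (hq2 : Cnorm (q ^ 2)%Cx < 1) by (rewrite Cnorm_pow; simpl; fold x; nra).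
  destruct (qpoch_cv (q ^ 2)%Cx hq2 (- q ^ 2)%Cx) as [A HA]. destruct (qpoch_cv q hq q) as [B HB].
  destruct (phi_bilateral q hq hq0 A B HA HB) as (Lp & Ln & l & HLp & HLn & Hl & E).
  destruct (one_plus_pow_ge q hq) as [d [Hd Hdk]].
  pose proof (one_plus_pow_neq0 q hq) as NZ.
  assert (NB := qpoch_inf_neq0 q hq q B hq HB).
  destruct (gauss_series_cv (fun n => q ^ (2 * n * n + 2 * n))%Cx (fun n => CINR 2 * CINR n * q ^ (2 * n) + Cx1)%Cx
    (fun n => (Cx1 + q ^ (2 * n)) * (Cx1 + q ^ (2 * n)))%Cx x (d * d) Hx ltac:(nra)) as [l1 Hl1].
  { intros n. apply Cnorm_pow_le; [exact hq | nia]. }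
  { intros n. apply Cnorm_linear0; [lia | apply Cnorm_pow_le1, hq | rewrite Cnorm_1; lra]. }
  { intros n. apply (sq_ge d (fun n => Cx1 + q ^ n)%Cx Hd Hdk). }
  destruct (gauss_series_cv (fun n => q ^ (2 * S n * S n))%Cx (fun n => CINR 2 * CINR (S n) * (- Cx1) + q ^ (2 * S n))%Cx
    (fun n => (Cx1 + q ^ (2 * S n)) * (Cx1 + q ^ (2 * S n)))%Cx x (d * d) Hx ltac:(nra)) as [l2 Hl2].
  { intros n. apply Cnorm_pow_le; [exact hq | nia]. }
  { intros n. apply Cnorm_linear; [lia | rewrite Cnorm_opp, Cnorm_1; lra | apply Cnorm_pow_le1, hq]. }
  { intros n. apply (sq_ge d (fun n => Cx1 + q ^ n)%Cx Hd Hdk). }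
  exists Lp, Ln, A, B, (l1 + l2)%Cx. split; [|split; [|split; [exact HA | split; [exact HB | split]]]].
  - apply (series_ext _ _ _ HLp). intros n. unfold lpos_limit.
    replace (Ci * - Ci)%Cx with Cx1 by (transitivity (- (Ci * Ci))%Cx; [rewrite Ci_sq|]; ring).
    replace (- Ci * q)%Cx with (- (Ci * q))%Cx by ring. rewrite qpoch_pm, Cpow_1_l.
    replace (Ci * q * (Ci * q))%Cx with (- q ^ 2)%Cx; [f_equal; ring|].
    transitivity ((Ci * Ci) * (q * q))%Cx; [rewrite Ci_sq; simpl; ring | ring].
  - apply (series_ext _ _ _ HLn). intros n. unfold lneg_limit. pose proof Ci_neq0 as I0.
    replace (Cx1 / - Ci)%Cx with (- (Cx1 / Ci))%Cx by (field; nz).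
    transitivity ((qpoch (Cx1 / Ci) q (S n) * qpoch (- (Cx1 / Ci)) q (S n)) * q ^ S n)%Cx; [ring|].
    rewrite qpoch_pm. replace (Cx1 / Ci * (Cx1 / Ci))%Cx with (- Cx1)%Cx; [reflexivity|].
    transitivity (Cx1 / (Ci * Ci))%Cx; [rewrite Ci_sq; field; nz | field; nz].
  - exists l1, l2. split; [|split; [|reflexivity]].
    + apply (series_ext _ _ _ Hl1). intros n.
      replace (2 * Z.of_nat n * Z.of_nat n + 2 * Z.of_nat n)%Z with (Z.of_nat (2 * n * n + 2 * n)) by lia.
      replace (2 * Z.of_nat n)%Z with (Z.of_nat (2 * n)) by lia.
      rewrite !Cpowz_nat, ZtoC_nat, ZtoC_2, CINR_2. reflexivity.
    + apply (series_ext _ _ _ Hl2). intros n.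
      replace (2 * - Z.of_nat (S n) * - Z.of_nat (S n) + 2 * - Z.of_nat (S n))%Z with (Z.of_nat (S n * (2 * n))) by lia.
      replace (2 * - Z.of_nat (S n))%Z with (- Z.of_nat (S (n + S n)))%Z by lia.
      rewrite Cpowz_nat, Cpowz_neg, ZtoC_neg, ZtoC_2, CINR_2.
      replace (2 * S n)%nat with (S (n + S n))%nat by lia.
      replace (S (n + S n) * S n)%nat with (S n * (2 * n) + S (n + S n))%nat by lia. rewrite Cpow_add.
      pose proof (NZ (S (n + S n))) as Z1. pose proof (Cpow_neq0 q (S (n + S n)) hq0) as Z2. intros. field; nz.
  - pose proof (paired_sum _ _ _ _ _ _ Hl1 Hl2 Hl) as EL.
    rewrite EL in E.
    + transitivity ((Lp + Ln) - Ln)%Cx; [ring|]. rewrite E. simpl. rewrite ZtoC_4.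
      replace (CINR 0) with Cx0 by reflexivity. pose proof two_neq0 as H2.
      generalize dependent (Cx1 + Cx1)%Cx. intros. field; nz.
    + intros n. pose proof (NZ (2 * S n)%nat) as Z1. rewrite diffquot1_spec by exact Z1.
      rewrite CINR_mul. rewrite (Cpow_add q (2 * S n * S n)). intros. field; nz.
Qed.

End Identities.

(** Half-angle formulas, with the sign of the imaginary part taken from Im q. The root supplies b =
    i q^(1/2) for nu. *)
Lemma Csqrt_exists (q : Cx) : exists p, (p * p = q)%Cx.
Proof.
  pose proof (Cnorm_Re q) as HR. set (r := Cnorm q) in *. pose proof (Rle_abs (Re q)) as R1.
  pose proof (Rle_abs (- Re q)) as R2. rewrite Rabs_Ropp in R2.
  set (u := sqrt ((r + Re q) / 2)). set (v := sqrt ((r - Re q) / 2)).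
  assert (Hu : u * u = (r + Re q) / 2) by (apply sqrt_sqrt; lra).
  assert (Hv : v * v = (r - Re q) / 2) by (apply sqrt_sqrt; lra).
  assert (Hr : r * r = Re q * Re q + Im q * Im q) by (apply sqrt_sqrt; nra).
  assert (Huv : u * v = Rabs (Im q) / 2).
  { unfold u, v. rewrite <- sqrt_mult by lra.
    replace ((r + Re q) / 2 * ((r - Re q) / 2)) with (Rsqr (Im q / 2)).
    - rewrite sqrt_Rsqr_abs. unfold Rdiv. rewrite Rabs_mult, (Rabs_pos_eq (/ 2)) by lra. reflexivity.
    - unfold Rsqr. replace ((r + Re q) / 2 * ((r - Re q) / 2)) with ((r * r - Re q * Re q) / 4) by field.
      rewrite Hr. field. }
  destruct (Rle_lt_dec 0 (Im q)) as [H|H].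
  - exists (mkC u v). rewrite Rabs_pos_eq in Huv by exact H. apply Cx_eq; simpl; lra.
  - exists (mkC u (- v)). rewrite Rabs_left in Huv by exact H. apply Cx_eq; simpl; lra.
Qed.

(** * The identity for nu *)

Section Nu.
Variable q : Cx.
Hypothesis hq : Cnorm q < 1.
Hypothesis hq0 : q <> Cx0.
Let x := Cnorm q.
Let Hx : 0 <= x < 1. Proof. split; [apply Cnorm_ge0 | exact hq]. Qed.

(** Here a = q s^2, so the vanishing factor is 1 - 1/s^2, the first one of (q/a) = (1/s^2). Writing
    it as -(1 - s^2)/s^2 produces the minus sign. The pairs are r = n and r = -1 - n, and no term is
    left over. *)
Lemma nu_bilateral (p A B : Cx) : (p * p = q)%Cx ->
  qpoch_inf_cv (- q)%Cx (q ^ 2)%Cx A -> qpoch_inf_cv q q B ->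
  exists Lp Ln l, Cseries_cv (lpos_limit q (Ci * p) (- (Ci * p)))%Cx Lp
    /\ Cseries_cv (lneg_limit q (Ci * p) (- (Ci * p)))%Cx Ln /\
    Cseries_cv (fun n => q ^ (2 * n * n + 2 * n) * diffquot1 (q ^ (2 * n + 1)) (2 * n + 1))%Cx l /\
    (Lp + Ln = - ((Cx1 + q) * A / (B * B * B) * l))%Cx.
Proof.
  intros Hp HA HB. destruct (approach_1 x Hx) as (s0 & s & Hs0 & Hsx & Hs & cvs).
  assert (NB := qpoch_inf_neq0 q hq q B hq HB).
  assert (s_neq0 : forall m, s m <> Cx0) by (intros m; apply Cnorm_neq0; specialize (Hs m); lra).
  pose proof Ci_neq0 as I0.
  assert (p0 : p <> Cx0) by (intros E; apply hq0; rewrite <- Hp, E; ring).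
  set (y := Cnorm p). assert (Hy : y * y = x) by (unfold y, x; rewrite <- Hp, Cnorm_mul; reflexivity).
  assert (Hy0 : 0 < y) by (apply Cnorm_pos, p0). assert (Hy1 : y < 1) by nra.
  destruct (square_bounds s0 s Hs cvs) as (sq & _ & sq1 & cvsq).
  assert (sq0 : forall m, (s m * s m)%Cx <> Cx0) by (intros m; apply Cmul_neq0; apply s_neq0).
  set (b := (Ci * p)%Cx).
  assert (Hb2 : (b * b = - q)%Cx).
  { unfold b. transitivity ((Ci * Ci) * (p * p))%Cx; [ring|]. rewrite Ci_sq, Hp. ring. }
  assert (nb : Cnorm b = y) by (unfold b; rewrite Cnorm_mul, Cnorm_Ci; unfold y; ring).
  assert (nb' : Cnorm (- b)%Cx = y) by (rewrite Cnorm_opp; exact nb).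
  assert (b0 : b <> Cx0) by (apply Cmul_neq0; assumption).
  assert (bc : forall m, (b * s m * (- b * s m) = q * (s m * s m))%Cx).
  { intros m. transitivity (- (b * b) * (s m * s m))%Cx; [ring|]. rewrite Hb2. ring. }
  (* y = |q|^(1/2) bounds |q/(b s)| and s0 x bounds |b s q|; both are below 1. *)
  set (rho := Rmax y (s0 * x)).
  assert (Hrho : rho < 1) by (apply Rmax_lub_lt; [exact Hy1 | nra]).
  assert (Hr1 : y <= rho) by apply Rmax_l.
  assert (Hy' : x / y <= rho) by (rewrite <- Hy; replace (y * y / y) with y by (field; lra); exact Hr1).
  assert (Hy2 : y * s0 * x <= rho) by nra.
  destruct (scaled_bounds q s0 s Hs cvs b rho) as (b2 & b4 & b5 & b6 & b7); try (rewrite nb; assumption).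
  destruct (scaled_bounds q s0 s Hs cvs (- b)%Cx rho) as (c2 & c4 & c5 & c6 & c7); try (rewrite nb'; assumption).
  rewrite nb in b5. rewrite nb' in c5.
  assert (u1 : forall u, Cnorm u = y -> forall m, (u * s m)%Cx <> Cx1).
  { intros u Hu m Z. pose proof (f_equal Cnorm Z) as Z'. rewrite Cnorm_mul, Hu, Cnorm_1 in Z'. specialize (sq m).
    rewrite Cnorm_mul in sq. set (t := Cnorm (s m)) in *.
    assert (y * t * (y * t) = 1) by (rewrite Z'; ring). assert (y * y * (t * t) < 1) by (rewrite Hy; nra). lra. }
  destruct (functional_choice (fun a P => qpoch_inf_cv a q P) (qpoch_cv q hq)) as [P HP].
  destruct (square_products q s0 s hq Hs cvs P B HP HB) as [cp1 cp2].
  destruct (qpoch_cv q hq (q / b)%Cx) as [Kb HKb]. destruct (qpoch_cv q hq (q / - b)%Cx) as [Kc HKc].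
  assert (EK : (Kb * Kc = A)%Cx).
  { apply (qpoch_inf_pm (q / b)%Cx q); [exact HKb | |].
    - replace (- (q / b))%Cx with (q / - b)%Cx by (field; nz). exact HKc.
    - replace (q / b * (q / b))%Cx with (- q)%Cx; [exact HA|].
      transitivity (q * q / (b * b))%Cx; [rewrite Hb2; field; nz | field; nz]. }
  destruct (diffquot_tannery (fun m => s m * s m)%Cx (fun n => q ^ (2 * n + 1))%Cx (fun n => q ^ (2 * n * n + 2 * n))%Cx
     (fun n => 2 * n + 1)%nat x (s0 * s0) Hx Hsx ltac:(intros m; specialize (sq m); lra) cvsq) as [l [Hl HL]].
  { intros n. rewrite Nat.add_1_r. apply Cnorm_pow_S_le, hq. }
  { intros n. lia. }
  { intros n. apply Cnorm_pow_le; [exact hq | nia]. }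
  destruct (limit_transform q (fun m => b * s m)%Cx (fun m => - b * s m)%Cx b (- b)%Cx rho (1 / y) hq hq0 Hrho)
    with (sigma := fun m => (s m * s m)%Cx)
         (W := fun m => (- (Cx1 / (s m * s m) * P (q / (s m * s m)) * P (s m * s m * q)))%Cx)
         (W0 := (- (B * B))%Cx) (X := l) (Q := B) (Kb := Kb) (Kc := Kc)
    as (Lp & Ln & HLp & HLn & E); try assumption.
  - apply u1, nb.
  - apply u1, nb'.
  - intros m E. rewrite bc in E. specialize (sq m).
    assert (Cnorm (q * (s m * s m))%Cx = 1) by (rewrite E; apply Cnorm_1).
    rewrite Cnorm_mul in H. fold x in H. nra.
  - intros m. rewrite bc. specialize (sq m). rewrite (Cnorm_mul _ q), (Cnorm_mul q). fold x. nra.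
  - intros m. rewrite bc. specialize (sq m). replace (q / (q * (s m * s m)))%Cx with (Cx1 / (s m * s m))%Cx by (pose proof (s_neq0 m); field; nz).
    rewrite Cnorm_div, Cnorm_1 by apply sq0. apply Rmult_lt_reg_r with (Cnorm (s m * s m)%Cx); [lra|].
    unfold Rdiv. rewrite Rmult_1_l, Rinv_l by lra. lra.
  - apply Copp_neq0, b0.
  - intros m E1 E2 H1 H2. rewrite bc in *.
    replace (q / (q * (s m * s m)))%Cx with (Cx1 / (s m * s m))%Cx in H1 by (pose proof (s_neq0 m); field; nz).
    assert (H3 : qpoch_inf_cv (Cx1 / (s m * s m))%Cx q ((Cx1 - Cx1 / (s m * s m)) * P (q / (s m * s m)))%Cx).
    { apply qpoch_inf_S. replace (Cx1 / (s m * s m) * q)%Cx with (q / (s m * s m))%Cx by (pose proof (s_neq0 m); field; nz). apply HP. }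
    assert (H4 : qpoch_inf_cv (q * (s m * s m))%Cx q ((Cx1 - q * (s m * s m)) * E2)%Cx) by (apply qpoch_inf_S; exact H2).
    replace (s m * s m * q)%Cx with (q * (s m * s m))%Cx by ring. rewrite (cv_unique _ _ _ H1 H3). rewrite (cv_unique _ _ _ (HP (q * (s m * s m))%Cx) H4).
    specialize (sq0 m). generalize dependent (s m * s m)%Cx. intros. field; nz.
  - apply cv_opp. replace (B * B)%Cx with (Cx1 / Cx1 * B * B)%Cx by (field; nz).
    apply cv_mul; [apply cv_mul; [apply cv_div; [apply cv_const | exact cvsq | exact Cx1_neq0]|]|].
    + exact cp1.
    + exact cp2.
  - apply Copp_neq0, Cmul_neq0; assumption.
  - intros R1 R2 H1 H2.
    assert (N4 : forall m, (Cx1 - s m * s m)%Cx <> Cx0).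
    { intros m. apply Csub_neq0, not_eq_sym, sq1. }
    (* The term r = n contains (s^2)^(2n); one more factor s^2 raises the exponent to N = 2n + 1,
       which makes each pair antisymmetric under s^2 -> 1/s^2 as [diffquot_spec] requires. *)
    apply (cv_ext (fun m => Cx1 / (s m * s m) * (s m * s m / (Cx1 - s m * s m) * (R1 m + R2 m)))%Cx).
    { intros m. specialize (N4 m). specialize (sq0 m). generalize dependent (s m * s m)%Cx. intros. field; nz. }
    replace l with (Cx1 / Cx1 * l)%Cx by (field; nz).
    apply cv_mul; [apply cv_div; [apply cv_const | exact cvsq | exact Cx1_neq0]|].
    apply HL. intros m. specialize (N4 m).
    apply (series_ext _ _ _ (series_mul (s m * s m / (Cx1 - s m * s m))%Cx _ _ (series_add _ _ _ _ (H1 m) (H2 m)))).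
    intros n.
    assert (P1 : (Cx1 + s m * s m * q ^ (2 * n + 1))%Cx <> Cx0).
    { replace (Cx1 + s m * s m * q ^ (2 * n + 1))%Cx with (Cx1 - - (s m * s m * q ^ (2 * n + 1)))%Cx by ring.
      apply one_minus_neq0. rewrite Cnorm_opp, (Cnorm_mul (s m * s m)%Cx). specialize (sq m). rewrite Nat.add_1_r.
      pose proof (Cnorm_pow_S_le q (2 * n) hq) as Z. fold x in Z. nra. }
    assert (P2 : (s m * s m + q ^ (2 * n + 1))%Cx <> Cx0).
    { apply Cnorm_neq0. replace (s m * s m + q ^ (2 * n + 1))%Cx with (s m * s m - - q ^ (2 * n + 1))%Cx by ring.
      pose proof (Cnorm_sub_ge (s m * s m)%Cx (- q ^ (2 * n + 1))%Cx) as G. rewrite Cnorm_opp in G.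
      pose proof (Cnorm_pow_le1 q (2 * n + 1) hq). specialize (sq m). lra. }
    transitivity (q ^ (2 * n * n + 2 * n) / (Cx1 - s m * s m) *
      ((Cx1 - s m * s m) * diffquot (s m * s m) (q ^ (2 * n + 1)) (2 * n + 1)))%Cx.
    2:{ intros. field; nz. }
    rewrite diffquot_spec by auto.
    unfold rpos_limit, rneg_limit. rewrite bc.
    replace ((Cx1 - b * s m * q ^ n) * (Cx1 - - b * s m * q ^ n))%Cx
      with (Cx1 - (b * b) * (s m * s m * (q ^ n * q ^ n)))%Cx by ring.
    replace ((q * (s m * s m)) ^ (2 * S n) * (q ^ S n - b * s m) * (q ^ S n - - b * s m))%Cx
      with ((q * (s m * s m)) ^ (2 * S n) * (q ^ S n * q ^ S n - (b * b) * (s m * s m)))%Cx by ring.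
    rewrite Hb2. rewrite <- !two_e_mul. rewrite !(Cpow_mul_l q).
    specialize (sq0 m). set (t := (s m * s m)%Cx) in *.
    replace (q ^ (2 * S n * S n))%Cx with (q ^ (2 * n * n) * (q ^ (2 * n) * q ^ (2 * n) * q * q))%Cx.
    2:{ replace (2 * S n * S n)%nat with (2 * n * n + (2 * n + 2 * n + 1 + 1))%nat by lia. rewrite !Cpow_add. simpl. ring. }
    replace (2 * S n)%nat with (2 * n + 1 + 1)%nat by lia. rewrite !(Cpow_add q), !(Cpow_add t).
    replace (q ^ 1)%Cx with q by (simpl; ring). replace (t ^ 1)%Cx with t by (simpl; ring).
    rewrite !(Cpow_add q) in P1, P2. replace (q ^ 1)%Cx with q in P1, P2 by (simpl; ring).
    pose proof (Cpow_neq0 t (2 * n) sq0) as Z3. pose proof (Cpow_neq0 q (2 * n) hq0) as Z4. generalize dependent (q ^ (2 * n))%Cx. generalize (q ^ (2 * n * n))%Cx.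
    clearbody t. clear - N4 sq0 hq0. intros.
    assert (P4 : (c0 * q * q - - q * t)%Cx <> Cx0).
    { replace (c0 * q * q - - q * t)%Cx with (q * (t + c0 * q))%Cx by ring. apply Cmul_neq0; assumption. }
    field; nz.
  - exists Lp, Ln, l. repeat split; try assumption. rewrite E.
    replace ((Cx1 - b) * (Cx1 - - b) * Kb * Kc)%Cx with ((Cx1 - b * b) * (Kb * Kc))%Cx by ring.
    assert (B2 : (- (B * B))%Cx <> Cx0) by (apply Copp_neq0, Cmul_neq0; assumption).
    rewrite EK, Hb2. field; nz.
Qed.

(** The product evaluation of the theta series enters as a hypothesis, which [triple_product_16]
    discharges at the end. *)
Lemma nu_identity (P1 P2 P3 : Cx) :
  qpoch_inf_cv (- (q ^ 4))%Cx (q ^ 16)%Cx P1 -> qpoch_inf_cv (- (q ^ 12))%Cx (q ^ 16)%Cx P2 ->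
  qpoch_inf_cv (q ^ 16)%Cx (q ^ 16)%Cx P3 ->
  Cseries_cv (fun n => q ^ (2 * n * n + 2 * n))%Cx (P1 * P2 * P3)%Cx ->
  exists F Sr A B T P1 P2 P3 : Cx,
     mock_nu_cv q F /\
     Cseries_cv (fun n => (qpoch (- q) (q ^ 2) n * q ^ n)%Cx) Sr /\
     qpoch_inf_cv (- q)%Cx (q ^ 2)%Cx A /\
     qpoch_inf_cv q q B /\
     Cbiseries_cv (fun r : Z =>
        (q ^^ (2 * r * r + 2 * r)%Z * (ZtoC r + Cx1)
         / ((Cx1 + q ^^ (2 * r + 1)%Z) * (Cx1 + q ^^ (2 * r + 1)%Z)))%Cx) T /\
     qpoch_inf_cv (- (q ^ 4))%Cx (q ^ 16)%Cx P1 /\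
     qpoch_inf_cv (- (q ^ 12))%Cx (q ^ 16)%Cx P2 /\
     qpoch_inf_cv (q ^ 16)%Cx (q ^ 16)%Cx P3 /\
     F = (- Sr + ZtoC 4 * A / (B * B * B) * T
          - ZtoC 2 * A / (B * B * B) * (P1 * P2 * P3))%Cx.
Proof.
  intros HP1 HP2 HP3 HPs.
  assert (hq2 : Cnorm (q ^ 2)%Cx < 1) by (rewrite Cnorm_pow; simpl; fold x; nra).
  destruct (qpoch_cv (q ^ 2)%Cx hq2 (- q)%Cx) as [A HA]. destruct (qpoch_cv q hq q) as [B HB].
  destruct (Csqrt_exists q) as [p Hp].
  destruct (nu_bilateral p A B Hp HA HB) as (Lp & Ln & l & HLp & HLn & Hl & E).
  destruct (one_plus_pow_ge q hq) as [d [Hd Hdk]].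
  pose proof (one_plus_pow_neq0 q hq) as NZ.
  assert (NB := qpoch_inf_neq0 q hq q B hq HB).
  assert (N1 : (Cx1 + q)%Cx <> Cx0) by (specialize (NZ 1%nat); simpl in NZ; intros Z; apply NZ; rewrite <- Z; ring).
  assert (p0 : p <> Cx0) by (intros Z; apply hq0; rewrite <- Hp, Z; ring).
  assert (b0 : (Ci * p)%Cx <> Cx0) by (apply Cmul_neq0; [exact Ci_neq0 | exact p0]).
  assert (Hb2 : (Ci * p * (Ci * p) = - q)%Cx).
  { transitivity ((Ci * Ci) * (p * p))%Cx; [ring|]. rewrite Ci_sq, Hp. ring. }
  assert (YB : forall n, d * d <= Cnorm ((Cx1 + q ^ (2 * n + 1)) * (Cx1 + q ^ (2 * n + 1)))%Cx).
  { intros n. apply Cnorm_mul_ge; auto. }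
  destruct (gauss_series_cv (fun n => q ^ (2 * n * n + 2 * n))%Cx (fun n => CINR 1 * CINR n * Cx1 + Cx1)%Cx
    (fun n => (Cx1 + q ^ (2 * n + 1)) * (Cx1 + q ^ (2 * n + 1)))%Cx x (d * d) Hx ltac:(nra)) as [l1 Hl1].
  { intros n. apply Cnorm_pow_le; [exact hq | nia]. }
  { intros n. apply Cnorm_linear0; [lia | |]; rewrite Cnorm_1; lra. }
  { exact YB. }
  destruct (gauss_series_cv (fun n => q ^ (2 * n * n + 2 * n))%Cx (fun n => CINR 1 * CINR n * (- (q ^ (2 * n + 1) * q ^ (2 * n + 1))) + Cx0)%Cx
    (fun n => (Cx1 + q ^ (2 * n + 1)) * (Cx1 + q ^ (2 * n + 1)))%Cx x (d * d) Hx ltac:(nra)) as [l2 Hl2].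
  { intros n. apply Cnorm_pow_le; [exact hq | nia]. }
  { intros n. apply Cnorm_linear0; [lia | | rewrite Cnorm_0; lra].
    rewrite Cnorm_opp, <- Cpow_add. apply Cnorm_pow_le1, hq. }
  { exact YB. }
  assert (C1 : CINR 1 = Cx1) by (apply Cx_eq; reflexivity).
  (* Dividing by 1 + q completes (-q^3;q^2)_n to (-q;q^2)_(n+1) in the positive half, and cancels
     the first factor of (-1/q;q^2)_(n+1), up to a power of q, in the negative half. *)
  exists (Cinv (Cx1 + q) * Lp)%Cx, (Cinv (Cx1 + q) * Ln)%Cx, A, B, (l1 + l2)%Cx, P1, P2, P3.
  split; [|split; [|split; [exact HA | split; [exact HB | split; [|repeat (split; [assumption|])]]]]].
  - apply (series_ext _ _ _ (series_mul (Cinv (Cx1 + q)%Cx) _ _ HLp)). intros n. unfold lpos_limit.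
    replace (Ci * p * - (Ci * p))%Cx with q by (transitivity (- (Ci * p * (Ci * p)))%Cx; [rewrite Hb2|]; ring).
    replace (- (Ci * p) * q)%Cx with (- (Ci * p * q))%Cx by ring. rewrite qpoch_pm.
    replace (Ci * p * q * (Ci * p * q))%Cx with (- q * q ^ 2)%Cx.
    2:{ transitivity ((Ci * p * (Ci * p)) * (q * q))%Cx; [rewrite Hb2; simpl; ring | ring]. }
    rewrite qpoch_S_l, Cpow_add.
    assert (Z : qpoch (- q * q ^ 2)%Cx (q ^ 2)%Cx n <> Cx0).
    { apply qpoch_neq0, one_minus_small_pow_neq0; [exact hq2|].
      replace (- q * q ^ 2)%Cx with (- (q * (q * q)))%Cx by (simpl; ring). rewrite Cnorm_opp, !Cnorm_mul. fold x. nra. } intros. field; nz.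
  - apply (series_ext _ _ _ (series_mul (Cinv (Cx1 + q)%Cx) _ _ HLn)). intros n. unfold lneg_limit.
    set (b := (Ci * p)%Cx) in *.
    replace (Cx1 / - b)%Cx with (- (Cx1 / b))%Cx by (field; nz).
    transitivity (Cinv (Cx1 + q) * (q ^ S n * (qpoch (Cx1 / b) q (S n) * qpoch (- (Cx1 / b)) q (S n))))%Cx; [ring|].
    rewrite qpoch_pm. replace (Cx1 / b * (Cx1 / b))%Cx with (- (Cx1 / q))%Cx.
    2:{ transitivity (Cx1 / (b * b))%Cx; [rewrite Hb2; field; nz | field; nz]. }
    rewrite qpoch_S_l. replace (- (Cx1 / q) * q ^ 2)%Cx with (- q)%Cx by (simpl; field; nz).
    simpl. field; nz.
  - exists l1, l2. split; [|split; [|reflexivity]].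
    + apply (series_ext _ _ _ Hl1). intros n.
      replace (2 * Z.of_nat n * Z.of_nat n + 2 * Z.of_nat n)%Z with (Z.of_nat (2 * n * n + 2 * n)) by lia.
      replace (2 * Z.of_nat n + 1)%Z with (Z.of_nat (2 * n + 1)) by lia.
      rewrite !Cpowz_nat, ZtoC_nat, C1. f_equal. f_equal. ring.
    + apply (series_ext _ _ _ Hl2). intros n.
      replace (2 * - Z.of_nat (S n) * - Z.of_nat (S n) + 2 * - Z.of_nat (S n))%Z with (Z.of_nat (2 * n * n + 2 * n)) by lia.
      replace (2 * - Z.of_nat (S n) + 1)%Z with (- Z.of_nat (S (2 * n)))%Z by lia.
      rewrite Cpowz_nat, Cpowz_neg, ZtoC_neg, (CINR_S n), C1.
      replace (2 * n + 1)%nat with (S (2 * n)) by lia.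
      pose proof (NZ (S (2 * n))) as Z1. pose proof (Cpow_neq0 q (S (2 * n)) hq0) as Z2. intros. field; nz.
  (* With w = q^(2n+1), the pair r = n, r = -1 - n contributes (n + 1 - n w^2)/(1 + w)^2 times
     q^(2n^2+2n). Four times this fraction exceeds the negated divided difference by exactly 2, and
     the excess sums to the theta series. *)
  - assert (EL : (- l = ZtoC 4 * (l1 + l2) - ZtoC 2 * (P1 * P2 * P3))%Cx).
    { assert (H := series_add _ _ _ _ (series_mul (ZtoC 4) _ _ (series_add _ _ _ _ Hl1 Hl2)) (series_mul (- ZtoC 2)%Cx _ _ HPs)).
      transitivity (ZtoC 4 * (l1 + l2) + - ZtoC 2 * (P1 * P2 * P3))%Cx; [|ring].
      apply (cv_unique _ _ _) with (2 := H).
      replace (- l)%Cx with (- Cx1 * l)%Cx by ring.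
      apply (series_ext _ _ _ (series_mul (- Cx1)%Cx _ _ Hl)). intros n.
      pose proof (NZ (2 * n + 1)%nat) as Z1. rewrite diffquot1_spec by exact Z1.
      rewrite CINR_add, CINR_mul, CINR_2, C1, ZtoC_4, ZtoC_2. intros. field; nz. }
    transitivity (Cinv (Cx1 + q) * ((Lp + Ln) - Ln))%Cx; [ring|]. rewrite E.
    transitivity (- (Cinv (Cx1 + q) * Ln) + A / (B * B * B) * - l)%Cx; [field; nz|].
    rewrite EL. field; nz.
Qed.

End Nu.

(** * The limiting case of the 1psi1 summation *)

(** The Gaussian binomial coefficient, by the q-Pascal rule rather than as a quotient: it is defined
    for every q and vanishes for k > n. *)
Fixpoint qbin (q : Cx) (n k : nat) : Cx :=
  match n, k with
  | _, O => Cx1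
  | O, S _ => Cx0
  | S n', S k' => (qbin q n' k' + q ^ S k' * qbin q n' (S k'))%Cx
  end.

(** * Gaussian binomials and the finite q-Vandermonde sum *)

Section QBinomial.
Local Open Scope C_scope.
Variable q : Cx.

Lemma qbin_0_r (n : nat) : qbin q n 0 = Cx1.
Proof. destruct n; reflexivity. Qed.

Lemma qbin_SS (n k : nat) : qbin q (S n) (S k) = qbin q n k + q ^ S k * qbin q n (S k).
Proof. reflexivity. Qed.

Lemma qbin_small (n : nat) : forall k, (n < k)%nat -> qbin q n k = Cx0.
Proof.
  induction n as [|n IH]; intros [|k] H; try lia; [reflexivity|].
  rewrite qbin_SS, !IH by lia. ring.
Qed.

Lemma qbin_diag (n : nat) : qbin q n n = Cx1.
Proof. induction n as [|n IH]; [reflexivity|]. rewrite qbin_SS, IH, qbin_small by lia. ring. Qed.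

Lemma qbin_fact (i : nat) : forall j, qbin q (i + j) j * (qpoch q q j * qpoch q q i) = qpoch q q (i + j).
Proof.
  induction i as [|i IHi].
  - intros j. simpl (0 + j)%nat. rewrite qbin_diag. change (qpoch q q 0) with Cx1. ring.
  - induction j as [|j IHj].
    + rewrite qbin_0_r, Nat.add_0_r. change (qpoch q q 0) with Cx1. ring.
    +
      replace (S i + S j)%nat with (S (i + S j)) by lia. rewrite qbin_SS, (qpoch_S q q (i + S j)).
      replace (S i + j)%nat with (i + S j)%nat in IHj by lia.
      transitivity (qbin q (i + S j) j * (qpoch q q j * qpoch q q (S i)) * (Cx1 - q * q ^ j)
        + q ^ S j * (qbin q (i + S j) (S j) * (qpoch q q (S j) * qpoch q q i)) * (Cx1 - q * q ^ i)).
      { rewrite !qpoch_S. ring. }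
      rewrite IHi, IHj. rewrite Cpow_add. simpl. ring.
Qed.

Lemma qbin_pascal_r (n : nat) : forall k, qbin q (S n) (S k) = qbin q n (S k) + q ^ (n - k) * qbin q n k.
Proof.
  induction n as [|n IH]; intros k.
  - destruct k; simpl; ring.
  - destruct k as [|k].
    + rewrite qbin_SS. rewrite !IH, !qbin_0_r, !Nat.sub_0_r.
      pose proof (qbin_SS n 0) as E. rewrite IH, !qbin_0_r, !Nat.sub_0_r in E.
      transitivity (Cx1 + q ^ 1 * qbin q n 1 + q * q ^ n); [simpl; ring|].
      rewrite <- E. simpl. ring.
    + pose proof (IH k) as I1. pose proof (IH (S k)) as I2.
      pose proof (qbin_SS n k) as S1. pose proof (qbin_SS n (S k)) as S2.
      transitivity (qbin q n (S k) + q ^ (n - k) * qbin q n k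
         + q ^ S (S k) * (qbin q n (S (S k)) + q ^ (n - S k) * qbin q n (S k))); [rewrite <- I1, <- I2; reflexivity|].
      transitivity (qbin q n (S k) + q ^ S (S k) * qbin q n (S (S k))
         + q ^ (n - k) * (qbin q n k + q ^ S k * qbin q n (S k))); [|rewrite <- S1, <- S2; reflexivity].
      destruct (Nat.le_gt_cases (S k) n) as [H|H].
      * replace (n - k)%nat with (S (n - S k)) by lia. simpl. ring.
      * rewrite (qbin_small n (S k)) by lia. ring.
Qed.

(** Both Pascal rules in succession; this is the step from 2N + 1 to 2N + 3 in the finite form of
    Jacobi's cube. *)
Lemma qbin_pascal2 (n k : nat) :
  qbin q (S (S n)) (S (S k)) = q ^ (n - k) * qbin q n k + (Cx1 + q ^ S n) * qbin q n (S k)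
                               + q ^ S (S k) * qbin q n (S (S k)).
Proof.
  rewrite qbin_SS, !qbin_pascal_r.
  destruct (Nat.le_gt_cases (S k) n) as [H|H].
  - replace (q ^ S n) with (q ^ S (S k) * q ^ (n - S k)); [ring|].
    rewrite <- Cpow_add. f_equal. lia.
  - rewrite (qbin_small n (S k)) by lia. ring.
Qed.

Lemma Csum_qbin_S (n : nat) (f : nat -> Cx) :
  Csum (fun j => qbin q (S n) j * f j) (S (S n)) = Csum (fun j => qbin q n j * (q ^ j * f j + f (S j))) (S n).
Proof.
  rewrite Csum_S_l, qbin_0_r.
  rewrite (Csum_ext (fun j => qbin q (S n) (S j) * f (S j))
    (fun j => qbin q n j * f (S j) + q ^ S j * qbin q n (S j) * f (S j))).
  2:{ intros k _. rewrite qbin_SS. ring. }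
  rewrite Csum_add.
  rewrite (Csum_ext (fun j => qbin q n j * (q ^ j * f j + f (S j)))
    (fun j => qbin q n j * f (S j) + q ^ j * qbin q n j * f j)) by (intros; ring).
  rewrite Csum_add.
  assert (E : Csum (fun j => q ^ j * qbin q n j * f j) (S (S n)) = Csum (fun j => q ^ j * qbin q n j * f j) (S n)).
  { change (Csum ?h (S (S n))) with (Csum h (S n) + h (S n)). cbv beta. rewrite (qbin_small n (S n)) by lia. ring. }
  rewrite <- E, (Csum_S_l _ (S n)), qbin_0_r. simpl (q ^ 0). ring.
Qed.

(* binomial coefficient j(j-1)/2 *)
Definition C2 (j : nat) : nat := tri (pred j).

Lemma C2_S (j : nat) : C2 (S j) = (j + C2 j)%nat.
Proof. unfold C2. destruct j; reflexivity. Qed.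

Lemma C2_double (j : nat) : (2 * C2 j + j = j * j)%nat.
Proof. induction j as [|j IH]; [reflexivity|]. rewrite C2_S. lia. Qed.

(** A form of the q-Chu-Vandermonde sum. After [Csum_qbin_S] the bracket (1 - b d q^j) - d (1 - b
    q^j) equals 1 - d for every j, and what remains is the same sum for n with d q in place of d. *)
Lemma q_vandermonde (b : Cx) (n : nat) : forall d,
  Csum (fun j => qbin q n j * (qpoch b q j * qpoch (b * d * q ^ j) q (n - j) * (- d) ^ j * q ^ C2 j)) (S n)
  = qpoch d q n.
Proof.
  induction n as [|n IH]; intros d.
  - unfold qpoch; simpl. ring.
  - rewrite Csum_qbin_S, qpoch_S_l, <- (IH (d * q)), <- Csum_mul. apply Csum_ext. intros j Hj. replace (S n - j)%nat with (S (n - j)) by lia.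
    rewrite (qpoch_S_l (b * d * q ^ j)), (qpoch_S b), C2_S, Cpow_add.
    replace (b * (d * q) * q ^ j) with (b * d * q ^ S j) by (simpl; ring).
    replace (b * d * q ^ j * q) with (b * d * q ^ S j) by (simpl; ring).
    replace (- (d * q)) with (- d * q) by ring. rewrite Cpow_mul_l. simpl. ring.
Qed.

Section Shifted.
Variables b z : Cx.
Hypothesis hq0 : q <> Cx0.
Hypothesis hz0 : z <> Cx0.
Let B : Cx := - (b * z).

(** The terms N + k and N - (n + 1) of [q_vandermonde] for 2N and d = -z/q^N, without the common
    factor z^N / q^(N(N+1)/2). *)
Definition psi_pos (N k : nat) : Cx :=
  z ^ k * q ^ C2 k * (qbin q (2 * N) (N + k) * qpoch b q (N + k) * qpoch (B * q ^ k) q (N - k)).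
Definition psi_neg (N n : nat) : Cx :=
  q ^ tri (S n) * qpoch (B / q ^ S n) q (S n) / z ^ S n
  * (qbin q (2 * N) (N - S n) * qpoch b q (N - S n) * qpoch B q N).

Lemma bilateral_vandermonde (N : nat) :
  Csum (psi_pos N) (S N) + Csum (psi_neg N) N = qpoch (- (q / z)) q N * qpoch (- z) q N.
Proof.
  pose proof (q_vandermonde b (2 * N) (- (z / q ^ N))) as V.
  pose proof (Cpow_neq0 q N hq0) as QN. pose proof (Cpow_neq0 q (tri N) hq0) as QT.
  pose proof (Cpow_neq0 z N hz0) as ZN.
  set (K := z ^ N / q ^ tri N).
  assert (HK : K <> Cx0) by (apply Cdiv_neq0; assumption).
  assert (ER : qpoch (- (z / q ^ N)) q (2 * N) = K * (qpoch (- (q / z)) q N * qpoch (- z) q N)).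
  { replace (2 * N)%nat with (N + N)%nat by lia. rewrite qpoch_add.
    replace (- (z / q ^ N)) with ((- z) / q ^ N) by (unfold Cdiv; ring).
    rewrite qpoch_rev_div by (try apply Copp_neq0; assumption).
    rewrite (Cpow_opp z). replace (- z / q ^ N * q ^ N) with (- z) by (field; nz).
    replace (q / - z) with (- (q / z)) by (field; nz).
    unfold K. pose proof (Cpow_m1_sq N) as M.
    transitivity ((- Cx1) ^ N * (- Cx1) ^ N * z ^ N * qpoch (- (q / z)) q N / q ^ tri N * qpoch (- z) q N).
    - unfold Cdiv; ring.
    - rewrite M. unfold Cdiv; ring. }
  rewrite ER in V. clear ER.
  replace (S (2 * N)) with (N + S N)%nat in V by lia.
  rewrite Csum_split, Csum_rev in V.
  rewrite (Csum_ext _ (fun n => K * psi_neg N n)) in V.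
  - rewrite (Csum_ext _ (fun k => K * psi_pos N k) (S N)) in V.
    + rewrite !Csum_mul in V.
      transitivity ((K * Csum (psi_neg N) N + K * Csum (psi_pos N) (S N)) / K); [field; nz|].
      rewrite V. field; nz.
    + intros k Hk. unfold psi_pos, K, B.
      replace (b * - (z / q ^ N) * q ^ (N + k)) with (- (b * z) * q ^ k) by (rewrite Cpow_add; field; nz).
      replace (2 * N - (N + k))%nat with (N - k)%nat by lia.
      replace (- - (z / q ^ N)) with (z / q ^ N) by ring. rewrite Cpow_div, Cpow_pow by assumption.
      rewrite (Cpow_add z).
      replace (q ^ C2 (N + k)) with (q ^ (N * (N + k)) * q ^ C2 k / q ^ tri N).
      2:{ apply Cdiv_eq; [exact QT|]. rewrite <- !Cpow_add. f_equal.
          pose proof (C2_double (N + k)). pose proof (C2_double k). pose proof (tri_double N). nia. } field; nz.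
  - intros n Hn. unfold psi_neg, K, B. set (m := S n).
    replace (b * - (z / q ^ N) * q ^ (N - m)) with (- (b * z) / q ^ m).
    2:{ replace (q ^ N) with (q ^ m * q ^ (N - m)) by (rewrite <- Cpow_add; f_equal; lia). field; nz. }
    replace (2 * N - (N - m))%nat with (m + N)%nat by lia. rewrite (qpoch_add (- (b * z) / q ^ m)).
    replace (- (b * z) / q ^ m * q ^ m) with (- (b * z)) by (field; apply Cpow_neq0, hq0).
    replace (- - (z / q ^ N)) with (z / q ^ N) by ring. rewrite Cpow_div, Cpow_pow by assumption.
    replace (z ^ N) with (z ^ (N - m) * z ^ m) by (rewrite <- Cpow_add; f_equal; lia).
    replace (q ^ C2 (N - m)) with (q ^ (N * (N - m)) * q ^ tri m / q ^ tri N).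
    2:{ apply Cdiv_eq; [exact QT|]. rewrite <- !Cpow_add. f_equal.
        pose proof (C2_double (N - m)). pose proof (tri_double m). pose proof (tri_double N).
        assert (N = N - m + m)%nat by lia. set (j := (N - m)%nat) in *. clearbody j. subst N. nia. } field; nz.
Qed.

End Shifted.
End QBinomial.

(** * Letting N tend to infinity in the q-Vandermonde sum *)

Section QBinLimit.
Variable q : Cx.
Hypothesis hq : Cnorm q < 1.
Let x := Cnorm q.
Let Hx : 0 <= x < 1. Proof. split; [apply Cnorm_ge0 | exact hq]. Qed.

Lemma qbin_eq (i j : nat) : qbin q (i + j) j = (qpoch q q (i + j) / (qpoch q q j * qpoch q q i))%Cx.
Proof.
  assert (N : forall n, qpoch q q n <> Cx0) by (intros n; apply qpoch_neq0; apply (one_minus_small_pow_neq0 q q hq hq)).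
  rewrite <- qbin_fact. pose proof (N i). pose proof (N j). field; nz.
Qed.

Definition qbin_bound : R := ubound q x / (lbound q x * lbound q x).

Lemma qbin_bound_pos : 0 < qbin_bound.
Proof.
  unfold qbin_bound. pose proof (lbound_pos q x). apply Rdiv_lt_0_compat; [apply exp_pos | nra].
Qed.

Lemma qbin_le (n k : nat) : Cnorm (qbin q n k) <= qbin_bound.
Proof.
  pose proof (lbound_pos q x) as L. pose proof qbin_bound_pos.
  destruct (Nat.le_gt_cases k n) as [Hk|Hk].
  - replace n with (n - k + k)%nat by lia. rewrite qbin_eq.
    apply Cnorm_div_le; [apply (qpoch_le q hq); unfold x; lra | nra |].
    apply Cnorm_mul_ge; try exact L; apply (qpoch_ge q hq); unfold x; lra.
  - rewrite qbin_small by exact Hk. rewrite Cnorm_0. lra.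
Qed.

Lemma qbin_cv (Q : Cx) (i j : nat -> nat) : qpoch_inf_cv q q Q ->
  (forall N, (N <= i N)%nat) -> (forall N, (N <= j N)%nat) ->
  Cseq_cv (fun N => qbin q (i N + j N) (j N)) (Cx1 / Q)%Cx.
Proof.
  intros HQ Hi Hj. assert (NQ := qpoch_inf_neq0 q hq q Q hq HQ).
  apply (cv_ext (fun N => qpoch q q (i N + j N) / (qpoch q q (j N) * qpoch q q (i N)))%Cx).
  - intros N. symmetry. apply qbin_eq.
  - replace (Cx1 / Q)%Cx with (Q / (Q * Q))%Cx by (field; nz).
    apply cv_div; [| |apply Cmul_neq0; exact NQ].
    + apply (cv_subseq (qpoch q q) Q (fun N => i N + j N)%nat); [intros n; specialize (Hi n); lia | exact HQ].
    + apply cv_mul; [apply (cv_subseq (qpoch q q) Q j) | apply (cv_subseq (qpoch q q) Q i)]; assumption.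
Qed.

Lemma cv_shift_index (u : nat -> Cx) (l : Cx) (k : nat) :
  Cseq_cv (fun N => u (N + k)%nat) l -> Cseq_cv u l.
Proof.
  intros H e He. destruct (H e He) as [N HN]. exists (N + k)%nat. intros n Hn.
  replace n with (n - k + k)%nat by lia. apply HN. lia.
Qed.

Lemma qbin_central_cv (Q : Cx) (k : nat) : qpoch_inf_cv q q Q ->
  Cseq_cv (fun N => qbin q (2 * N) (N + k)) (Cx1 / Q)%Cx /\ Cseq_cv (fun N => qbin q (2 * N) (N - k)) (Cx1 / Q)%Cx.
Proof.
  intros HQ. split; apply (cv_shift_index _ _ k).
  - apply (cv_ext (fun N => qbin q (N + (N + k + k)) (N + k + k))).
    + intros N. f_equal. lia.
    + apply (qbin_cv Q (fun N => N) (fun N => N + k + k)%nat HQ); intros; lia.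
  - apply (cv_ext (fun N => qbin q (N + k + k + N) N)).
    + intros N. f_equal; lia.
    + apply (qbin_cv Q (fun N => N + k + k)%nat (fun N => N) HQ); intros; lia.
Qed.

Variables b z : Cx.
Hypothesis hq0 : q <> Cx0.
Hypothesis hz0 : z <> Cx0.
Let B : Cx := (- (b * z))%Cx.
Hypothesis hb : Cnorm b < 1.
Hypothesis hB : Cnorm B < 1.

(* the limiting case A -> oo of Ramanujan's 1psi1 summation *)
Lemma bilateral_vandermonde_limit (C1 C2' r1 r2 : R) (Q b_inf B_inf K1 K2 : Cx) :
  0 <= C1 -> 0 <= C2' -> 0 <= r1 < 1 -> 0 <= r2 < 1 ->
  (forall k, Cnorm (z ^ k * q ^ C2 k)%Cx <= C1 * r1 ^ k) ->
  (forall n, Cnorm (q ^ tri (S n) * qpoch (B / q ^ S n) q (S n) / z ^ S n)%Cx <= C2' * r2 ^ n) ->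
  qpoch_inf_cv q q Q -> qpoch_inf_cv b q b_inf -> qpoch_inf_cv B q B_inf ->
  qpoch_inf_cv (- (q / z))%Cx q K1 -> qpoch_inf_cv (- z)%Cx q K2 ->
  exists lp ln, Cseries_cv (fun k => z ^ k * q ^ C2 k / qpoch B q k)%Cx lp /\
    Cseries_cv (fun n => q ^ tri (S n) * qpoch (B / q ^ S n) q (S n) / z ^ S n)%Cx ln /\
    (lp + ln = Q * K1 * K2 / (b_inf * B_inf))%Cx.
Proof.
  intros HC1 HC2 Hr1 Hr2 Bd1 Bd2 HQ Hb HB HK1 HK2.
  assert (NQ := qpoch_inf_neq0 q hq q Q hq HQ). assert (Nb := qpoch_inf_neq0 q hq _ _ hb Hb).
  assert (NB := qpoch_inf_neq0 q hq _ _ hB HB).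
  pose proof qbin_bound_pos as QP.
  pose proof (exp_pos (Cnorm b * (1 / (1 - x)))) as Ub. fold (ubound q (Cnorm b)) in Ub.
  pose proof (exp_pos (Cnorm B * (1 / (1 - x)))) as UB. fold (ubound q (Cnorm B)) in UB.
  set (U := qbin_bound * ubound q (Cnorm b) * ubound q (Cnorm B)).
  assert (HU : 0 <= U) by (unfold U; apply Rlt_le, Rmult_lt_0_compat; [apply Rmult_lt_0_compat|]; assumption).
  assert (NBk : forall k, qpoch B q k <> Cx0) by (intros k; apply qpoch_neq0, one_minus_small_pow_neq0; assumption).
  destruct (tannery_partial (psi_pos q b z) (fun k => z ^ k * q ^ C2 k / qpoch B q k * (Cx1 / Q * b_inf * B_inf))%Cx
     S (C1 * U) r1 Hr1) as [lp [Lp1 Lp2]].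
  { apply Rmult_le_pos; assumption. } { lia. }
  { intros N k. unfold psi_pos. replace (C1 * U * r1 ^ k) with (C1 * r1 ^ k * U) by ring.
    apply Cnorm_mul_le; [apply Bd1|]. unfold U.
    apply Cnorm_mul_le; [apply Cnorm_mul_le; [apply qbin_le | apply (qpoch_le q hq); lra]|].
    apply (qpoch_le q hq). fold B. rewrite Cnorm_mul, Cnorm_pow. fold x.
    pose proof (pow_le_1 x k ltac:(lra)). pose proof (Cnorm_ge0 B). nra. }
  { intros k. unfold psi_pos. fold B.
    replace (z ^ k * q ^ C2 k / qpoch B q k * (Cx1 / Q * b_inf * B_inf))%Cx
      with (z ^ k * q ^ C2 k * (Cx1 / Q * b_inf * (B_inf / qpoch B q k)))%Cx.
    2:{ specialize (NBk k). field; nz. }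
    apply cv_mul; [apply cv_const|]. apply cv_mul; [apply cv_mul|].
    - apply (qbin_central_cv Q k HQ).
    - apply (cv_subseq (qpoch b q) _ (fun N => N + k)%nat); [intros; lia | exact Hb].
    - apply (cv_shift_index _ _ k).
      apply (cv_ext (fun N => qpoch B q (k + N) / qpoch B q k)%Cx).
      + intros N. replace (N + k - k)%nat with N by lia. rewrite qpoch_add. specialize (NBk k). field; nz.
      + apply cv_div; [|apply cv_const|apply NBk].
        apply (cv_subseq (qpoch B q) _ (fun N => k + N)%nat); [intros; lia | exact HB]. }
  destruct (tannery_partial (psi_neg q b z) (fun n => q ^ tri (S n) * qpoch (B / q ^ S n) q (S n) / z ^ S n * (Cx1 / Q * b_inf * B_inf))%Cx
     (fun N => N) (C2' * U) r2 Hr2) as [ln [Ln1 Ln2]].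
  { apply Rmult_le_pos; assumption. } { lia. }
  { intros N n. unfold psi_neg. replace (C2' * U * r2 ^ n) with (C2' * r2 ^ n * U) by ring.
    apply Cnorm_mul_le; [apply Bd2|]. unfold U.
    apply Cnorm_mul_le; [apply Cnorm_mul_le; [apply qbin_le | apply (qpoch_le q hq); lra]|].
    apply (qpoch_le q hq). fold B. lra. }
  { intros n. unfold psi_neg. fold B.
    apply cv_mul; [apply cv_const|]. apply cv_mul; [apply cv_mul|].
    - apply (qbin_central_cv Q (S n) HQ).
    - apply cv_minus_index, Hb.
    - exact HB. }
  assert (NW : (Cx1 / Q * b_inf * B_inf)%Cx <> Cx0).
  { apply Cmul_neq0; [apply Cmul_neq0; [apply Cdiv_neq0; [exact Cx1_neq0 | exact NQ] | exact Nb] | exact NB]. }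
  set (W := (Cx1 / Q * b_inf * B_inf)%Cx) in *.
  assert (EQ : (lp + ln = K1 * K2)%Cx).
  { apply (cv_unique (fun N => Csum (psi_pos q b z N) (S N) + Csum (psi_neg q b z N) N)%Cx).
    - apply cv_add; assumption.
    - apply (cv_ext _ _ _ (fun N => eq_sym (bilateral_vandermonde q b z hq0 hz0 N))). apply cv_mul; assumption. }
  exists (Cinv W * lp)%Cx, (Cinv W * ln)%Cx. split; [|split].
  - apply (series_ext _ _ _ (series_mul (Cinv W) _ _ Lp1)). intros k.
    specialize (NBk k). field; nz.
  - apply (series_ext _ _ _ (series_mul (Cinv W) _ _ Ln1)). intros k. field; nz.
  - transitivity (Cinv W * (lp + ln))%Cx; [ring|]. rewrite EQ. unfold W. field; nz.
Qed.

End QBinLimit.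

Lemma gauss_bound_pow (q : Cx) (e : nat -> nat) : Cnorm q < 1 -> (forall n, (n * n <= e n)%nat) ->
  exists C, 0 <= C /\ forall n, Cnorm (q ^ e n)%Cx <= C * (1 / 2) ^ n.
Proof.
  intros hq H. destruct (gauss_bound 1 (Cnorm q)) as [C [HC HB]]; [lra | pose proof (Cnorm_ge0 q); lra |].
  exists C. split; [exact HC|]. intros n. eapply Rle_trans; [apply (Cnorm_pow_le q (e n) n hq (H n))|].
  specialize (HB n). rewrite pow1 in HB. lra.
Qed.

(* Jacobi's triple product for sum_k q^(8k^2+4k): its terms k = n and k = -1-n are the terms 2n and 2n+1 of this series. *)
Lemma triple_product_16 (q P1 P2 P3 : Cx) : Cnorm q < 1 -> q <> Cx0 ->
  qpoch_inf_cv (- (q ^ 4))%Cx (q ^ 16)%Cx P1 -> qpoch_inf_cv (- (q ^ 12))%Cx (q ^ 16)%Cx P2 ->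
  qpoch_inf_cv (q ^ 16)%Cx (q ^ 16)%Cx P3 ->
  Cseries_cv (fun n => q ^ (2 * n * n + 2 * n))%Cx (P1 * P2 * P3)%Cx.
Proof.
  intros hq hq0 H1 H2 H3.
  assert (h16 : Cnorm (q ^ 16)%Cx < 1).
  { eapply Rle_lt_trans; [apply (Cnorm_pow_S_le q 15 hq) | exact hq]. }
  assert (Z0 : (- (Cx0 * q ^ 12))%Cx = Cx0) by ring.
  assert (E1 : forall k, ((q ^ 12) ^ k * (q ^ 16) ^ C2 k = q ^ (8 * k * k + 4 * k))%Cx).
  { intros k. rewrite !Cpow_pow, <- Cpow_add. f_equal. pose proof (C2_double k). nia. }
  assert (E2 : forall n, ((q ^ 16) ^ tri (S n) * qpoch (- (Cx0 * q ^ 12) / (q ^ 16) ^ S n) (q ^ 16) (S n) / (q ^ 12) ^ S n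
     = q ^ (8 * S n * S n - 4 * S n))%Cx).
  { intros n. rewrite Z0. replace (Cx0 / (q ^ 16) ^ S n)%Cx with Cx0 by (unfold Cdiv; ring). rewrite qpoch_0_l.
    rewrite !Cpow_pow. apply Cdiv_eq; [apply Cpow_neq0, hq0|].
    transitivity (q ^ (16 * tri (S n)))%Cx; [ring|]. rewrite <- Cpow_add. f_equal. pose proof (tri_double (S n)). lia. }
  destruct (gauss_bound_pow q (fun k => 8 * k * k + 4 * k)%nat hq ltac:(intros; cbv beta; nia)) as [A1 [HA1 B1]].
  destruct (gauss_bound_pow q (fun n => 8 * S n * S n - 4 * S n)%nat hq ltac:(intros n; cbv beta; lia)) as [A2 [HA2 B2]].
  assert (O : forall Q, qpoch_inf_cv Cx0 Q Cx1).
  { intros Q. apply (cv_ext (fun _ => Cx1)); [intros; symmetry; apply qpoch_0_l | apply cv_const]. }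
  (* With b = 0 also B = -b z = 0, so the q-factorials in the terms become 1 and the triple product
     is left, with base q^16, z = q^12 and q^16/z = q^4. *)
  destruct (bilateral_vandermonde_limit (q ^ 16)%Cx h16 Cx0 (q ^ 12)%Cx (Cpow_neq0 _ _ hq0) (Cpow_neq0 _ _ hq0)
     ltac:(rewrite Cnorm_0; lra) ltac:(rewrite Z0, Cnorm_0; lra) A1 A2 (1/2) (1/2) P3 Cx1 Cx1 P1 P2 HA1 HA2
     ltac:(lra) ltac:(lra)) as (lp & ln & L1 & L2 & E).
  - intros k. rewrite E1. apply B1.
  - intros n. rewrite E2. apply B2.
  - exact H3.
  - apply O.
  - rewrite Z0. apply O.
  - replace (q ^ 16 / q ^ 12)%Cx with (q ^ 4)%Cx; [exact H1|].
    symmetry. apply Cdiv_eq; [apply Cpow_neq0, hq0|]. rewrite <- Cpow_add. reflexivity.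
  - exact H2.
  - destruct (gauss_bound_pow q (fun n => 2 * n * n + 2 * n)%nat hq ltac:(intros; cbv beta; nia)) as [A3 [HA3 B3]].
    destruct (series_geo_cv (fun n => q ^ (2 * n * n + 2 * n))%Cx A3 (1/2) ltac:(lra) HA3 B3) as [l [Hl _]].
    replace (P1 * P2 * P3)%Cx with l; [exact Hl|].
    transitivity (lp + ln)%Cx; [|rewrite E; field; nz].
    apply (cv_unique _ _ _ (series_pairs _ _ Hl)).
    apply (series_ext _ _ _ (series_add _ _ _ _ L1 L2)). intros n.
    rewrite E1, E2, Z0, qpoch_0_l.
    replace (2 * (2 * n) * (2 * n) + 2 * (2 * n))%nat with (8 * n * n + 4 * n)%nat by lia.
    replace (2 * S (2 * n) * S (2 * n) + 2 * S (2 * n))%nat with (8 * S n * S n - 4 * S n)%nat by lia. field; nz.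
Qed.

(** * The identity for psi *)

Section JacobiCube.
Local Open Scope C_scope.
Variable q : Cx.

(** The coefficient of z^(-m) in (z)_(N+1) (q/z)_N; the coefficient of z^(m+1) is its negative.
    Dividing such a pair by 1 - z and putting z = 1 gives the weight 2m + 1. *)
Definition cube_coef (N m : nat) : Cx := (- Cx1) ^ m * q ^ tri m * qbin q (2 * N + 1) (N + 1 + m).
Definition odd_number (m : nat) : Cx := CINR (2 * m + 1).

Lemma odd_number_E (m : nat) : odd_number m = (Cx1 + Cx1) * CINR m + Cx1.
Proof. unfold odd_number. rewrite Nat.add_1_r, CINR_S, CINR_mul, CINR_2. reflexivity. Qed.

Lemma qbin_middle (N : nat) : qbin q (2 * N + 1) N = qbin q (2 * N + 1) (N + 1).
Proof.
  assert (Sym : forall M k, (k <= M)%nat -> qbin q M (M - k) = qbin q M k).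
  { clear. induction M as [|M IH]; intros k Hk.
    - replace k with O by lia. reflexivity.
    - destruct k as [|k]; [rewrite Nat.sub_0_r, qbin_0_r; apply qbin_diag|].
      destruct (Nat.eq_dec k M) as [->|Hne]; [rewrite Nat.sub_diag, qbin_0_r, qbin_diag; reflexivity|].
      replace (S M - S k)%nat with (S (M - S k)) by lia.
      rewrite qbin_SS, qbin_pascal_r. rewrite (IH (S k)) by lia.
      replace (S (M - S k)) with (M - k)%nat by lia. rewrite (IH k) by lia. reflexivity. }
  rewrite <- (Sym (2 * N + 1)%nat N) by lia. f_equal. lia.
Qed.

(** Passing from N to N + 1 multiplies by (1 - y z)(1 - y/z) = 1 + y^2 - y (z + 1/z), where y =
    q^(N+1). *)
Lemma cube_coef_S (N m : nat) : (m < N + 1)%nat ->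
  cube_coef (S N) (S m) = (Cx1 + q ^ (N + 1) * q ^ (N + 1)) * cube_coef N (S m)
                          - q ^ (N + 1) * (cube_coef N m + cube_coef N (S (S m))).
Proof.
  intros Hm. unfold cube_coef.
  replace (2 * S N + 1)%nat with (S (S (2 * N + 1))) by lia.
  replace (S N + 1 + S m)%nat with (S (S (N + 1 + m))) by lia. rewrite qbin_pascal2.
  replace (2 * N + 1 - (N + 1 + m))%nat with (N - m)%nat by lia.
  replace (N + 1 + S m)%nat with (S (N + 1 + m)) by lia.
  replace (N + 1 + S (S m))%nat with (S (S (N + 1 + m))) by lia.
  assert (E1 : q ^ tri (S m) * q ^ (N - m) = q ^ (N + 1) * q ^ tri m).
  { rewrite <- !Cpow_add. f_equal. simpl. lia. }
  assert (E2 : q ^ tri (S m) * q ^ S (S (N + 1 + m)) = q ^ (N + 1) * q ^ tri (S (S m))).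
  { rewrite <- !Cpow_add. f_equal. simpl. lia. }
  replace (q ^ (N + 1) * q ^ (N + 1)) with (q ^ S (2 * N + 1)) by (rewrite <- Cpow_add; f_equal; lia).
  transitivity ((- Cx1) ^ S m * ((q ^ tri (S m) * q ^ (N - m)) * qbin q (2 * N + 1) (N + 1 + m)
     + q ^ tri (S m) * (Cx1 + q ^ S (2 * N + 1)) * qbin q (2 * N + 1) (S (N + 1 + m))
     + (q ^ tri (S m) * q ^ S (S (N + 1 + m))) * qbin q (2 * N + 1) (S (S (N + 1 + m))))); [ring|].
  rewrite E1, E2. cbn [Cpow]. ring.
Qed.

(** The neighbour at m = -1 is minus the coefficient at m = 0, by antisymmetry; hence the extra
    q^(N+1) in the first factor. *)
Lemma cube_coef_0 (N : nat) :
  cube_coef (S N) 0 = (Cx1 + q ^ (N + 1) + q ^ (N + 1) * q ^ (N + 1)) * cube_coef N 0 - q ^ (N + 1) * cube_coef N 1.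
Proof.
  unfold cube_coef.
  replace (2 * S N + 1)%nat with (S (S (2 * N + 1))) by lia.
  replace (S N + 1 + 0)%nat with (S (S N)) by lia. rewrite qbin_pascal2, qbin_middle.
  replace (2 * N + 1 - N)%nat with (N + 1)%nat by lia.
  replace (N + 1 + 0)%nat with (N + 1)%nat by lia. replace (N + 1 + 1)%nat with (S (S N)) by lia.
  replace (q ^ (N + 1) * q ^ (N + 1)) with (q ^ S (2 * N + 1)) by (rewrite <- Cpow_add; f_equal; lia).
  replace (S N) with (N + 1)%nat by lia. simpl. ring.
Qed.

(* summation by parts: 2 m + 1 is harmonic for the second difference *)
Lemma odd_number_parts (c : nat -> Cx) (K : nat) :
  Csum (fun m => (c m + c (S (S m))) * odd_number (S m)) K
  = (Cx1 + Cx1) * Csum (fun m => c m * odd_number m) K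
    + c K * (odd_number K - (Cx1 + Cx1)) + c (S K) * odd_number K + c O - c 1%nat.
Proof.
  induction K as [|K IH]; simpl Csum.
  - rewrite odd_number_E. replace (CINR 0) with Cx0 by reflexivity. ring.
  - rewrite IH, !odd_number_E, !CINR_S. ring.
Qed.

Lemma cube_coef_small (N m : nat) : (N < m)%nat -> cube_coef N m = Cx0.
Proof. intros H. unfold cube_coef. rewrite qbin_small by lia. ring. Qed.

(** By [odd_number_parts] the sum of the two neighbours acts on the weights as multiplication by 2.
    The recurrence therefore multiplies the sum by 1 + y^2 - 2y = (1 - y)^2 with y = q^(N+1), the
    new factors on the right. *)
Lemma jacobi_cube_finite (N : nat) :
  Csum (fun m => cube_coef N m * odd_number m) (S N) = qpoch q q N * qpoch q q N.
Proof.
  induction N as [|N IH].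
  - unfold cube_coef, qpoch. simpl. rewrite odd_number_E. replace (CINR 0) with Cx0 by reflexivity. ring.
  - rewrite Csum_S_l, cube_coef_0.
    rewrite (Csum_ext _ (fun m => (Cx1 + q ^ (N + 1) * q ^ (N + 1)) * (cube_coef N (S m) * odd_number (S m))
        + - q ^ (N + 1) * ((cube_coef N m + cube_coef N (S (S m))) * odd_number (S m)))).
    2:{ intros m Hm. rewrite cube_coef_S by lia. ring. }
    rewrite Csum_add, !Csum_mul, odd_number_parts.
    rewrite (cube_coef_small N (S N)), (cube_coef_small N (S (S N))) by lia. rewrite IH.
    assert (E : Csum (fun m => cube_coef N (S m) * odd_number (S m)) (S N)
        = qpoch q q N * qpoch q q N - cube_coef N 0 * odd_number 0).
    { rewrite <- IH. cbn [Csum]. rewrite (cube_coef_small N (S N)) by lia.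
      pose proof (Csum_S_l (fun m => cube_coef N m * odd_number m) N) as L. cbn [Csum] in L. rewrite L. ring. }
    rewrite E, qpoch_S. rewrite (odd_number_E 0). replace (CINR 0) with Cx0 by reflexivity.
    rewrite Nat.add_1_r. simpl. ring.
Qed.

End JacobiCube.

Lemma jacobi_cube (q Q : Cx) : Cnorm q < 1 -> qpoch_inf_cv q q Q ->
  Cseries_cv (fun m => (- Cx1) ^ m * q ^ tri m * odd_number m)%Cx (Q * Q * Q)%Cx.
Proof.
  intros hq HQ. pose proof (Cnorm_ge0 q) as Hx0. set (x := Cnorm q) in *.
  assert (NQ := qpoch_inf_neq0 q hq q Q hq HQ).
  (* The exponent m(m+1)/2 grows only like m^2/2, so the Gaussian bound is taken for y = |q|^(1/2);
     its base 4 comes from 2m + 1 <= 2 * 4^m. *)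
  set (y := sqrt x). assert (Hy : y * y = x) by (apply sqrt_sqrt; exact Hx0).
  assert (Hy0 : 0 <= y) by apply sqrt_pos. assert (Hy1 : y < 1) by nra.
  destruct (gauss_bound 4 y) as [C [HC HB]]; [lra | lra |].
  pose proof (qbin_bound_pos q) as QP.
  destruct (tannery_partial (fun N m => cube_coef q N m * odd_number m)%Cx
     (fun m => (- Cx1) ^ m * q ^ tri m * (Cx1 / Q) * odd_number m)%Cx S (qbin_bound q * 2 * C) (1/2) ltac:(lra))
    as [l [Hl1 Hl2]].
  - apply Rmult_le_pos; lra.
  - lia.
  - intros N m. unfold cube_coef, odd_number. rewrite !Cnorm_mul, Cnorm_CINR, !Cnorm_pow, Cnorm_opp, Cnorm_1, pow1.
    fold x. pose proof (qbin_le q hq (2 * N + 1) (N + 1 + m)) as U. pose proof (Cnorm_ge0 (qbin q (2 * N + 1) (N + 1 + m))) as U0.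
    assert (T : x ^ tri m <= y ^ (m * m)).
    { rewrite <- Hy, Rpow_mult_distr, <- pow_add. replace (tri m + tri m)%nat with (m * m + m)%nat by (pose proof (tri_double m); lia).
      rewrite pow_add. pose proof (pow_le y (m * m) Hy0). pose proof (pow_le_1 y m ltac:(lra)). nra. }
    assert (T0 : 0 <= x ^ tri m) by (apply pow_le; exact Hx0).
    assert (I : INR (2 * m + 1) <= 2 * 4 ^ m).
    { eapply Rle_trans; [apply INR_le_pow2|]. rewrite pow_add, pow_mult. simpl (2 ^ 1). replace (2 ^ 2) with 4 by ring. lra. }
    specialize (HB m). pose proof (pos_INR (2 * m + 1)) as I0.
    replace (qbin_bound q * 2 * C * (1 / 2) ^ m) with (qbin_bound q * 2 * (C * (1 / 2) ^ m)) by ring.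
    apply Rle_trans with (y ^ (m * m) * qbin_bound q * (2 * 4 ^ m)).
    + rewrite Rmult_1_l. apply Rmult_le_compat; [nra | exact I0 | apply Rmult_le_compat; assumption | exact I].
    + replace (y ^ (m * m) * qbin_bound q * (2 * 4 ^ m)) with (qbin_bound q * 2 * (4 ^ m * y ^ (m * m))) by ring.
      apply Rmult_le_compat_l; lra.
  - intros m. apply cv_mul; [|apply cv_const]. apply cv_mul; [apply cv_const|].
    apply (cv_shift_index _ _ m).
    apply (cv_ext (fun N => qbin q (N + (N + 1 + m + m)) (N + 1 + m + m))).
    + intros N. f_equal; lia.
    + apply (qbin_cv q hq Q (fun N => N) (fun N => N + 1 + m + m)%nat HQ); intros; lia.
  - assert (El : l = (Q * Q)%Cx).
    { apply (cv_unique _ _ _ Hl2). apply (cv_ext _ _ _ (fun N => eq_sym (jacobi_cube_finite q N))). apply cv_mul; exact HQ. }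
    rewrite El in Hl1. replace (Q * Q * Q)%Cx with (Q * (Q * Q))%Cx by ring.
    apply (series_ext _ _ _ (series_mul Q _ _ Hl1)). intros m. field; nz.
Qed.

Lemma qpoch_even_odd (a q : Cx) (n : nat) :
  qpoch a q (2 * n) = (qpoch a (q ^ 2) n * qpoch (a * q) (q ^ 2) n)%Cx.
Proof.
  induction n as [|n IH]; [unfold qpoch; simpl; ring|].
  replace (2 * S n)%nat with (S (S (2 * n))) by lia. rewrite !qpoch_S, IH.
  rewrite Cpow_pow. cbn [Cpow]. ring.
Qed.

(** * The bilateral sum for psi and its Cesaro part *)

Section Psi.
Variable q : Cx.
Hypothesis hq : Cnorm q < 1.
Hypothesis hq0 : q <> Cx0.
Let x := Cnorm q.
Let Hx : 0 <= x < 1. Proof. split; [apply Cnorm_ge0 | exact hq]. Qed.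
Let hq2 : Cnorm (q ^ 2)%Cx < 1.
Proof. eapply Rle_lt_trans; [apply (Cnorm_pow_S_le q 1 hq) | exact hq]. Qed.

(** The differences (q;q^2)_n - (q;q^2)_(n+1) with alternating signs. *)
Definition psi_tail (n : nat) : Cx := ((- Cx1) ^ n * q ^ (2 * n + 1) * qpoch q (q ^ 2) n)%Cx.

Lemma psi_tail_bound : exists C, 0 <= C /\ forall n, Cnorm (psi_tail n) <= C * x ^ n.
Proof.
  pose proof (exp_pos (x * (1 / (1 - Cnorm (q ^ 2)%Cx)))) as U. fold (ubound (q ^ 2)%Cx x) in U.
  exists (ubound (q ^ 2)%Cx x). split; [lra|]. intros n. unfold psi_tail.
  rewrite Rmult_comm. apply Cnorm_mul_le; [|apply (qpoch_le _ hq2); unfold x; lra].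
  rewrite Cnorm_mul, !Cnorm_pow, Cnorm_opp, Cnorm_1, pow1, Rmult_1_l. fold x.
  replace (2 * n + 1)%nat with (n + (n + 1))%nat by lia. rewrite pow_add.
  pose proof (pow_le_1 x (n + 1) ltac:(lra)). pose proof (pow_le x n ltac:(lra)). nra.
Qed.

(** Summation by parts: twice the divergent alternating sum is a convergent series plus an
    oscillating term, and only the latter calls for Cesaro means. *)
Lemma alternating_partial (K : nat) :
  ((Cx1 + Cx1) * Csum (fun n => qpoch q (q ^ 2) n * (- Cx1) ^ n) K
   = Cx1 - (- Cx1) ^ K * qpoch q (q ^ 2) K + Csum psi_tail K)%Cx.
Proof.
  induction K as [|K IH]; [unfold qpoch; simpl; ring|].
  cbn [Csum].
  transitivity ((Cx1 + Cx1) * Csum (fun n => qpoch q (q ^ 2) n * (- Cx1) ^ n) K + (Cx1 + Cx1) * (qpoch q (q ^ 2) K * (- Cx1) ^ K))%Cx; [ring|].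
  rewrite IH, qpoch_S.
  replace (psi_tail K) with ((- Cx1) ^ K * (q ^ (2 * K) * q) * qpoch q (q ^ 2) K)%Cx
    by (unfold psi_tail; rewrite (Cpow_add q (2 * K) 1); simpl (q ^ 1)%Cx; ring).
  rewrite Cpow_pow. change ((- Cx1) ^ S K)%Cx with (- Cx1 * (- Cx1) ^ K)%Cx. ring.
Qed.

Lemma psi_cesaro (V : Cx) : Cseries_cv psi_tail V ->
  Ccesaro_cv (fun n => (qpoch q (q ^ 2) n * (- Cx1) ^ n)%Cx) ((Cx1 + V) / (Cx1 + Cx1))%Cx.
Proof.
  intros HV. set (a := fun n => (qpoch q (q ^ 2) n * (- Cx1) ^ n)%Cx). set (S0 := ((Cx1 + V) / (Cx1 + Cx1))%Cx).
  pose proof two_neq0 as H2.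
  destruct psi_tail_bound as [C [HC HB]].
  pose proof (series_geo_tail psi_tail V C x Hx HC HB HV) as Tail.
  set (U := ubound (q ^ 2)%Cx x). assert (HU : 0 < U) by apply exp_pos.
  assert (HCx : 0 <= C / (1 - x)) by (apply Rdiv_ge0; lra).
  assert (A2 : forall K, Cnorm ((Cx1 + Cx1) * Csum a K)%Cx <= 1 + U + (Cnorm V + C / (1 - x))).
  { intros K. unfold a. rewrite alternating_partial. eapply Rle_trans; [apply Cnorm_triang|].
    apply Rplus_le_compat.
    - eapply Rle_trans; [apply one_minus_le|]. apply Rplus_le_compat_l.
      rewrite Cnorm_mul, Cnorm_pow, Cnorm_opp, Cnorm_1, pow1, Rmult_1_l. apply (qpoch_le _ hq2). unfold x; lra.
    - replace (Csum psi_tail K) with (V + (Csum psi_tail K - V))%Cx by ring.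
      eapply Rle_trans; [apply Cnorm_triang|]. apply Rplus_le_compat_l.
      eapply Rle_trans; [apply Tail|]. pose proof (pow_le_1 x K ltac:(lra)). nra. }
  (* the Cesaro sums of a converge because the sums below stay bounded *)
  assert (Id : forall N, ((Cx1 + Cx1) * (Csum (fun k => Csum a (S k)) N - CINR N * S0)
     = Csum (fun k => Csum psi_tail (S k) - V) N - (Csum a (S N) - Cx1))%Cx).
  { induction N as [|N IH].
    - unfold a, qpoch; simpl. replace (CINR 0) with Cx0 by reflexivity. ring.
    - rewrite CINR_S.
      transitivity ((Cx1 + Cx1) * (Csum (fun k => Csum a (S k)) N - CINR N * S0)
        + (Cx1 + Cx1) * Csum a (S N) - (Cx1 + Cx1) * S0)%Cx.
      { change (Csum (fun k => Csum a (S k)) (S N)) with (Csum (fun k => Csum a (S k)) N + Csum a (S N))%Cx. ring. }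
      rewrite IH. unfold a at 2. rewrite alternating_partial. fold a.
      replace ((Cx1 + Cx1) * S0)%Cx with (Cx1 + V)%Cx by (unfold S0; field; nz).
      change (Csum (fun k => Csum psi_tail (S k) - V) (S N))%Cx
        with (Csum (fun k => Csum psi_tail (S k) - V) N + (Csum psi_tail (S N) - V))%Cx.
      change (Csum a (S (S N))) with (Csum a (S N) + qpoch q (q ^ 2) (S N) * (- Cx1) ^ S N)%Cx. ring. }
  set (M1 := C / (1 - x) * (1 / (1 - x))).
  assert (B1 : forall N, Cnorm (Csum (fun k => Csum psi_tail (S k) - V) N)%Cx <= M1).
  { intros N. apply Rle_trans with (C / (1 - x) * ((1 - x ^ N) / (1 - x))).
    - induction N as [|N IH].
      + simpl. rewrite Cnorm_0. right. field. lra.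
      + change (Csum (fun k => Csum psi_tail (S k) - V) (S N))%Cx
          with (Csum (fun k => Csum psi_tail (S k) - V) N + (Csum psi_tail (S N) - V))%Cx.
        eapply Rle_trans; [apply Cnorm_triang|].
        apply Rle_trans with (C / (1 - x) * ((1 - x ^ N) / (1 - x)) + C / (1 - x) * x ^ N).
        * apply Rplus_le_compat; [exact IH|]. eapply Rle_trans; [apply Tail|].
          apply Rmult_le_compat_l; [exact HCx|]. simpl. pose proof (pow_le x N ltac:(lra)). nra.
        * right. simpl. field. lra.
    - apply Rmult_le_compat_l; [exact HCx|]. apply Rmult_le_compat_r; [left; apply Rinv_0_lt_compat; lra|].
      pose proof (pow_le x N ltac:(lra)). lra. }
  assert (HM1 : 0 <= M1) by (specialize (B1 O); pose proof (Cnorm_ge0 (Csum (fun k => Csum psi_tail (S k) - V) 0)%Cx); lra).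
  set (M := M1 + (1 + U + (Cnorm V + C / (1 - x))) + 1).
  assert (n2 : Cnorm (Cx1 + Cx1)%Cx = 2).
  { replace (Cx1 + Cx1)%Cx with (RtoC 2) by (apply Cx_eq; simpl; ring). rewrite Cnorm_RtoC. apply Rabs_pos_eq. lra. }
  assert (B2 : forall N, Cnorm (Csum (fun k => Csum a (S k)) N - CINR N * S0)%Cx <= M).
  { intros N. pose proof (f_equal Cnorm (Id N)) as E. rewrite Cnorm_mul, n2 in E.
    set (z := Cnorm (Csum (fun k => Csum a (S k)) N - CINR N * S0)%Cx) in *. assert (0 <= z) by apply Cnorm_ge0.
    pose proof (A2 (S N)) as A. rewrite Cnorm_mul, n2 in A. pose proof (Cnorm_ge0 (Csum a (S N))) as A0.
    apply Rle_trans with (2 * z); [lra|]. rewrite E. eapply Rle_trans; [apply Cnorm_sub|].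
    unfold M. rewrite Rplus_assoc. apply Rplus_le_compat; [apply B1|].
    eapply Rle_trans; [apply Cnorm_sub|]. rewrite Cnorm_1. lra. }
  assert (HM : 0 < M).
  { unfold M. pose proof (Cnorm_ge0 V). lra. }
  intros e He. destruct (archimed_cor1 (e / M)) as [N0 [HN0 HN0']]; [apply Rdiv_lt_0_compat; lra|].
  exists N0. intros n Hn.
  assert (Pn : 0 < INR (S n)) by (apply lt_0_INR; lia).
  assert (Nn : RtoC (INR (S n)) <> Cx0) by (apply Cnorm_neq0; rewrite Cnorm_RtoC, Rabs_pos_eq; lra).
  replace (Csum (fun k => Csum a (S k)) (S n) / RtoC (INR (S n)) - S0)%Cx
    with ((Csum (fun k => Csum a (S k)) (S n) - CINR (S n) * S0) / RtoC (INR (S n)))%Cx by (unfold CINR; field; nz).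
  apply Rle_lt_trans with (M / INR (S n)).
  - apply Cnorm_div_le; [apply B2 | exact Pn | rewrite Cnorm_RtoC, Rabs_pos_eq; lra].
  - unfold Rdiv.
    apply Rle_lt_trans with (M * / INR N0).
    + apply Rmult_le_compat_l; [lra|]. apply Rinv_le_contravar; [apply lt_0_INR; lia | apply le_INR; lia].
    + replace e with (M * (e / M)) by (field; lra). apply Rmult_lt_compat_l; lra.
Qed.

(** The limiting 1psi1 sum with base q^2, b = -q^2 and z = q, hence B = q^3. Dividing by 1 - q
    completes (q^3;q^2)_k to (q;q^2)_(k+1) and turns the negative half into [psi_tail]. *)
Lemma psi_bilateral (M0 D0 E0 O3 : Cx) :
  qpoch_inf_cv (- q)%Cx (q ^ 2)%Cx M0 -> qpoch_inf_cv (q ^ 2)%Cx (q ^ 2)%Cx D0 ->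
  qpoch_inf_cv (- (q ^ 2))%Cx (q ^ 2)%Cx E0 -> qpoch_inf_cv (q * q ^ 2)%Cx (q ^ 2)%Cx O3 ->
  exists lp V, Cseries_cv (fun k => q ^ (k * k) / qpoch q (q ^ 2) (S k))%Cx lp /\
    Cseries_cv psi_tail V /\ (lp + V = D0 * M0 * M0 / (E0 * ((Cx1 - q) * O3)))%Cx.
Proof.
  intros HM HD HE HO.
  assert (N1 : (Cx1 - q)%Cx <> Cx0) by (apply one_minus_neq0; exact hq).
  assert (HBq : (- (- (q ^ 2) * q) = q * q ^ 2)%Cx) by ring.
  assert (nB : Cnorm (q * q ^ 2)%Cx < 1) by (rewrite Cnorm_mul; fold x; pose proof (Cnorm_ge0 (q ^ 2)%Cx); nra).
  assert (NO := qpoch_inf_neq0 (q ^ 2)%Cx hq2 _ _ nB HO).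
  assert (NE := qpoch_inf_neq0 (q ^ 2)%Cx hq2 _ _ ltac:(rewrite Cnorm_opp; exact hq2) HE).
  assert (q20 : (q ^ 2)%Cx <> Cx0) by (apply Cpow_neq0, hq0).
  assert (E1 : forall k, (q ^ k * (q ^ 2) ^ C2 k = q ^ (k * k))%Cx).
  { intros k. rewrite Cpow_pow, <- Cpow_add. f_equal. pose proof (C2_double k). lia. }
  assert (E2 : forall n, ((q ^ 2) ^ tri (S n) * qpoch (- (- (q ^ 2) * q) / (q ^ 2) ^ S n) (q ^ 2) (S n) / q ^ S n
     = (Cx1 - q) * psi_tail n)%Cx).
  { intros n. rewrite HBq. rewrite qpoch_rev_div; [|exact q20 | apply Cmul_neq0; assumption].
    rewrite qpoch_S_l. replace (q ^ 2 / (q * q ^ 2))%Cx with (Cx1 / q)%Cx by (field; nz).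
    replace (Cx1 / q * q ^ 2)%Cx with q by (simpl; field; nz).
    rewrite (Cpow_mul_l q (q ^ 2)%Cx), (Cpow_pow q 2 (S n)). unfold psi_tail.
    replace (2 * S n)%nat with (2 * n + 1 + 1)%nat by lia. rewrite (Cpow_add q (2 * n + 1) 1).
    pose proof (Cpow_neq0 q (S n) hq0) as Z1. pose proof (Cpow_neq0 _ (tri (S n)) q20) as Z2.
    change ((- Cx1) ^ S n)%Cx with (- Cx1 * (- Cx1) ^ n)%Cx. replace (q ^ 1)%Cx with q by (simpl; ring). intros. field; nz. }
  destruct (gauss_bound_pow q (fun k => k * k)%nat hq ltac:(intros; cbv beta; lia)) as [A1 [HA1 B1]].
  destruct psi_tail_bound as [A2 [HA2 B2]].
  pose proof (Cnorm_ge0 (Cx1 - q)%Cx) as P0.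
  destruct (bilateral_vandermonde_limit (q ^ 2)%Cx hq2 (- (q ^ 2))%Cx q q20 hq0
     ltac:(rewrite Cnorm_opp; exact hq2) ltac:(rewrite HBq; exact nB) A1 (Cnorm (Cx1 - q)%Cx * A2) (1/2) x D0 E0 O3 M0 M0 HA1
     ltac:(nra) ltac:(lra) Hx) as (lp & ln & L1 & L2 & E).
  - intros k. rewrite E1. apply B1.
  - intros n. rewrite E2, Cnorm_mul, Rmult_assoc. apply Rmult_le_compat_l; [exact P0 | apply B2].
  - exact HD.
  - exact HE.
  - rewrite HBq. exact HO.
  - replace (q ^ 2 / q)%Cx with q by (simpl; field; nz). exact HM.
  - exact HM.
  - exists (Cinv (Cx1 - q) * lp)%Cx, (Cinv (Cx1 - q) * ln)%Cx. split; [|split].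
    + apply (series_ext _ _ _ (series_mul (Cinv (Cx1 - q)%Cx) _ _ L1)). intros k.
      rewrite E1, HBq, qpoch_S_l.
      assert (Z : qpoch (q * q ^ 2)%Cx (q ^ 2)%Cx k <> Cx0) by (apply qpoch_neq0, one_minus_small_pow_neq0; assumption). intros. field; nz.
    + apply (series_ext _ _ _ (series_mul (Cinv (Cx1 - q)%Cx) _ _ L2)). intros n.
      rewrite E2. field; nz.
    + transitivity (Cinv (Cx1 - q) * (lp + ln))%Cx; [ring|]. rewrite E. field; nz.
Qed.

Lemma psi_identity : exists F Sr D T : Cx,
     mock_psi_cv q F /\
     Ccesaro_cv (fun n => (qpoch q (q ^ 2) n * (- Cx1) ^ n)%Cx) Sr /\
     qpoch_inf_cv (q ^ 2)%Cx (q ^ 2)%Cx D /\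
     Cbiseries_cv (fun r : Z =>
        (q ^^ (2 * r * r + r)%Z * (ZtoC 4 * ZtoC r + Cx1) * (- Cx1) ^^ r)%Cx) T /\
     F = (- Sr + Cx1 / (ZtoC 2 * (D * D)) * T)%Cx.
Proof.
  destruct (qpoch_cv _ hq2 (- q)%Cx) as [M0 HM]. destruct (qpoch_cv _ hq2 (q ^ 2)%Cx) as [D0 HD].
  destruct (qpoch_cv _ hq2 (- (q ^ 2))%Cx) as [E0 HE]. destruct (qpoch_cv _ hq2 (q * q ^ 2)%Cx) as [O3 HO].
  destruct (psi_bilateral M0 D0 E0 O3 HM HD HE HO) as (lp & V & Hlp & HV & E).
  assert (HO1 := qpoch_inf_S _ _ _ HO). set (O1 := ((Cx1 - q) * O3)%Cx) in *.
  assert (ND := qpoch_inf_neq0 _ hq2 _ _ hq2 HD).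
  assert (NE := qpoch_inf_neq0 _ hq2 _ _ ltac:(rewrite Cnorm_opp; exact hq2) HE).
  assert (NO := qpoch_inf_neq0 _ hq2 _ _ hq HO1).
  (* Euler's identity (q;q^2)(-q;q^2)(-q^2;q^2) = 1, the limit of (q)_(2n) (-q)_(2n) =
     (q^2;q^2)_(2n) after cancelling (q^2;q^2)_oo. *)
  assert (OME : (O1 * M0 * E0 = Cx1)%Cx).
  { assert (EQ : (O1 * D0 * (M0 * E0) = D0)%Cx).
    { apply (cv_unique (fun n => qpoch q q (2 * n) * qpoch (- q) q (2 * n))%Cx).
      - apply (cv_ext (fun n => qpoch q (q ^ 2) n * qpoch (q ^ 2) (q ^ 2) n * (qpoch (- q) (q ^ 2) n * qpoch (- (q ^ 2)) (q ^ 2) n))%Cx).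
        + intros n. rewrite !qpoch_even_odd. replace (q * q)%Cx with (q ^ 2)%Cx by (simpl; ring).
          replace (- q * q)%Cx with (- (q ^ 2))%Cx by (simpl; ring). reflexivity.
        + apply cv_mul; apply cv_mul; assumption.
      - apply (cv_ext (fun n => qpoch (q ^ 2)%Cx (q ^ 2)%Cx (2 * n))).
        + intros n. rewrite qpoch_pm. f_equal. simpl. ring.
        + apply (cv_subseq _ _ (fun n => 2 * n)%nat); [intros; lia | exact HD]. }
    transitivity (O1 * D0 * (M0 * E0) / D0)%Cx; [field; nz|]. rewrite EQ. field; nz. }
  assert (hmq : Cnorm (- q)%Cx < 1) by (rewrite Cnorm_opp; exact hq).
  destruct (qpoch_cv _ hmq (- q)%Cx) as [R HR].
  assert (ER : (R = M0 * D0)%Cx).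
  { apply (cv_unique (fun n => qpoch (- q)%Cx (- q)%Cx (2 * n))).
    - apply (cv_subseq _ _ (fun n => 2 * n)%nat); [intros; lia | exact HR].
    - apply (cv_ext (fun n => qpoch (- q) (q ^ 2) n * qpoch (q ^ 2) (q ^ 2) n)%Cx); [|apply cv_mul; assumption].
      intros n. rewrite qpoch_even_odd. replace ((- q) ^ 2)%Cx with (q ^ 2)%Cx by (simpl; ring).
      replace (- q * - q)%Cx with (q ^ 2)%Cx by (simpl; ring). reflexivity. }
  assert (HJ := series_pairs _ _ (jacobi_cube (- q)%Cx R hmq HR)).
  assert (n1 : forall n, 1 <= Cnorm ((- Cx1) ^ n)%Cx) by (intros n; rewrite Cnorm_pow, Cnorm_opp, Cnorm_1, pow1; lra).
  (* The sign is placed in the denominator, where it is its own inverse, to fit the shape of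
     [gauss_series_cv]. *)
  destruct (gauss_series_cv (fun n => q ^ (2 * n * n + n))%Cx (fun n => CINR 4 * CINR n * Cx1 + Cx1)%Cx
    (fun n => (- Cx1) ^ n)%Cx x 1 Hx ltac:(lra)) as [l1 Hl1].
  { intros n. apply Cnorm_pow_le; [exact hq | nia]. }
  { intros n. apply Cnorm_linear0; [lia | |]; rewrite Cnorm_1; lra. }
  { exact n1. }
  destruct (gauss_series_cv (fun n => q ^ (S n * (2 * n + 1)))%Cx (fun n => CINR 4 * CINR (S n) * (- Cx1) + Cx1)%Cx
    (fun n => (- Cx1) ^ S n)%Cx x 1 Hx ltac:(lra)) as [l2 Hl2].
  { intros n. apply Cnorm_pow_le; [exact hq | nia]. }
  { intros n. apply Cnorm_linear; [lia | rewrite Cnorm_opp |]; rewrite Cnorm_1; lra. }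
  { intros n. apply n1. }
  assert (m1inv : forall n, Cinv ((- Cx1) ^ n)%Cx = ((- Cx1) ^ n)%Cx).
  { intros n. destruct (Cpow_m1_cases n) as [->| ->]; apply Cx_eq; simpl; field. }
  (* The terms m = 2n and m = 2n + 1 of Jacobi's series at -q are the terms r = n and r = -(n + 1)
     here; 2m + 1 is 4r + 1 up to sign. *)
  assert (ET : (l1 + l2 = R * R * R)%Cx).
  { apply (cv_unique _ _ _ (series_add _ _ _ _ Hl1 Hl2)).
    apply (series_ext _ _ _ HJ). intros n.
    rewrite !odd_number_E. rewrite !(Cpow_opp q).
    assert (T1 : tri (2 * n) = (2 * n * n + n)%nat) by (pose proof (tri_double (2 * n)); lia).
    assert (T2 : tri (S (2 * n)) = (S n * (2 * n + 1))%nat) by (pose proof (tri_double (S (2 * n))); lia).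
    rewrite T1, T2.
    assert (M1 : ((- Cx1) ^ (2 * n) = Cx1)%Cx) by (rewrite two_e_mul; apply Cpow_m1_sq).
    assert (M2 : ((- Cx1) ^ (2 * n * n + n) = (- Cx1) ^ n)%Cx).
    { rewrite Cpow_add, <- Cpow_pow, M1, Cpow_1_l. ring. }
    assert (M3 : ((- Cx1) ^ (S n * (2 * n + 1)) = (- Cx1) ^ S n)%Cx).
    { replace (S n * (2 * n + 1))%nat with (2 * n * S n + S n)%nat by lia.
      rewrite Cpow_add, <- Cpow_pow, M1, Cpow_1_l. ring. }
    rewrite M2, M3. change ((- Cx1) ^ S (2 * n))%Cx with (- Cx1 * (- Cx1) ^ (2 * n))%Cx. rewrite M1.
    unfold Cdiv. rewrite !m1inv. rewrite (CINR_S (2 * n)), (CINR_S n), CINR_mul, CINR_4, CINR_2. ring. }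
  assert (NZ : forall k, qpoch q (q ^ 2)%Cx k <> Cx0) by (intros k; apply qpoch_neq0, one_minus_small_pow_neq0; assumption).
  destruct (gauss_series_cv (fun k => q ^ (k * k))%Cx (fun _ => Cx1) (qpoch q (q ^ 2)%Cx) x (lbound (q ^ 2)%Cx x)
    Hx (lbound_pos _ _)) as [cl Hcl].
  { intros k. apply Cnorm_pow_le; [exact hq | lia]. }
  { intros k. rewrite Cnorm_1. pose proof (pow_R1_Rle 2 k ltac:(lra)). lra. }
  { intros k. apply (qpoch_ge _ hq2); unfold x; lra. }
  assert (HF := series_unS _ _ Hcl).
  (* From 1 = (1 - q^(2k+1)) + q^(2k+1), each q^(k^2)/(q;q^2)_(k+1) is the k-th plus the (k+1)-st
     term of [cl]. As [cl] is 1 + psi(q), [lp] is 1 + 2 psi(q). *)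
  assert (E1 : (lp = cl + cl - Cx1)%Cx).
  { apply (cv_unique _ _ _ Hlp).
    pose proof (series_add _ _ _ _ Hcl HF) as H. cbv beta in H.
    replace (cl + (cl - q ^ (0 * 0) * Cx1 / qpoch q (q ^ 2) 0))%Cx with (cl + cl - Cx1)%Cx in H
      by (unfold qpoch; simpl; field; nz).
    apply (series_ext _ _ _ H). intros k.
    pose proof (NZ k) as Z1. pose proof (NZ (S k)) as Z2. rewrite qpoch_S in *.
    assert (Z3 : (Cx1 - q * (q ^ 2) ^ k)%Cx <> Cx0) by (intros Z; apply Z2; rewrite Z; ring).
    replace (S k * S k)%nat with (k * k + (2 * k) + 1)%nat by lia. rewrite !(Cpow_add q), <- (Cpow_pow q 2 k).
    replace (q ^ 1)%Cx with q by (simpl; ring). intros. field; nz. }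
  exists (cl - Cx1)%Cx, ((Cx1 + V) / (Cx1 + Cx1))%Cx, D0, (l1 + l2)%Cx.
  split; [|split; [apply psi_cesaro, HV | split; [exact HD | split]]].
  - replace (cl - Cx1)%Cx with (cl - q ^ (0 * 0) * Cx1 / qpoch q (q ^ 2) 0)%Cx by (unfold qpoch; simpl; field; nz).
    apply (series_ext _ _ _ HF). intros k. pose proof (NZ (S k)). field; nz.
  - exists l1, l2. split; [|split; [|reflexivity]].
    + apply (series_ext _ _ _ Hl1). intros n.
      replace (2 * Z.of_nat n * Z.of_nat n + Z.of_nat n)%Z with (Z.of_nat (2 * n * n + n)) by lia.
      rewrite !Cpowz_nat, ZtoC_nat, ZtoC_4, CINR_4. unfold Cdiv. rewrite m1inv. ring.
    + apply (series_ext _ _ _ Hl2). intros n.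
      replace (2 * - Z.of_nat (S n) * - Z.of_nat (S n) + - Z.of_nat (S n))%Z with (Z.of_nat (S n * (2 * n + 1))) by lia.
      rewrite Cpowz_nat, Cpowz_neg, ZtoC_neg, ZtoC_4, CINR_4. unfold Cdiv. ring.
  (* By Euler's identity 1/(E0 O1) = M0, so the left side is D0 M0^3 = (M0 D0)^3 / D0^2. *)
  - assert (X : (D0 * M0 * M0 / (E0 * O1) = R * R * R / (D0 * D0))%Cx).
    { rewrite ER. transitivity (D0 * M0 * M0 * (O1 * M0 * E0) / (E0 * O1))%Cx; [rewrite OME; field; nz|].
      field; nz. }
    rewrite E1, X in E. rewrite ET, ZtoC_2. pose proof two_neq0 as H2.
    transitivity (((cl + cl - Cx1 + V) - (Cx1 + V)) / (Cx1 + Cx1))%Cx; [field; nz|].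
    rewrite E. field; nz.
Qed.

End Psi.

Theorem mainTheorem2 (q : Cx) (hq : Cnorm q < 1) (hq0 : q <> Cx0) :
  (* identity for f *)
  (exists F Sr A B T : Cx,
     mock_f_cv q F /\
     Cseries_cv (fun m => (qpoch (- Cx1) q (S m) * qpoch (- Cx1) q (S m) * q ^ (S m))%Cx) Sr /\
     qpoch_inf_cv (- q)%Cx q A /\
     qpoch_inf_cv q q B /\
     Cbiseries_cv (fun r : Z =>
        (q ^^ (2 * r * r + r)%Z * (ZtoC 4 * ZtoC r * q ^^ r + Cx1)
         / ((Cx1 + q ^^ r) * (Cx1 + q ^^ r)))%Cx) T /\
     F = (- Sr + ZtoC 4 * (A * A) / (B * B * B) * T)%Cx) /\
  (* identity for phi *)
  (exists F Sr A B T : Cx,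
     mock_phi_cv q F /\
     Cseries_cv (fun m => (qpoch (- Cx1) (q ^ 2) (S m) * q ^ (S m))%Cx) Sr /\
     qpoch_inf_cv (- (q ^ 2))%Cx (q ^ 2)%Cx A /\
     qpoch_inf_cv q q B /\
     Cbiseries_cv (fun r : Z =>
        (q ^^ (2 * r * r + 2 * r)%Z * (ZtoC 2 * ZtoC r * q ^^ (2 * r)%Z + Cx1)
         / ((Cx1 + q ^^ (2 * r)%Z) * (Cx1 + q ^^ (2 * r)%Z)))%Cx) T /\
     F = (- Sr + ZtoC 4 * A / (B * B * B) * T)%Cx) /\
  (* identity for nu *)
  (exists F Sr A B T P1 P2 P3 : Cx,
     mock_nu_cv q F /\
     Cseries_cv (fun n => (qpoch (- q) (q ^ 2) n * q ^ n)%Cx) Sr /\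
     qpoch_inf_cv (- q)%Cx (q ^ 2)%Cx A /\
     qpoch_inf_cv q q B /\
     Cbiseries_cv (fun r : Z =>
        (q ^^ (2 * r * r + 2 * r)%Z * (ZtoC r + Cx1)
         / ((Cx1 + q ^^ (2 * r + 1)%Z) * (Cx1 + q ^^ (2 * r + 1)%Z)))%Cx) T /\
     qpoch_inf_cv (- (q ^ 4))%Cx (q ^ 16)%Cx P1 /\
     qpoch_inf_cv (- (q ^ 12))%Cx (q ^ 16)%Cx P2 /\
     qpoch_inf_cv (q ^ 16)%Cx (q ^ 16)%Cx P3 /\
     F = (- Sr + ZtoC 4 * A / (B * B * B) * T
          - ZtoC 2 * A / (B * B * B) * (P1 * P2 * P3))%Cx) /\
  (* identity for psi; the series sum_{n>=0} (q;q^2)_n (-1)^n is Cesaro-summed *)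
  (exists F Sr D T : Cx,
     mock_psi_cv q F /\
     Ccesaro_cv (fun n => (qpoch q (q ^ 2) n * (- Cx1) ^ n)%Cx) Sr /\
     qpoch_inf_cv (q ^ 2)%Cx (q ^ 2)%Cx D /\
     Cbiseries_cv (fun r : Z =>
        (q ^^ (2 * r * r + r)%Z * (ZtoC 4 * ZtoC r + Cx1) * (- Cx1) ^^ r)%Cx) T /\
     F = (- Sr + Cx1 / (ZtoC 2 * (D * D)) * T)%Cx).
Proof.
  split; [exact (f_identity q hq hq0)|]. split; [exact (phi_identity q hq hq0)|].
  split; [|exact (psi_identity q hq hq0)].
  assert (h16 : Cnorm (q ^ 16)%Cx < 1) by (eapply Rle_lt_trans; [apply (Cnorm_pow_S_le q 15 hq) | exact hq]).
  destruct (qpoch_cv _ h16 (- (q ^ 4))%Cx) as [P1 HP1]. destruct (qpoch_cv _ h16 (- (q ^ 12))%Cx) as [P2 HP2].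
  destruct (qpoch_cv _ h16 (q ^ 16)%Cx) as [P3 HP3].
  apply (nu_identity q hq hq0 P1 P2 P3 HP1 HP2 HP3), triple_product_16; assumption.
Qed.
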